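(* In the setting described in the context, suppose that one of the following conditions is satisfied: (i) $\sum_{k\ge0}\gamma_k=+\infty$, $\sum_{k\ge0}\gamma_k^2<\infty$ and $\lim_{k\to+\infty}\gamma_k^{-1}\ln(\gamma_{k-1}/\gamma_k)=0$; (ii) $\sum_{k\ge0}\gamma_k=+\infty$, $\sum_{k\ge0}\gamma_k^2<\infty$ and $\lim_{k\to+\infty}\gamma_k^{-1}\ln(\gamma_{k-1}/\gamma_k)=\gamma_*^{-1}<2R$ for some $\gamma_*>0$. Then for all $p\ge1$ there exists $C_p>0$ such that $$\lim_{n\to\infty}\gamma_n^{-1/2}\,\mathbb E\left[\sum_{i\in F^*}|x_n(i)-\nu(i)|^p\right]^{1/p}=C_p.$$
   Context: Let $F$ be a finite set containing an element $0$, and $F^*=F\setminus\{0\}$ with cardinality $d\ge 2$. Let $P=(P_{i,j})_{i,j\in F}$ be a stochastic matrix such that $0$ is absorbing ($P_{0,i}=0$ for all $i\in F^*$), $P_{i,0}>0$ for some $i\in F^*$, and $F^*$ is an irreducible class: $\sum_{k\ge 0}(P^k)_{i,j}>0$ for all $i,j\in F^*$. No aperiodicity is assumed. Let $\hat P=(P_{i,j})_{i,j\in F^*}$. Let $\Delta$ be the set of probability measures on $F^*$, identified with the unit simplex of $\mathbb{R}^d$. The quasi-stationary distribution $\nu$ is the unique element of $\Delta$ such that $\nu\hat P=\lambda\nu$ for some $\lambda\in(0,1)$; one has $\lambda = 1-\sum_{i\in F^*}\nu(i)P_{i,0}$. The eigenvalues of $\hat P$, with multiplicity, are $\lambda_1=\lambda,\lambda_2,\dots,\lambda_d$,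 with $1>\lambda_1\ge|\lambda_2|\ge\dots\ge|\lambda_d|\ge 0$ and $\lambda_i\ne\lambda$ for $i\ge2$. Set $$R=1-(1-\lambda)\max_{i\ge2}\mathrm{Re}\left(\frac1{1-\lambda_i}\right),$$ which is positive. For $x\in\Delta$ let $K[x]$ be the Markov kernel on $F^*$ given by $K[x]_{i,j}=P_{i,j}+P_{i,0}\,x(j)$. Let $(\gamma_n)_{n\ge0}$ be a decreasing sequence in $(0,1)$ with $\sum_{n}\gamma_n=+\infty$ and $\lim_{n\to\infty}\gamma_n\ln n=0$. Let $(X_n)_{n\ge0}$ be an $F^*$-valued process and $(x_n)_{n\ge0}$ a $\Delta$-valued process such that, with $\mathcal F_n=\sigma(X_k: k\le n)$: $x_0$ is $\mathcal F_0$-measurable (e.g. $x_0=\delta_{X_0}$), and for all $n\ge0$, $$\mathbb P(X_{n+1}=j\mid\mathcal F_n)=K[x_n]_{i,j}\ \text{ on } \{X_n=i\},\quad i,j\in F^*,\qquad x_{n+1}=(1-\gamma_n)x_n+\gamma_n\delta_{X_{n+1}}.$$ *)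

(* Defs.v *)
From HB Require Import structures.
From mathcomp Require Import all_boot all_order all_algebra.
From mathcomp Require Import complex.
From mathcomp Require Import all_classical all_reals all_analysis.

Set Implicit Arguments.
Unset Strict Implicit.
Unset Printing Implicit Defensive.

Import Order.TTheory GRing.Theory Num.Theory.
Import numFieldNormedType.Exports.

Local Open Scope classical_set_scope.
Local Open Scope ring_scope.
Local Open Scope complex_scope.

(* F^* = F \ {o}; [o] plays the role of the absorbing state 0. *)
Definition star (F : finType) (o : F) : finType := {i : F | i != o}.

Definition mx_of (R : Type) (I : finType) (A : I -> I -> R) : 'M[R]_#|I| :=
  \matrix_(i, j) A (enum_val i) (enum_val j).

Definition stochastic (R : realType) (F : finType) (P : F -> F -> R) : Prop :=
  (forall i j, 0 <= P i j) /\ (forall i, \sum_j P i j = 1).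

Definition mpow (R : realType) (I : finType) (A : I -> I -> R) (k : nat)
    (i j : I) : R :=
  (mx_of A ^+ k) (enum_rank i) (enum_rank j).

Definition absorbed_chain (R : realType) (F : finType) (o : F)
    (P : F -> F -> R) : Prop :=
  [/\ stochastic P,
      (forall i : star o, P o (val i) = 0),
      (exists i : star o, 0 < P (val i) o) &
      (forall i j : star o,
        (0 < \sum_(0 <= k <oo) (mpow P k (val i) (val j))%:E)%E)].

Definition hat (R : realType) (F : finType) (o : F) (P : F -> F -> R) :
    star o -> star o -> R :=
  fun i j => P (val i) (val j).

Definition simplex (R : realType) (I : finType) (v : I -> R) : Prop :=
  (forall i, 0 <= v i) /\ \sum_i v i = 1.

Definition quasi_stationary (R : realType) (F : finType) (o : F)
    (P : F -> F -> R) (nu : star o -> R) (lambda : R) : Prop :=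
  [/\ simplex nu, 0 < lambda < 1 &
      forall j, \sum_i nu i * hat P i j = lambda * nu j].

(* [lambda :: mu] lists the complex eigenvalues of A, with algebraic
   multiplicity, by nonincreasing modulus. *)
Definition eigenvalue_list (R : realType) (I : finType) (A : I -> I -> R)
    (lambda : R) (mu : seq R[i]) : Prop :=
  char_poly (map_mx (real_complex R) (mx_of A)) =
    \prod_(z <- lambda%:C :: mu) ('X - z%:P) /\
  sorted (fun z w : R[i] => `|w| <= `|z|) (lambda%:C :: mu).

(* The maximum is over the nonempty list mu; taking the value at its head as
   the neutral element adds nothing to it. *)
Definition rate (R : realType) (lambda : R) (mu : seq R[i]) : R :=
  1 - (1 - lambda) *
    \big[Num.max/complex.Re (1 - head 0 mu)^-1]_(z <- mu)
      complex.Re (1 - z)^-1.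

Definition kernelK (R : realType) (F : finType) (o : F) (P : F -> F -> R)
    (x : star o -> R) (i j : star o) : R :=
  P (val i) (val j) + P (val i) o * x j.

Definition step_sequence (R : realType) (gamma : R^nat) : Prop :=
  [/\ (forall n, 0 < gamma n < 1),
      nonincreasing_seq gamma,
      (series gamma @ \oo --> +oo) &
      (fun n => gamma n * ln (n%:R : R)) @ \oo --> (0 : R)].

(* The generators of F_n = sigma(X_k : k <= n). *)
Definition past (Omega I : Type) (X : nat -> Omega -> I) (n : nat) :
    set (set Omega) :=
  [set A | exists k, exists B : set I, (k <= n)%N /\ A = X k @^-1` B].

Definition sigma_measurable (R : realType) (Omega : pointedType)
    (G : set (set Omega)) (Y : Omega -> R) : Prop :=
  @measurable_fun _ _ (g_sigma_algebraType G) _ setT Y.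

(* Y is a version of Pr(A | sigma(G)). *)
Definition is_cond_prob (R : realType) (d : measure_display)
    (Omega : measurableType d) (Pr : probability Omega R)
    (G : set (set Omega)) (A : set Omega) (Y : Omega -> R) : Prop :=
  sigma_measurable G Y /\
  forall B, <<s G >> B -> (\int[Pr]_(w in B) (Y w)%:E = Pr (A `&` B))%E.

(* The conditional law "K[x_n]_{i,j} on {X_n = i}", for all i at once, says
   that K[x_n]_{X_n,j} is a version of Pr(X_{n+1} = j | F_n). *)
Definition reinforced_process (R : realType) (F : finType) (o : F)
    (P : F -> F -> R) (gamma : R^nat) (d : measure_display)
    (Omega : measurableType d) (Pr : probability Omega R)
    (X : nat -> Omega -> star o) (x : nat -> Omega -> star o -> R) : Prop :=
  [/\ (forall n i, measurable (X n @^-1` [set i])),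
      (forall n w, simplex (x n w)),
      (forall i, sigma_measurable (past X 0) (fun w => x 0%N w i)),
      (forall n j, is_cond_prob Pr (past X n) (X n.+1 @^-1` [set j])
                     (fun w => kernelK P (x n w) (X n w) j)) &
      (forall n w i, x n.+1 w i =
         (1 - gamma n) * x n w i + gamma n * (X n.+1 w == i)%:R)].

(* The junk ratio at k = 0, where k.-1 = 0, does not affect the limit. *)
Definition condition_i (R : realType) (gamma : R^nat) : Prop :=
  [/\ (series gamma @ \oo --> +oo),
      cvgn (series (fun k => gamma k ^+ 2)) &
      (fun k => (gamma k)^-1 * ln (gamma k.-1 / gamma k)) @ \oo --> (0 : R)].

Definition condition_ii (R : realType) (gamma : R^nat) (rho : R) : Prop :=
  [/\ (series gamma @ \oo --> +oo),
      cvgn (series (fun k => gamma k ^+ 2)) &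
      exists gstar : R, [/\ 0 < gstar, gstar^-1 < 2 * rho &
        (fun k => (gamma k)^-1 * ln (gamma k.-1 / gamma k)) @ \oo
          --> gstar^-1]].

(* Main.v *)
(** Write M = (1 - Phat)^-1, r for the right Perron vector of Phat, and
    th = (1 - lambda)^-1. The mean field of (x_n) is phi(x) x M - x, where
    phi(x) = 1 / (x M 1), and psi(x) = (x r)^(b - 1) x - (x r)^b nu linearises
    it exactly: along it, psi moves by phi(x) psi A - b psi, A = M - th (1 - b)
    restricted to the row vectors killed by r. The Poisson equation of K[x] has
    an explicit solution in terms of M, so Z_n = psi(x_n) + gamma_n U(x_n, X_n)
    is an autoregression with martingale noise and an O(gamma_n^2) error.
    Let kappa = lim ln(gamma_{n-1} / gamma_n) / gamma_n. If kappa / 2 < b and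
    every eigenvalue z <> lambda of Phat has Re (1 / (1 - z)) < th (1 - b), a
    quadratic Lyapunov function W with W(z A, z) <= 0 gives
    sup_n E exp(a W(Z_n) / gamma_n) < oo. The characteristic function of
    V_n = Z_n / sqrt gamma_n, corrected by a Poisson term of order gamma_n, then
    satisfies a recursion along the backward contraction t |-> t + gamma_n L t
    whose fixed point is the Gaussian with covariance Q, L^T Q + Q L = - Gbar.
    Hence E cos <V_n, t> converges, and since all moments are bounded so does
    E |<V_n, t>|^p, to a positive limit because a vanishing variance in a
    coordinate direction would contradict the Poisson equation at a state from
    which the chain is killed. *)
Require Import Defs.
From HB Require Import structures.
From mathcomp Require Import all_boot all_order all_algebra.
From mathcomp Require Import complex ring lra.
From mathcomp Require Import all_classical all_reals all_analysis measurable_realfun.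

Set Implicit Arguments.
Unset Strict Implicit.
Unset Printing Implicit Defensive.

Import Order.TTheory GRing.Theory Num.Theory.
Import numFieldNormedType.Exports.

Local Open Scope classical_set_scope.
Local Open Scope ring_scope.

(** The overview leaves open how [b] is found and which obstacle it avoids. The condition Re (1 / (1
    - z)) < th (1 - b) for all listed z <> lambda follows from [b < rate], so under (ii) [b] is
    taken between kap / 2 and [rate]. Under (i), where kap = 0, a small [b > 0] is enough: Re (1 /
    (1 - z)) < th holds on the whole disc |z| <= lambda away from lambda, so the eigenvalues of
    modulus lambda of a periodic chain are covered. Proving convergence first and linearising near
    nu afterwards would require control, in every L^p, of the event that x_n is far from nu. Here
    the linearisation is exact on the whole simplex, and the variable speed phi >= 0 only multiplies
    the nonpositive quantity W(z A, z); hence the moment bounds hold from any initial law. An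
    exponential moment is sought because it bounds all powers of V_n at once. Comparing time n + 1
    at t with time n at t + gamma_n L t identifies the limit with no tightness argument, and the
    divergence of the sum of gamma_n erases the initial law. Expectations are finite sums until the
    process is identified with the chain at the end. *)

Definition eform (R : realType) (d m : nat) (E : 'M[R]_(d, m)) (y z : 'rV[R]_d) : R :=
  ((y *m E) *m (z *m E)^T) 0 0.

(** * Real and imaginary parts *)

Section ComplexParts.
Variable R : realType.
Implicit Types z w : R[i].

Lemma ReD z w : complex.Re (z + w) = complex.Re z + complex.Re w.
Proof. by case: z w => [a b] [a' b']. Qed.

Lemma ImD z w : complex.Im (z + w) = complex.Im z + complex.Im w.
Proof. by case: z w => [a b] [a' b']. Qed.

Lemma Re_sum (I : finType) (f : I -> R[i]) :
  complex.Re (\sum_i f i) = \sum_i complex.Re (f i).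
Proof. exact: (big_morph _ ReD erefl). Qed.

Lemma Im_sum (I : finType) (f : I -> R[i]) :
  complex.Im (\sum_i f i) = \sum_i complex.Im (f i).
Proof. exact: (big_morph _ ImD erefl). Qed.

Lemma Re_rM (a : R) z : complex.Re (real_complex R a * z) = a * complex.Re z.
Proof. by case: z => x y /=; rewrite mul0r subr0. Qed.

Lemma Im_rM (a : R) z : complex.Im (real_complex R a * z) = a * complex.Im z.
Proof. by case: z => x y /=; rewrite mul0r addr0. Qed.

Definition norm2 z : R := complex.Re z ^+ 2 + complex.Im z ^+ 2.

Definition dotc z w : R :=
  complex.Re z * complex.Re w + complex.Im z * complex.Im w.

Lemma norm2_ge0 z : 0 <= norm2 z.
Proof. by rewrite addr_ge0 // sqr_ge0. Qed.

Lemma dotc_sum (I : finType) (f : I -> R[i]) w :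
  dotc (\sum_i f i) w = \sum_i dotc (f i) w.
Proof. by rewrite /dotc Re_sum Im_sum !mulr_suml -big_split. Qed.

(** [dotc] is the real inner product of the plane. The imaginary part of [t] turns [z] by a right
    angle and contributes nothing, which is why only real parts of eigenvalues matter for
    dissipativity. *)
Lemma dotc_diag z t : dotc (z * t) z = complex.Re t * norm2 z.
Proof. by case: z t => [a b] [x y]; rewrite /dotc /norm2 /=; ring. Qed.

Lemma dotc_le z t w : dotc (z * t) w <=
  (`|complex.Re t| + `|complex.Im t|) * (norm2 z + norm2 w).
Proof.
case: z t w => [a b] [x y] [p q]; rewrite /dotc /norm2 /=.
set L := (X in X <= _).
have -> : L = x * (a * p + b * q) + y * (a * q - b * p) by rewrite /L; ring.
have h u v : u * v <= `|u| * `|v| :> R by rewrite -normrM ler_norm.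
rewrite mulrDl; apply: lerD; apply: le_trans (h _ _) _;
  apply: ler_wpM2l => //; rewrite ler_norml.
  have := sqr_ge0 (a + p); have := sqr_ge0 (b + q).
  have := sqr_ge0 (a - p); have := sqr_ge0 (b - q).
  have := sqr_ge0 a; have := sqr_ge0 b; have := sqr_ge0 p; have := sqr_ge0 q.
  by move=> *; apply/andP; split; nra.
have := sqr_ge0 (a + q); have := sqr_ge0 (b + p).
have := sqr_ge0 (a - q); have := sqr_ge0 (b - p).
have := sqr_ge0 a; have := sqr_ge0 b; have := sqr_ge0 p; have := sqr_ge0 q.
by move=> *; apply/andP; split; nra.
Qed.

End ComplexParts.

(** Cauchy-Schwarz against the constant vector, obtained termwise from
    [2 * f i * f j <= f i ^+ 2 + f j ^+ 2]. *)
Lemma sum_sqr_le (R : realDomainType) (d : nat) (f : 'I_d -> R) :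
  (\sum_i f i) ^+ 2 <= d%:R * \sum_i f i ^+ 2.
Proof.
rewrite -(ler_pM2l (ltr0n R 2)) expr2 big_distrlr /=.
have -> : 2%:R * (d%:R * \sum_i f i ^+ 2) = \sum_i \sum_j (f i ^+ 2 + f j ^+ 2).
  under [RHS]eq_bigr => i _ do rewrite big_split /= sumr_const card_ord.
  rewrite big_split /= sumr_const card_ord sumrMnl.
  by rewrite !mulr_natl -mulr2n.
rewrite mulr_sumr ler_sum // => i _; rewrite mulr_sumr ler_sum // => j _.
by have := sqr_ge0 (f i - f j); rewrite -subr_ge0 => h; lra.
Qed.

(** * Lyapunov functions *)

Section Lyapunov.
Variables (R : realType) (d : nat).
Implicit Types (A : 'M[R]_d) (z : 'rV[R]_d).
Local Notation toC := (real_complex R).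

(* The rows of [E] are a basis in which [A] is triangular, rescaled by the
   powers of a large [w] so that the off-diagonal entries become small. *)
Lemma lyapunov_trig A (Q T : 'M[R[i]]_d) (c : R) :
  Q \in unitmx -> map_mx toC A *m Q = Q *m T -> is_trig_mx T ->
  (forall i, complex.Re (T i i) < c) ->
  exists E : 'M[R]_(d, d + d),
    (exists C, forall z k, z 0 k ^+ 2 <= C * eform E z z) /\
    (forall z, eform E (z *m A) z <= c * eform E z z).
Proof.
move=> Qu AQ /is_trig_mxP Ttr Tc.
pose tau : R := \sum_i \sum_j (`|complex.Re (T i j)| + `|complex.Im (T i j)|).
have tau_ge0 : 0 <= tau by rewrite !sumr_ge0 // => i _; rewrite sumr_ge0 // => j _; rewrite addr_ge0.
have leTau i j : `|complex.Re (T i j)| + `|complex.Im (T i j)| <= tau.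
  rewrite /tau (bigD1 i) //= (bigD1 j) //= -addrA lerDl addr_ge0 ?sumr_ge0 // => *;
    rewrite ?sumr_ge0 // => *; exact: addr_ge0.
have tau2 : 0 <= tau * d%:R *+ 2 by rewrite mulrn_wge0 // mulr_ge0.
(* [om] dominates [2 * d * tau / (c - Re (T j j))] for every [j]: off-diagonal terms damped by
   [1 / om] then fit into the gap between the diagonal and [c]. *)
pose om : R := 1 + \sum_j (tau * d%:R *+ 2) / (c - complex.Re (T j j)).
have dc j : 0 < c - complex.Re (T j j) by rewrite subr_gt0.
have om1 : 1 <= om.
  by rewrite lerDl sumr_ge0 // => j _; rewrite divr_ge0 // ltW.
have om0 : 0 < om by exact: lt_le_trans om1.
have omj j : (tau * d%:R *+ 2) / om <= c - complex.Re (T j j).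
  rewrite ler_pdivrMr // -ler_pdivrMl // [_^-1 * _]mulrC.
  rewrite /om (bigD1 j) //= addrCA lerDl addr_ge0 // sumr_ge0 // => i _.
  by rewrite divr_ge0 // ltW.
pose Ec : 'M[R[i]]_d := \matrix_(k, j) (toC (om ^+ j) * Q k j).
(* Splitting the complex coordinates into real and imaginary parts doubles the columns and makes
   [eform E z z] the sum of the squared moduli of the coordinates [w z j]. *)
pose E : 'M[R]_(d, d + d) :=
  row_mx (map_mx (@complex.Re R) Ec) (map_mx (@complex.Im R) Ec).
pose cz z : 'rV[R[i]]_d := map_mx toC z.
pose w z (j : 'I_d) : R[i] := toC (om ^+ j) * (cz z *m Q) 0 j.
have Ew z (j : 'I_d) : ((z *m E) 0 (lshift d j) = complex.Re (w z j)) *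
    ((z *m E) 0 (rshift d j) = complex.Im (w z j)).
  rewrite /E mul_mx_row row_mxEl row_mxEr /w Re_rM Im_rM !mxE Re_sum Im_sum !mulr_sumr.
  split; apply: eq_bigr => k _; rewrite !mxE ?Re_rM ?Im_rM; ring.
have eE y z : eform E y z = \sum_j dotc (w y j) (w z j).
  rewrite /eform mxE big_split_ord /= -big_split /=; apply: eq_bigr => j _.
  by rewrite ![(_^T) _ _]mxE !Ew.
have eW z : eform E z z = \sum_j norm2 (w z j).
  by rewrite eE; apply: eq_bigr => j _; rewrite /dotc /norm2 !expr2.
have eW_ge0 z : 0 <= eform E z z by rewrite eW sumr_ge0 // => j _; exact: norm2_ge0.
exists E; split.
  (* [z] is recovered from its coordinates through [invmx Q]; the factors [om ^- j] are at most 1,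
     so the constant depends on [Q] and [d] only. *)
  exists (\sum_(k < d) (1 + \sum_(j < d) norm2 (invmx Q j k)) * (d%:R *+ 2)) => z k.
  have zE : toC (z 0 k) = \sum_(j < d) toC ((om ^+ j)^-1) * w z j * invmx Q j k.
    have : cz z = (cz z *m Q) *m invmx Q by rewrite mulmxK.
    move=> /matrixP /(_ 0 k); rewrite [LHS]mxE => ->; rewrite mxE.
    apply: eq_bigr => j _; rewrite /w mulrA -rmorphM /= mulVf ?mul1r //.
    by rewrite expf_neq0 // gt_eqF.
  have zE' : z 0 k = \sum_(j < d) (om ^+ j)^-1 * complex.Re (w z j * invmx Q j k).
    have /(congr1 (@complex.Re R)) := zE; rewrite Re_sum /= => ->.
    by apply: eq_bigr => j _; rewrite -mulrA Re_rM.
  have b (j : 'I_d) : `|(om ^+ j)^-1 * complex.Re (w z j * invmx Q j k)| ^+ 2 <=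
     (norm2 (w z j) * norm2 (invmx Q j k)) *+ 2.
    have o1 : 0 <= (om ^+ j)^-1 <= 1.
      by rewrite invr_ge0 exprn_ge0 ?(ltW om0) //= invf_le1 ?exprn_gt0 // exprn_ege1.
    rewrite real_normK ?num_real // exprMn.
    have h : complex.Re (w z j * invmx Q j k) ^+ 2 <= (norm2 (w z j) * norm2 (invmx Q j k)) *+ 2.
      case: (w z j) (invmx Q j k) => [a b] [x y]; rewrite /norm2 /=.
      by have := sqr_ge0 (a * x + b * y); have := sqr_ge0 (a * y); have := sqr_ge0 (b * x);
         have := sqr_ge0 (a * x); have := sqr_ge0 (b * y); nra.
    apply: le_trans h; rewrite -[leRHS]mul1r ler_wpM2r ?sqr_ge0 //.
    by case/andP: o1 => o0 o1; rewrite exprn_ile1.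
  rewrite zE' (le_trans (sum_sqr_le _)) //.
  have -> : (\sum_(k < d) (1 + \sum_(j < d) norm2 (invmx Q j k)) * (d%:R *+ 2)) * eform E z z =
    \sum_(k < d) \sum_j (d%:R * (norm2 (w z j) * (1 + \sum_(j < d) norm2 (invmx Q j k))) *+ 2).
    by rewrite mulr_suml; apply: eq_bigr => l _; rewrite eW mulr_sumr; apply: eq_bigr => j _; ring.
  rewrite [leRHS](bigD1 k) //= ler_wpDr ?sumr_ge0 // => [l _|].
    rewrite sumr_ge0 // => j _; rewrite mulrn_wge0 // mulr_ge0 // mulr_ge0 ?norm2_ge0 //.
    by rewrite addr_ge0 ?sumr_ge0 // => *; exact: norm2_ge0.
  rewrite mulr_sumr ler_sum // => j _; rewrite -mulrnAr ler_wpM2l //.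
  rewrite -[X in X <= _]real_normK ?num_real //.
  apply: le_trans (b j) _; rewrite ler_wMn2r // ler_wpM2l ?norm2_ge0 //.
  by rewrite (bigD1 j) //= addrCA lerDl addr_ge0 ?sumr_ge0 // => *; exact: norm2_ge0.
move=> z; rewrite eE eW mulr_sumr.
(* Rescaling multiplies the entry [T i j] by [om ^+ j / om ^+ i]; it is zero for [i < j] and damped
   by at least [1 / om] for [j < i]. *)
have wA (j : 'I_d) : w (z *m A) j = \sum_(i < d) w z i * (toC (om ^+ j / om ^+ i) * T i j).
  rewrite /w /cz map_mxM -mulmxA AQ mulmxA mxE mulr_sumr.
  apply: eq_bigr => i _; rewrite rmorphM /= fmorphV.
  have : toC (om ^+ i) != 0 by rewrite fmorph_eq0 expf_neq0 // gt_eqF.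
  by move=> h; field.
have step (j : 'I_d) : dotc (w (z *m A) j) (w z j) <= complex.Re (T j j) * norm2 (w z j) +
   \sum_i (tau / om) * (norm2 (w z i) + norm2 (w z j)).
  rewrite wA dotc_sum (bigD1 j) //= divff ?expf_neq0 ?gt_eqF // rmorph1 mul1r dotc_diag lerD2l.
  have nn i : 0 <= (tau / om) * (norm2 (w z i) + norm2 (w z j)).
    by apply: mulr_ge0; [exact: divr_ge0 tau_ge0 (ltW om0) | apply: addr_ge0; exact: norm2_ge0].
  rewrite [leRHS](bigD1 j) //= ler_wpDl //; apply: ler_sum => i ij.
  have [lij|lji] := ltnP i j.
    by rewrite Ttr // mulr0 mulr0 (_ : dotc _ _ = 0) // /dotc /= !mul0r addr0.
  have {}lji : (j < i)%N by rewrite ltn_neqAle lji andbT eq_sym.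
  apply: le_trans (dotc_le _ _ _) _; apply: ler_wpM2r; first by rewrite addr_ge0 ?norm2_ge0.
  rewrite Re_rM Im_rM !normrM -mulrDr.
  have h0 : 0 <= om ^+ j / om ^+ i by rewrite divr_ge0 // exprn_ge0 // (ltW om0).
  rewrite -normrM ger0_norm // [leLHS]mulrC ler_pM // ?addr_ge0 //.
  rewrite ler_pdivrMr ?exprn_gt0 // -(subnK lji) addnS -addSn exprD.
  rewrite exprS -mulrA mulKf ?gt_eqF //.
  by rewrite ler_peMl ?exprn_ge0 ?exprn_ege1 // (ltW om0).
apply: le_trans (ler_sum _ (fun j _ => step j)) _.
rewrite big_split /=.
have -> : \sum_(i < d) \sum_(i0 < d) tau / om * (norm2 (w z i0) + norm2 (w z i)) =
  \sum_i (tau * d%:R *+ 2) / om * norm2 (w z i).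
  under eq_bigr => i _ do (under eq_bigr => j _ do rewrite mulrDr; rewrite big_split /=).
  rewrite big_split /= [X in X + _]exchange_big /= -big_split /=.
  apply: eq_bigr => i _; rewrite !sumr_const card_ord -mulr_natl; ring.
rewrite -big_split /=; apply: ler_sum => j _.
by rewrite -mulrDl ler_wpM2r ?norm2_ge0 // -lerBrDl.
Qed.

End Lyapunov.

(** The Schur form supplies the triangular matrix; its diagonal entries are eigenvalues, so the
    hypothesis on [A] bounds their real parts. Dimension zero is set apart because the Schur form is
    available for positive dimension. *)
Lemma lyapunov (R : realType) (d : nat) (A : 'M[R]_d) (c : R) :
  (forall (eta : R[i]) (q : 'rV[R[i]]_d), q != 0 ->
     q *m map_mx (real_complex R) A = eta *: q -> complex.Re eta < c) ->
  exists E : 'M[R]_(d, d + d),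
    (exists C, forall (z : 'rV[R]_d) k, z 0 k ^+ 2 <= C * eform E z z) /\
    (forall z : 'rV[R]_d, eform E (z *m A) z <= c * eform E z z).
Proof.
move=> hA; have [d0|d0] := posnP d.
  by move: A hA; rewrite d0 => A _; exists 0; split=> [|z];
    [exists 0 => z [] | rewrite /eform !mulmx0 mul0mx mxE mulr0].
have [P Pu Ptrig] := Schur (map_mx (real_complex R) A) d0.
have Pu' := unitarymx_unit Pu.
move: Ptrig; rewrite /similar_to /= conjumx // => Ttr.
apply: (@lyapunov_trig _ _ _ (invmx P) _ c _ _ Ttr); rewrite ?unitmx_inv //.
  by rewrite !mulmxA mulVmx // mul1mx.
move=> i; set T := P *m _ *m _ in Ttr *.
have : eigenvalue T (T i i).
  rewrite eigenvalue_root_char char_poly_trig // /root horner_prod.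
  by apply/prodf_eq0; exists i => //; rewrite hornerXsubC subrr.
case/eigenvalueP => v vT v0; apply: (hA _ (v *m P)).
  apply: contraNneq v0 => vP.
  by rewrite -[v](mulmxK Pu') vP mul0mx.
by rewrite scalemxAl -vT /T !mulmxA mulmxKV.
Qed.

(** * Perron theory *)

Section Perron.
Variables (R : realType) (d : nat) (Ph : 'M[R]_d) (nu : 'rV[R]_d) (lam : R).
Hypothesis Ph_ge0 : forall i j, 0 <= Ph i j.
Hypothesis Ph_le1 : forall i, \sum_j Ph i j <= 1.
(** Irreducibility is phrased with closed sets because it is applied to supports and zero sets of
    eigenvectors. *)
Hypothesis irr : forall B : pred 'I_d, (exists i, B i) ->
  (forall i j, B i -> 0 < Ph i j -> B j) -> forall j, B j.
Hypothesis nu_ge0 : forall i, 0 <= nu 0 i.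
Hypothesis nu_sum : \sum_i nu 0 i = 1.
Hypothesis lam01 : 0 < lam < 1.
Hypothesis nuPh : nu *m Ph = lam *: nu.

Local Notation toC := (real_complex R).

Let lam0 : 0 < lam. Proof. by case/andP: lam01. Qed.

(** A left eigenvector transports mass forward, so its support is closed under transitions. *)
Lemma left_eigen_gt0 (q : 'rV[R]_d) : (forall i, 0 <= q 0 i) ->
  q *m Ph = lam *: q -> (exists i, 0 < q 0 i) -> forall i, 0 < q 0 i.
Proof.
move=> q0 qP ex; apply: (@irr (fun i => 0 < q 0 i) ex) => i j qi Pij.
have /matrixP /(_ 0 j) := qP; rewrite !mxE => e.
rewrite -(pmulr_rgt0 _ lam0) -e (bigD1 i) //= ltr_wpDr ?mulr_gt0 //.
by rewrite sumr_ge0 // => k _; rewrite mulr_ge0.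
Qed.

Lemma qsd_gt0 i : 0 < nu 0 i.
Proof.
apply: left_eigen_gt0 => //.
case: (boolP [exists i, 0 < nu 0 i]) => [/existsP //|/existsPn h].
have := oner_neq0 R; rewrite -nu_sum big1 ?eqxx // => j _.
by apply/eqP; rewrite eq_le nu_ge0 andbT leNgt h.
Qed.

(** Where a nonnegative right eigenvector vanishes, a sum of nonnegative terms vanishes, hence so
    does the vector at every successor: the zero set is closed. *)
Lemma right_eigen_gt0 (r : 'cV[R]_d) : (forall i, 0 <= r i 0) ->
  Ph *m r = lam *: r -> r != 0 -> forall i, 0 < r i 0.
Proof.
move=> r0 Pr rn i; apply: contraNT rn; rewrite -leNgt => ri; apply/eqP/matrixP => k l; rewrite ord1 mxE {l}.
suff h : forall k, r k 0 == 0 by exact/eqP.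
apply: irr; first by exists i; rewrite eq_le r0 ri.
move=> {ri k}i j /eqP ri Pij; have /matrixP /(_ i 0) := Pr.
rewrite !mxE ri mulr0 => /eqP.
rewrite psumr_eq0 => [/allP /(_ j (mem_index_enum _))|k _]; last by rewrite mulr_ge0.
by rewrite mulf_eq0 gt_eqF.
Qed.

(** [lam] is also an eigenvalue of the transpose. For a real right eigenvector [v] one has
    [Ph |v| >= lam |v|], and integrating the difference against the positive [nu] gives 0, so [|v|]
    is itself an eigenvector. The normalisation turns [r *m nu] into the spectral projection. *)
Lemma right_eigen : exists r : 'cV[R]_d,
  [/\ forall i, 0 < r i 0, Ph *m r = lam *: r & nu *m r = 1%:M].
Proof.
have nu0 : nu != 0.
  apply: contraTneq (lexx (0 : R)) => n0.
  by have := oner_neq0 R; rewrite -nu_sum big1 ?eqxx // => j _; rewrite n0 mxE.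
have : \det (Ph - lam%:M) == 0.
  by apply/det0P; exists nu => //; rewrite mulmxBr nuPh mul_mx_scalar subrr.
rewrite -det_tr => /det0P [v v0]; rewrite raddfB /= tr_scalar_mx mulmxBr mul_mx_scalar.
move/subr0_eq => vP.
pose r : 'cV[R]_d := \col_i `|v 0 i|.
have r_ge0 i : 0 <= r i 0 by rewrite mxE.
have rneq : r != 0.
  apply: contraNneq v0 => r0; apply/eqP/matrixP => i j; rewrite ord1 mxE.
  by apply/eqP; have /matrixP /(_ j 0) := r0; rewrite !mxE => /eqP; rewrite normr_eq0.
have vE i : lam * v 0 i = \sum_j Ph i j * v 0 j.
  have /matrixP /(_ 0 i) := vP; rewrite !mxE => <-.
  by apply: eq_bigr => j _; rewrite mxE mulrC.
have ler i : 0 <= (Ph *m r) i 0 - lam * r i 0.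
  rewrite subr_ge0 !mxE -{1}(gtr0_norm lam0) -normrM vE.
  apply: le_trans (ler_norm_sum _ _ _) _; apply: ler_sum => j _.
  by rewrite normrM ger0_norm // mxE.
have : \sum_i nu 0 i * ((Ph *m r) i 0 - lam * r i 0) = 0.
  transitivity ((nu *m (Ph *m r - lam *: r)) 0 0).
    by rewrite [RHS]mxE; apply: eq_bigr => i _; rewrite !mxE.
  by rewrite mulmxBr mulmxA nuPh -scalemxAl -scalemxAr subrr mxE.
move/eqP; rewrite psumr_eq0 => [/allP h|i _]; last by rewrite mulr_ge0.
have Pr : Ph *m r = lam *: r.
  apply/matrixP => i j; rewrite ord1; have := h i (mem_index_enum _).
  by rewrite mulf_eq0 gt_eqF ?qsd_gt0 //= subr_eq0 => /eqP ->; rewrite [RHS]mxE.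
have rp := right_eigen_gt0 r_ge0 Pr rneq.
have np : 0 < (nu *m r) 0 0.
  have : nu *m r != 0.
    apply: contraNneq nu0 => /matrixP /(_ 0 0); rewrite !mxE => /eqP.
    rewrite psumr_eq0 => [/allP z|i _]; last by rewrite mulr_ge0 // ltW.
    apply/eqP/matrixP => i j; rewrite ord1 mxE.
    by have := z j (mem_index_enum _); rewrite mulf_eq0 (gt_eqF (rp j)) orbF => /eqP.
  move=> h0; rewrite lt_neqAle; apply/andP; split; last first.
    by rewrite mxE sumr_ge0 // => i _; rewrite mulr_ge0 // ltW.
  apply: contraNneq h0 => h0; apply/eqP/matrixP => i j; by rewrite !ord1 -h0 mxE.
have [c [c0 e]] : exists c, 0 < c /\ nu *m r = c%:M.
  by exists ((nu *m r) 0 0); split => //; exact: mx11_scalar.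
exists (c^-1 *: r); split.
- by move=> i; rewrite mxE mulr_gt0 // invr_gt0.
- by rewrite -scalemxAr Pr !scalerA mulrC.
by rewrite -scalemxAr e scale_scalar_mx mulVf // gt_eqF.
Qed.

Variable r : 'cV[R]_d.
Hypothesis r_gt0 : forall i, 0 < r i 0.
Hypothesis Phr : Ph *m r = lam *: r.
Hypothesis nur : nu *m r = 1%:M.

(* Comparing [|q|] with [|q| Ph] against the positive vector [r]. *)
Lemma abs_left_eigen (q : 'rV[R]_d) : q *m Ph = lam *: q ->
  (\row_i `|q 0 i|) *m Ph = lam *: \row_i `|q 0 i|.
Proof.
move=> qP; set b := \row_i _.
have ler i : 0 <= (b *m Ph) 0 i - lam * b 0 i.
  have /matrixP /(_ 0 i) := qP; rewrite !mxE subr_ge0 => e.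
  rewrite -{1}(gtr0_norm lam0) -normrM -e.
  apply: le_trans (ler_norm_sum _ _ _) _; apply: ler_sum => j _.
  by rewrite normrM mxE (ger0_norm (Ph_ge0 _ _)).
have : \sum_i ((b *m Ph) 0 i - lam * b 0 i) * r i 0 = 0.
  transitivity (((b *m Ph - lam *: b) *m r) 0 0).
    by rewrite [RHS]mxE; apply: eq_bigr => i _; rewrite !mxE.
  by rewrite mulmxBl -mulmxA Phr -scalemxAl -scalemxAr subrr mxE.
move/eqP; rewrite psumr_eq0 => [/allP h|i _]; last by rewrite mulr_ge0 // ltW.
apply/matrixP => k i; rewrite ord1; have := h i (mem_index_enum _).
by rewrite mulf_eq0 (gt_eqF (r_gt0 i)) orbF subr_eq0 => /eqP ->; rewrite [RHS]mxE.
Qed.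

(** [|q| + q] and [|q| - q] are nonnegative eigenvectors with pointwise product 0. A nonzero one
    would be positive everywhere, so one of them vanishes; then [q] has constant sign and
    [q *m r = 0] forces [q = 0]. *)
Lemma left_eigen_simple (q : 'rV[R]_d) :
  q *m Ph = lam *: q -> q *m r = 0 -> q = 0.
Proof.
move=> qP qr; have aP := abs_left_eigen qP.
pose pp (e : R) : 'rV[R]_d := \row_i `|q 0 i| + e *: q.
have ppP e : pp e *m Ph = lam *: pp e.
  by rewrite mulmxDl aP -scalemxAl qP scalerDr !scalerA mulrC.
have ppE e i : pp e 0 i = `|q 0 i| + e * q 0 i by rewrite !mxE.
have pp1 i : 0 <= pp 1 0 i by rewrite ppE mul1r -lerBlDr sub0r; have := ler_norm (- q 0 i); rewrite normrN.
have ppN i : 0 <= pp (-1) 0 i by rewrite ppE mulN1r subr_ge0 ler_norm.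
have prod0 i : pp 1 0 i * pp (-1) 0 i = 0.
  by rewrite !ppE mul1r mulN1r mulrC -subr_sqr real_normK ?num_real // subrr.
have sgn e : e ^+ 2 = 1 -> (forall i, 0 <= pp e 0 i) -> ~ (exists i, 0 < pp e 0 i) -> q = 0.
  move=> e1 p0 np; have z i : e * q 0 i = - `|q 0 i|.
    apply/eqP; rewrite -addr_eq0 addrC -ppE eq_le p0 andbT leNgt.
    by apply/negP => h; apply: np; exists i.
  have : \sum_i `|q 0 i| * r i 0 = 0.
    have /matrixP /(_ 0 0) := qr; rewrite !mxE => e0.
    transitivity (- e * \sum_i q 0 i * r i 0); last by rewrite e0 mulr0.
    by rewrite mulr_sumr; apply: eq_bigr => i _; rewrite mulrA mulNr z opprK.
  move/eqP; rewrite psumr_eq0 => [/allP h|i _]; last by rewrite mulr_ge0 // ltW.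
  apply/matrixP => k i; rewrite ord1 mxE; have := h i (mem_index_enum _).
  by rewrite mulf_eq0 (gt_eqF (r_gt0 i)) orbF normr_eq0 => /eqP.
have [/existsP p1|/existsPn n1] := boolP [exists i, 0 < pp 1 0 i]; last first.
  by apply: (sgn 1) => //; [rewrite expr1n | case=> i; rewrite (negbTE (n1 i))].
apply: (sgn (-1)) => //; first by rewrite sqrrN expr1n.
have {}p1 := left_eigen_gt0 pp1 (ppP 1) p1.
by case=> i hi; have := mulr_gt0 (p1 i) hi; rewrite prod0 ltxx.
Qed.

Lemma left_eigen_simpleC (q : 'rV[R[i]]_d) :
  q *m map_mx toC Ph = toC lam *: q -> q *m map_mx toC r = 0 -> q = 0.
Proof.
move=> qP qr.
(* [f] stands for the real or the imaginary part; an additive, real-homogeneous map sends [q] to a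
   real eigenvector killed by [r]. *)
have Rr (f : R[i] -> R) : (forall z w, f (z + w) = f z + f w) -> f 0 = 0 ->
    (forall a z, f (toC a * z) = a * f z) -> map_mx f q = 0.
  move=> fD f0 fM; have fS (I : finType) (g : I -> R[i]) : f (\sum_i g i) = \sum_i f (g i).
    exact: (big_morph f fD f0).
  apply: left_eigen_simple.
    apply/matrixP => k j; have /matrixP /(_ k j) /(congr1 f) := qP.
    rewrite !mxE fM fS => e; rewrite -[RHS]e; apply: eq_bigr => i _.
    by rewrite !mxE [in RHS]mulrC fM mulrC.
  apply/matrixP => k j; have /matrixP /(_ k j) /(congr1 f) := qr.
  rewrite !mxE fS f0 => e; rewrite -[RHS]e; apply: eq_bigr => i _.
  by rewrite !mxE [in RHS]mulrC fM mulrC.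
have /matrixP re := Rr _ (@ReD R) erefl (@Re_rM R).
have /matrixP im := Rr _ (@ImD R) erefl (@Im_rM R).
apply/matrixP => k j; have := re k j; have := im k j; rewrite !mxE.
by case: (q k j) => x y /= -> ->.
Qed.

(** If [v Ph = v] then [|v| <= |v| Ph]. Pairing with [r] multiplies the right side by [lam < 1], so
    [|v|] pairs to 0 with a positive vector. *)
Lemma subPh_unit : 1%:M - Ph \in unitmx.
Proof.
rewrite unitmxE unitfE; apply/negP => /det0P [v v0].
rewrite mulmxBr mulmx1 => /subr0_eq vP; case/negP: v0; apply/eqP.
have : \sum_i ((\sum_k `|v 0 k| * Ph k i) - `|v 0 i|) * r i 0 =
       (lam - 1) * \sum_i `|v 0 i| * r i 0.
  under eq_bigr => i _ do rewrite mulrBl mulr_suml.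
  rewrite big_split /= sumrN mulrBl mul1r; congr (_ - _).
  rewrite exchange_big mulr_sumr /=; apply: eq_bigr => k _.
  have /matrixP /(_ k 0) := Phr; rewrite !mxE mulrCA => <-.
  by rewrite mulr_sumr; apply: eq_bigr => i _; rewrite mulrA.
move=> e; have h0 : 0 <= \sum_i `|v 0 i| * r i 0.
  by rewrite sumr_ge0 // => i _; rewrite mulr_ge0 // ltW.
have : 0 <= (lam - 1) * \sum_i `|v 0 i| * r i 0.
  rewrite -e sumr_ge0 // => i _; rewrite mulr_ge0 ?(ltW (r_gt0 _)) //.
  have /matrixP /(_ 0 i) := vP; rewrite mxE subr_ge0 => ->.
  apply: le_trans (ler_norm_sum _ _ _) _; apply: ler_sum => k _.
  by rewrite normrM (ger0_norm (Ph_ge0 _ _)).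
rewrite nmulr_rge0 ?subr_lt0; last by case/andP: lam01.
move=> h1; have /eqP : \sum_i `|v 0 i| * r i 0 = 0 by apply/eqP; rewrite eq_le h0 h1.
rewrite psumr_eq0 => [/allP h|i _]; last by rewrite mulr_ge0 // ltW.
apply/matrixP => k i; rewrite ord1 mxE; have := h i (mem_index_enum _).
by rewrite mulf_eq0 (gt_eqF (r_gt0 i)) orbF normr_eq0 => /eqP.
Qed.

Let M : 'M[R]_d := invmx (1%:M - Ph).
Let th : R := (1 - lam)^-1.

Let lam1 : 1 - lam != 0.
Proof. by case/andP: lam01 => _ l1; rewrite subr_eq0 gt_eqF. Qed.

Lemma resolvent_right : M *m r = th *: r.
Proof.
have e : (1%:M - Ph) *m r = (1 - lam) *: r by rewrite mulmxBl mul1mx Phr scalerBl scale1r.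
have : M *m ((1%:M - Ph) *m r) = r by rewrite mulKmx // subPh_unit.
by rewrite e -scalemxAr => h; rewrite -[in RHS]h scalerA /th mulVf // scale1r.
Qed.

Lemma resolvent_left : nu *m M = th *: nu.
Proof.
have e : nu *m (1%:M - Ph) = (1 - lam) *: nu by rewrite mulmxBr mulmx1 nuPh scalerBl scale1r.
have : (nu *m (1%:M - Ph)) *m M = nu by rewrite mulmxK // subPh_unit.
by rewrite e -scalemxAl => h; rewrite -[in RHS]h scalerA /th mulVf // scale1r.
Qed.

(** Minimum principle for [s = 1 + Ph s]: a negative minimum is incompatible with row sums at most
    1, and [s >= 0] then gives [s >= 1]. *)
Lemma resolvent_const1_ge1 i : 1 <= (M *m (const_mx 1 : 'cV[R]_d)) i 0.
Proof.
set s := M *m _.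
have sE k : s k 0 = 1 + \sum_j Ph k j * s j 0.
  have : (1%:M - Ph) *m s = const_mx 1 by rewrite /s mulKVmx // subPh_unit.
  rewrite mulmxBl mul1mx => /matrixP /(_ k 0); rewrite !mxE => /eqP.
  by rewrite subr_eq => /eqP.
have [i0 _ minP] := @arg_minP _ _ _ i predT (fun k => s k 0) isT.
have s0 : 0 <= s i0 0.
  rewrite leNgt; apply/negP => neg.
  have : s i0 0 * (1 - \sum_j Ph i0 j) >= 1.
    rewrite mulrBr mulr1 {1}sE mulr_sumr -addrA -sumrB lerDl sumr_ge0 // => j _.
    by rewrite mulrC -mulrBl mulr_ge0 // subr_ge0 minP.
  by apply/negP; rewrite -ltNge; apply: le_lt_trans ltr01; rewrite nmulr_rle0 // subr_ge0.
by rewrite sE lerDl sumr_ge0 // => j _; rewrite mulr_ge0 // (le_trans s0) // minP.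
Qed.

(** Multiplying the eigenvalue equation by [r] shows that either [eta = th - K] or [q] kills [r]. In
    the second case the rank-one term drops out, [eta = 1 / (1 - z)] for an eigenvalue [z] of [Ph],
    and simplicity of the Perron eigenvalue excludes [z = lam]. *)
Lemma deflated_spectrum (bnd K : R) : th - K < bnd ->
  (forall z : R[i], eigenvalue (map_mx toC Ph) z -> z != toC lam ->
     complex.Re (1 - z)^-1 < bnd) ->
  forall (eta : R[i]) (q : 'rV[R[i]]_d), q != 0 ->
    q *m map_mx toC (M - K *: (r *m nu)) = eta *: q -> complex.Re eta < bnd.
Proof.
move=> hK hbnd eta q q0 qA.
have rC : map_mx toC (M - K *: (r *m nu)) *m map_mx toC r = toC (th - K) *: map_mx toC r.
  rewrite -map_mxM -map_mxZ; congr map_mx.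
  by rewrite mulmxBl resolvent_right -scalemxAl -mulmxA nur mulmx1 scalerBl.
have [qr|qr] := eqVneq (q *m map_mx toC r) 0; last first.
  have : eta *: (q *m map_mx toC r) = toC (th - K) *: (q *m map_mx toC r).
    by rewrite scalemxAl -qA -mulmxA rC scalemxAr.
  move/eqP; rewrite -subr_eq0 -scalerBl scaler_eq0 (negbTE qr) orbF subr_eq0.
  by move=> /eqP ->.
have qM : q *m map_mx toC M = eta *: q.
  rewrite -qA map_mxB map_mxZ map_mxM mulmxBr -scalemxAr mulmxA qr mul0mx.
  by rewrite scaler0 subr0.
have qI : q = eta *: (q *m (1%:M - map_mx toC Ph)).
  rewrite scalemxAl -qM -mulmxA -(map_scalar_mx toC) -map_mxB -map_mxM.
  by rewrite mulVmx ?subPh_unit // map_scalar_mx rmorph1 mulmx1.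
have e0 : eta != 0 by apply: contraNneq q0 => e0; rewrite qI e0 scale0r.
have qP : q *m map_mx toC Ph = (1 - eta^-1) *: q.
  rewrite scalerBl scale1r [in eta^-1 *: q]qI scalerA mulVf // scale1r.
  by rewrite mulmxBr mulmx1 opprB addrC subrK.
have -> : eta = (1 - (1 - eta^-1))^-1 by rewrite opprB addrC subrK invrK.
apply: hbnd; first by apply/eigenvalueP; exists q.
by apply: contraNneq q0 => zl; apply/eqP/left_eigen_simpleC => //; rewrite qP zl.
Qed.

End Perron.

(** * Mean value and Taylor estimates *)

Section Calculus.
Variable R : realType.
Implicit Types x y t u : R.

(** The endpoints are in any order, and [c] is also located relative to [x], so that the estimate
    can be applied again to [df c - df x] for Taylor remainders. *)
Lemma mvt_between (f df : R -> R) (a b x y : R) :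
  (forall z, a <= z <= b -> is_derive z 1 f (df z)) ->
  a <= x <= b -> a <= y <= b ->
  exists c, [/\ a <= c <= b, `|c - x| <= `|y - x| & f y - f x = df c * (y - x)].
Proof.
move=> fd.
have main u v : u <= v -> a <= u -> v <= b ->
    exists2 c, u <= c <= v & f v - f u = df c * (v - u).
  move=> uv au vb; have fd' z : z \in `[u, v] -> is_derive z 1 f (df z).
    by rewrite in_itv /= => /andP[uz zv]; apply: fd; rewrite (le_trans au uz) (le_trans zv vb).
  have cont : {within `[u, v], continuous f}.
    by apply: derivable_within_continuous => z /fd' [].
  have fd2 z : z \in `]u, v[ -> is_derive z 1 f (df z).
    rewrite in_itv /= => /andP[/ltW uz /ltW zv]; apply: fd'.
    by rewrite in_itv /= uz zv.
  have [c cuv e] := MVT_segment uv fd2 cont.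
  by exists c => //; rewrite in_itv in cuv.
move=> /andP[ax xb] /andP[ay yb]; have [xy|/ltW yx] := leP x y.
  have [c /andP[xc cy] e] := main _ _ xy ax yb; exists c; split => //.
    by rewrite (le_trans ax xc) (le_trans cy yb).
  by rewrite !ger0_norm ?subr_ge0 ?lerD2r.
have [c /andP[yc cx] e] := main _ _ yx ay xb; exists c; split.
- by rewrite (le_trans ay yc) (le_trans cx xb).
- by rewrite distrC [leRHS]distrC !ger0_norm ?subr_ge0 // lerD2l lerN2.
- by rewrite -opprB e -mulrN opprB.
Qed.

Lemma mvt (f df : R -> R) x y : (forall z : R, is_derive z (1 : R) f (df z)) ->
  exists c, `|c - x| <= `|y - x| /\ f y - f x = df c * (y - x).
Proof.
move=> fd.
have hx : Num.min x y <= x <= Num.max x y by rewrite ge_min le_max lexx.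
have hy : Num.min x y <= y <= Num.max x y by rewrite ge_min le_max lexx !orbT.
by have [c [_ cl e]] := mvt_between (fun z _ => fd z) hx hy; exists c.
Qed.

Lemma powR_bounded (a b e : R) : 0 < a ->
  exists2 C, 0 <= C & forall t, a <= t <= b -> `|t `^ e| <= C.
Proof.
move=> a0; exists (expR (`|e| * (`|ln a| + `|ln b|))); first exact: expR_ge0.
move=> t /andP[at_ tb]; have t0 := lt_le_trans a0 at_.
rewrite ger0_norm ?powR_ge0 // /powR gt_eqF // ler_expR.
apply: le_trans (ler_norm _) _; rewrite normrM ler_wpM2l //.
have l1 : ln a <= ln t by rewrite ler_ln ?posrE.
have l2 : ln t <= ln b by rewrite ler_ln ?posrE // (lt_le_trans t0 tb).
rewrite ler_norml; apply/andP; split.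
  have := normr_ge0 (ln b); have := ler_norm (- ln a); rewrite normrN; lra.
have := normr_ge0 (ln a); have := ler_norm (ln b); lra.
Qed.

Lemma powR_lipschitz (a b e : R) : 0 < a ->
  exists2 C, 0 <= C & forall t u, a <= t <= b -> a <= u <= b ->
    `|t `^ e - u `^ e| <= C * `|t - u|.
Proof.
move=> a0; have [C C0 hC] := powR_bounded b (e - 1) a0.
exists (`|e| * C); first exact: mulr_ge0.
move=> t u ht hu.
have dp z : a <= z <= b -> is_derive z 1 (fun z : R => z `^ e) (e * z `^ (e - 1)).
  by move=> /andP[az _]; apply: is_derive1_powR; exact: lt_le_trans az.
have [c [cab _ ->]] := mvt_between dp hu ht.
by rewrite !normrM ler_wpM2r // ler_wpM2l // hC.
Qed.

Lemma powR_taylor (a b e : R) : 0 < a ->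
  exists2 C, 0 <= C & forall t u, a <= t <= b -> a <= u <= b ->
    `|t `^ e - u `^ e - e * u `^ (e - 1) * (t - u)| <= C * `|t - u| ^+ 2.
Proof.
move=> a0; have [C C0 hC] := powR_lipschitz b (e - 1) a0.
exists (`|e| * C); first exact: mulr_ge0.
move=> t u ht hu.
have dp z : a <= z <= b -> is_derive z 1 (fun z : R => z `^ e) (e * z `^ (e - 1)).
  by move=> /andP[az _]; apply: is_derive1_powR; exact: lt_le_trans az.
have [c [cab cl ->]] := mvt_between dp hu ht.
rewrite -mulrBl -mulrBr !normrM expr2 mulrA ler_wpM2r // -mulrA ler_wpM2l //.
by apply: le_trans (hC _ _ cab hu) _; rewrite ler_wpM2l.
Qed.

Lemma abs_sin_le t : `|sin t| <= `|t|.
Proof.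
have [c [_]] := @mvt sin cos 0 t (@is_derive_sin R).
by rewrite sin0 !subr0 => ->; rewrite normrM ler_piMl // cos_max.
Qed.

Lemma cos_lipschitz t u : `|cos t - cos u| <= `|t - u|.
Proof.
have [c [_ ->]] := @mvt cos (fun z => - sin z) u t (@is_derive_cos R).
by rewrite normrM ler_piMl // normrN sin_max.
Qed.

Lemma abs_cosB1_le t : `|cos t - 1| <= `|t| ^+ 2.
Proof.
have [c []] := @mvt cos (fun z => - sin z) 0 t (@is_derive_cos R).
rewrite cos0 !subr0 => cl ->.
by rewrite normrM normrN expr2 ler_wpM2r // (le_trans (abs_sin_le c)).
Qed.

Lemma abs_sinB_le t : `|sin t - t| <= `|t| ^+ 3.
Proof.
have dp (z : R) : is_derive z (1 : R) (fun z => sin z - z) (cos z - 1).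
  exact: is_deriveB.
have [c []] := mvt 0 t dp.
rewrite sin0 !subr0 => cl ->.
rewrite normrM exprSr ler_wpM2r // (le_trans (abs_cosB1_le c)) //.
by rewrite ler_pXn2r ?nnegrE.
Qed.

Lemma cos_taylor2 t : `|cos t - 1 + t ^+ 2 / 2| <= 2 * `|t| ^+ 3.
Proof.
have dp (z : R) : is_derive z (1 : R) (fun z => cos z + z ^+ 2 / 2) (- sin z + z).
  apply: is_deriveD; apply: (@is_derive_eq _ _ _ _ _ _ _ _ (is_deriveM _ _)).
  by rewrite /GRing.scale /=; lra.
have [c []] := mvt 0 t dp.
rewrite cos0 !subr0 expr0n mul0r addr0 => cl e.
rewrite (_ : cos t - 1 + t ^+ 2 / 2 = (- sin c + c) * t); last by rewrite -e; ring.
rewrite normrM exprSr mulrA ler_wpM2r // addrC -normrN opprB.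
have tc : 2 * `|c| ^+ 2 <= 2 * `|t| ^+ 2 by rewrite ler_pM2l // ler_pXn2r ?nnegrE.
apply: le_trans tc; have [c1|/ltW c1] := leP `|c| 1.
  apply: le_trans (abs_sinB_le c) _; rewrite exprSr.
  have := normr_ge0 c; have := sqr_ge0 `|c|; nra.
apply: le_trans (ler_normB _ _) _; have := abs_sin_le c; nra.
Qed.

Lemma cos_add_taylor (A b : R) :
  `|cos (A + b) - cos A + b * sin A + b ^+ 2 / 2 * cos A| <= 3 * `|b| ^+ 3.
Proof.
rewrite cosD.
have -> : cos A * cos b - sin A * sin b - cos A + b * sin A + b ^+ 2 / 2 * cos A =
  cos A * (cos b - 1 + b ^+ 2 / 2) - sin A * (sin b - b) by ring.
apply: le_trans (ler_normB _ _) _.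
rewrite !normrM.
have := cos_taylor2 b; have := abs_sinB_le b.
have := cos_max A; have := sin_max A.
set u := `|cos A|; set v := `|sin A|; set w := `|_|; set z := `|_|.
have : 0 <= u by exact: normr_ge0. have : 0 <= v by exact: normr_ge0.
have : 0 <= w by exact: normr_ge0. have : 0 <= z by exact: normr_ge0.
by move=> *; nra.
Qed.

(** Inverting [1 - t <= expR (- t)] leaves the polynomial inequality for [1 / (1 - t)]. *)
Lemma expR_le_quad t : `|t| <= 2^-1 -> expR t <= 1 + t + 2 * t ^+ 2.
Proof.
move=> /[dup] ht; rewrite ler_norml => /andP[t1 t2].
have e1 : 1 - t <= expR (- t) by have := expR_ge1Dx (- t).
have p : 0 < 1 - t by lra.
have : expR t <= (1 - t)^-1.
  by rewrite -[expR t]invrK -expRN lef_pV2 ?posrE ?expR_gt0.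
move=> h; apply: (le_trans h).
rewrite -[leLHS]mul1r ler_pdivrMr //.
have : 0 <= t ^+ 2 by exact: sqr_ge0.
by move=> *; nra.
Qed.

Lemma expR_taylor1 t : `|t| <= 2^-1 -> `|expR t - 1 - t| <= 2 * t ^+ 2.
Proof.
move=> ht; have := expR_le_quad ht; have := expR_ge1Dx t => h1 h2.
by rewrite ger0_norm; lra.
Qed.

End Calculus.

(** * Lipschitz functions on the simplex *)

Section Simplex.
Variables (R : realType) (d : nat).
Implicit Types (x y : 'rV[R]_d) (v : 'cV[R]_d) (f g : 'rV[R]_d -> R).

Definition simp x := (forall i, 0 <= x 0 i) /\ \sum_i x 0 i = 1.

Definition l1 x : R := \sum_i `|x 0 i|.

Lemma l1_ge0 x : 0 <= l1 x. Proof. exact: sumr_ge0. Qed.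

Lemma coord_le_l1 x i : `|x 0 i| <= l1 x.
Proof. by rewrite /l1 (bigD1 i) //= lerDl sumr_ge0. Qed.

Lemma simp_l1 x : simp x -> l1 x = 1.
Proof. by case=> x0 <-; apply: eq_bigr => i _; rewrite ger0_norm. Qed.

Lemma simp_coord x i : simp x -> 0 <= x 0 i <= 1.
Proof.
move=> sx; case: (sx) => x0 _; rewrite x0 /= -(simp_l1 sx).
by apply: le_trans (coord_le_l1 x i); exact: ler_norm.
Qed.

Lemma l1D x y : l1 (x + y) <= l1 x + l1 y.
Proof.
by rewrite /l1 -big_split ler_sum // => i _; rewrite mxE ler_normD.
Qed.

Lemma l1Z (a : R) x : l1 (a *: x) = `|a| * l1 x.
Proof.
by rewrite /l1 mulr_sumr; apply: eq_bigr => i _; rewrite mxE normrM.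
Qed.

Lemma simp_delta (j : 'I_d) : simp (delta_mx 0 j).
Proof.
split=> [i|]; first by rewrite mxE.
rewrite (bigD1 j) //= mxE !eqxx big1 ?addr0 // => i ij.
by rewrite mxE eqxx (negbTE ij).
Qed.

Lemma simp_convex (c : R) x y : 0 <= c <= 1 -> simp x -> simp y ->
  simp ((1 - c) *: x + c *: y).
Proof.
move=> /andP[c0 c1] [x0 x1] [y0 y1]; split.
  by move=> i; rewrite !mxE addr_ge0 // mulr_ge0 // subr_ge0.
under eq_bigr do rewrite !mxE.
by rewrite big_split /= -!mulr_sumr x1 y1 !mulr1 subrK.
Qed.

Lemma l1_convex (c : R) x y : 0 <= c -> simp x -> simp y ->
  l1 ((1 - c) *: x + c *: y - x) <= 2 * c.
Proof.
move=> c0 sx sy.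
have -> : (1 - c) *: x + c *: y - x = c *: y + (- c) *: x.
  by apply/matrixP => i j; rewrite !mxE; ring.
apply: le_trans (l1D _ _) _.
by rewrite !l1Z (simp_l1 sx) (simp_l1 sy) normrN ger0_norm // !mulr1 mulr_natl mulr2n.
Qed.

(** The sup bound belongs to the definition because it makes the class stable under products. *)
Definition lip f := exists C, [/\ 0 <= C,
  forall x, simp x -> `|f x| <= C &
  forall x y, simp x -> simp y -> `|f x - f y| <= C * l1 (x - y)].

Lemma lip_cst (c : R) : lip (fun => c).
Proof.
exists `|c|; split=> // x y _ _.
by rewrite subrr normr0 mulr_ge0 // l1_ge0.
Qed.

Lemma lip_ext f g : f =1 g -> lip f -> lip g.
Proof. by move=> fg [C [C0 h1 h2]]; exists C; split=> // *; rewrite -!fg; auto. Qed.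

Lemma lip_add f g : lip f -> lip g -> lip (fun x => f x + g x).
Proof.
move=> [C [C0 f1 f2]] [D [D0 g1 g2]]; exists (C + D); split.
- exact: addr_ge0.
- by move=> x sx; apply: le_trans (ler_normD _ _) _; rewrite lerD ?f1 ?g1.
move=> x y sx sy; rewrite opprD addrACA mulrDl.
by apply: le_trans (ler_normD _ _) _; rewrite lerD ?f2 ?g2.
Qed.

Lemma lip_mul f g : lip f -> lip g -> lip (fun x => f x * g x).
Proof.
move=> [C [C0 f1 f2]] [D [D0 g1 g2]]; exists (2 * (C * D)); split.
- by rewrite !mulr_ge0.
- move=> x sx; rewrite normrM; apply: le_trans (ler_pM _ _ (f1 _ sx) (g1 _ sx)) _ => //.
  by rewrite ler_peMl ?mulr_ge0 // ler1n.
move=> x y sx sy.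
have -> : f x * g x - f y * g y = (f x - f y) * g x + f y * (g x - g y) by ring.
apply: le_trans (ler_normD _ _) _; rewrite !normrM.
have -> : 2 * (C * D) * l1 (x - y) = C * l1 (x - y) * D + C * (D * l1 (x - y)) by ring.
by apply: lerD; apply: ler_pM; rewrite ?f1 ?f2 ?g1 ?g2.
Qed.

Lemma lip_opp f : lip f -> lip (fun x => - f x).
Proof.
by move=> h; apply: lip_ext (lip_mul (lip_cst (-1)) h) => x; rewrite mulN1r.
Qed.

Lemma lip_sum (I : finType) (F : I -> 'rV[R]_d -> R) :
  (forall i, lip (F i)) -> lip (fun x => \sum_i F i x).
Proof.
move=> hF.
have main (s : seq I) : lip (fun x => \sum_(i <- s) F i x).
  elim: s => [|i s IHs].
    by apply: lip_ext (lip_cst 0) => x; rewrite big_nil.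
  by apply: lip_ext (lip_add (hF i) IHs) => x; rewrite big_cons.
exact: main.
Qed.

Lemma lip_coord i : lip (fun x => x 0 i).
Proof.
exists 1; split=> //.
  by move=> x /(simp_coord i) /andP[x0 x1]; rewrite ger0_norm.
by move=> x y _ _; rewrite mul1r; apply: le_trans (coord_le_l1 _ i); rewrite !mxE.
Qed.

Lemma lip_lin v : lip (fun x => (x *m v) 0 0).
Proof.
apply: (@lip_ext (fun x => \sum_i x 0 i * v i 0)); first by move=> x; rewrite mxE.
by apply: lip_sum => i; apply: lip_mul; [exact: lip_coord | exact: lip_cst].
Qed.

(** Positive linear forms stay in a compact part of the open half-line, where powers with any real
    exponent are smooth. The lower bound [c^-1] works because [c] dominates every [(v i 0)^-1]. *)
Lemma lin_range v : (forall i, 0 < v i 0) ->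
  exists a b, 0 < a /\ forall x, simp x -> a <= (x *m v) 0 0 <= b.
Proof.
move=> v0; have inv0 i : 0 < (v i 0)^-1 by rewrite invr_gt0.
pose c := 1 + \sum_i (v i 0)^-1.
have c0 : 0 < c by rewrite /c ltr_wpDr // sumr_ge0 // => i _; exact: ltW.
exists c^-1, (\sum_i v i 0); split; first by rewrite invr_gt0.
move=> x sx; have [x0 x1] := sx; apply/andP; split; rewrite mxE.
  rewrite -[c^-1]mul1r -x1 mulr_suml ler_sum // => i _.
  rewrite ler_wpM2l // -[v i 0]invrK lef_pV2 ?posrE // /c (bigD1 i) //= addrCA lerDl.
  by rewrite addr_ge0 // sumr_ge0 // => j _; exact: ltW.
rewrite ler_sum // => i _; case/andP: (simp_coord i sx) => _ h.
by rewrite ler_piMl // ltW.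
Qed.

Lemma lip_powR v (e : R) : (forall i, 0 < v i 0) ->
  lip (fun x => ((x *m v) 0 0) `^ e).
Proof.
move=> v0; have [a [b [a0 hab]]] := lin_range v0.
have [C C0 hC] := powR_lipschitz b e a0; have [D D0 hD] := powR_bounded b e a0.
have [L [L0 _ hL]] := lip_lin v.
exists (D + C * L); split; first by rewrite addr_ge0 // mulr_ge0.
  by move=> x sx; rewrite (le_trans (hD _ (hab _ sx))) // lerDl mulr_ge0.
move=> x y sx sy; apply: le_trans (hC _ _ (hab _ sx) (hab _ sy)) _.
apply: (@le_trans _ _ (C * (L * l1 (x - y)))); first by rewrite ler_wpM2l // hL.
by rewrite mulrA ler_wpM2r ?l1_ge0 // lerDr.
Qed.

End Simplex.

Section LipschitzVectors.
Variables (R : realType) (d m : nat).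
Implicit Types (F G : 'rV[R]_d -> 'rV[R]_m) (f : 'rV[R]_d -> R).

Definition lipv F := forall k, lip (fun x => F x 0 k).

Lemma lipv_cst (c : 'rV[R]_m) : lipv (fun _ : 'rV[R]_d => c).
Proof. by move=> k; exact: lip_cst. Qed.

Lemma lipvD F G : lipv F -> lipv G -> lipv (fun x => F x + G x).
Proof.
move=> hF hG k; apply: lip_ext (lip_add (hF k) (hG k)) => x; by rewrite mxE.
Qed.

Lemma lipvZ f F : lip f -> lipv F -> lipv (fun x => f x *: F x).
Proof.
by move=> hf hF k; apply: lip_ext (lip_mul hf (hF k)) => x; rewrite mxE.
Qed.

Lemma lipvB F G : lipv F -> lipv G -> lipv (fun x => F x - G x).
Proof.
move=> hF hG k; apply: lip_ext (lip_add (hF k) (lip_opp (hG k))) => x.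
by rewrite !mxE.
Qed.

Lemma lipvM p F (A : 'M[R]_(m, p)) : lipv F ->
  forall k, lip (fun x => (F x *m A) 0 k).
Proof.
move=> hF k; apply: (@lip_ext _ _ (fun x => \sum_j F x 0 j * A j k)).
  by move=> x; rewrite mxE.
by apply: lip_sum => j; apply: lip_mul => //; exact: lip_cst.
Qed.

Lemma lipv_bounds F : lipv F -> exists C, [/\ 0 <= C,
  forall x, simp x -> l1 (F x) <= C &
  forall x y, simp x -> simp y -> l1 (F x - F y) <= C * l1 (x - y)].
Proof.
move=> hF; pose C k := sval (cid (hF k)).
have hC k := svalP (cid (hF k)).
exists (\sum_k C k); split.
- by apply: sumr_ge0 => k _; case: (hC k).
- by move=> x sx; apply: ler_sum => k _; case: (hC k) => _ h _; exact: h.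
move=> x y sx sy; rewrite mulr_suml; apply: ler_sum => k _; rewrite !mxE.
by case: (hC k) => _ _; exact.
Qed.

End LipschitzVectors.

Lemma lipv_id (R : realType) (d : nat) : lipv (fun x : 'rV[R]_d => x).
Proof. by move=> k; exact: lip_coord. Qed.

Lemma l1_mulmx (R : realType) (d m : nat) (A : 'M[R]_(d, m)) :
  exists2 C, 0 <= C & forall z : 'rV[R]_d, l1 (z *m A) <= C * l1 z.
Proof.
exists (\sum_k \sum_j `|A j k|).
  by apply: sumr_ge0 => k _; exact: sumr_ge0.
move=> z; rewrite mulr_suml; apply: ler_sum => k _; rewrite mxE.
apply: le_trans (ler_norm_sum _ _ _) _; rewrite mulr_suml; apply: ler_sum => j _.
by rewrite normrM mulrC ler_wpM2l // coord_le_l1.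
Qed.

Lemma l1N (R : realType) (d : nat) (x : 'rV[R]_d) : l1 (- x) = l1 x.
Proof. by rewrite -scaleN1r l1Z normrN normr1 mul1r. Qed.

Lemma l1B (R : realType) (d : nat) (x y : 'rV[R]_d) : l1 (x - y) <= l1 x + l1 y.
Proof. by rewrite -(l1N y) l1D. Qed.

Lemma powRB1_mulr (R : realType) (t e : R) : 0 < t -> t `^ (e - 1) * t = t `^ e.
Proof.
move=> t0; rewrite powRB; last by rewrite (gt_eqF t0) implybT.
by rewrite (powRr1 (ltW t0)) divfK // gt_eqF.
Qed.

(** * Linearisation of the mean field *)

Section Model.
Variables (R : realType) (d : nat) (Ph M : 'M[R]_d) (nu : 'rV[R]_d) (r : 'cV[R]_d).
Variables (th b K0 : R).

Definition absorb i : R := 1 - \sum_j Ph i j.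

Definition kern (x : 'rV[R]_d) i j : R := Ph i j + absorb i * x 0 j.

(** The expected absorption times. *)
Definition lifetime : 'cV[R]_d := M *m const_mx 1.

Definition mass (x : 'rV[R]_d) : R := (x *m r) 0 0.

(** It normalises [x *m M], the occupation measure before absorption, to the stationary law of
    [kern x]. It is written as a power so that [lip_powR] applies. *)
Definition phi (x : 'rV[R]_d) : R := ((x *m lifetime) 0 0) `^ (-1).

(* Along the mean field [phi x *: (x *m M) - x] one has
   [(ln mass)' = th * phi - 1], so the factor [mass `^ b] makes [psi] decay at the
   uniform rate [b] although [phi] is not constant. *)
Definition psi (x : 'rV[R]_d) : 'rV[R]_d :=
  mass x `^ (b - 1) *: x - mass x `^ b *: nu.

Definition dpsi (x v : 'rV[R]_d) : 'rV[R]_d :=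
  mass x `^ (b - 1) *: v +
  mass v *: (((b - 1) * mass x `^ (b - 1 - 1)) *: x - (b * mass x `^ (b - 1)) *: nu).

(* [dpsi x] applied to the solution of the Poisson equation of the kernel
   [kern x]. *)
Definition poisson (x : 'rV[R]_d) (i : 'I_d) : 'rV[R]_d :=
  dpsi x (row i M - (lifetime i 0 * phi x) *: (x *m M)).

(** A closed form, by the Poisson equation, of the mean of [poisson x] one step after [i] (see
    [sum_kern_poisson]); subtracting it makes [noise] a martingale increment. *)
Definition corr (x : 'rV[R]_d) (i : 'I_d) : 'rV[R]_d :=
  poisson x i - dpsi x (delta_mx 0 i - phi x *: (x *m M)).

Definition noise (x : 'rV[R]_d) (i j : 'I_d) : 'rV[R]_d := poisson x j - corr x i.

(* The rank-one term does not act on [psi x], which [r] annihilates; it moves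
   the Perron eigenvalue [th] of [M] out of the way. *)
Definition drift_mx : 'M[R]_d := M - (th - b * th)%:M - K0 *: (r *m nu).

Definition zcorr (g : R) (x : 'rV[R]_d) (i : 'I_d) : 'rV[R]_d :=
  psi x + g *: corr x i.

Hypothesis Ph_ge0 : forall i j, 0 <= Ph i j.
Hypothesis Ph_le1 : forall i, \sum_j Ph i j <= 1.
Hypothesis r_gt0 : forall i, 0 < r i 0.
Hypothesis lifetime_gt0 : forall i, 0 < lifetime i 0.
Hypothesis PhM : Ph *m M = M - 1%:M.
Hypothesis Mr : M *m r = th *: r.
Hypothesis nuM : nu *m M = th *: nu.
Hypothesis nur : nu *m r = 1%:M.
Hypothesis nu_simp : simp nu.

Lemma kern_ge0 x i j : simp x -> 0 <= kern x i j.
Proof. by case=> x0 _; rewrite addr_ge0 // mulr_ge0 // subr_ge0. Qed.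

Lemma kern_sum x i : simp x -> \sum_j kern x i j = 1.
Proof.
by case=> _ x1; rewrite big_split /= -mulr_sumr x1 mulr1 addrC subrK.
Qed.

Lemma massD x y : mass (x + y) = mass x + mass y.
Proof. by rewrite /mass mulmxDl mxE. Qed.

Lemma massZ (c : R) x : mass (c *: x) = c * mass x.
Proof. by rewrite /mass -scalemxAl mxE. Qed.

Lemma dpsiD x u v : dpsi x (u + v) = dpsi x u + dpsi x v.
Proof. by rewrite /dpsi massD scalerDl scalerDr addrACA. Qed.

Lemma dpsiZ x (c : R) v : dpsi x (c *: v) = c *: dpsi x v.
Proof. by apply/matrixP => k l; rewrite /dpsi massZ !mxE; ring. Qed.

Lemma dpsiB x u v : dpsi x (u - v) = dpsi x u - dpsi x v.
Proof. by rewrite dpsiD -[- v]scaleN1r dpsiZ scaleN1r. Qed.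

Lemma dpsi_sum x (I : finType) (F : I -> 'rV[R]_d) :
  dpsi x (\sum_i F i) = \sum_i dpsi x (F i).
Proof.
apply: (big_morph (dpsi x)); first exact: dpsiD.
by have := dpsiB x 0 0; rewrite !subrr.
Qed.

Lemma mass_gt0 x : simp x -> 0 < mass x.
Proof.
by move=> sx; have [a [c [a0 /(_ _ sx)/andP[h _]]]] := lin_range r_gt0; exact: lt_le_trans h.
Qed.

Lemma lifetime_lin_gt0 x : simp x -> 0 < (x *m lifetime) 0 0.
Proof.
by move=> sx; have [a [c [a0 /(_ _ sx)/andP[h _]]]] := lin_range lifetime_gt0; exact: lt_le_trans h.
Qed.

Lemma phi_lifetime x : simp x -> phi x * (x *m lifetime) 0 0 = 1.
Proof.
by move=> /lifetime_lin_gt0 h; rewrite /phi (powR_inv1 (ltW h)) mulVf // gt_eqF.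
Qed.

Lemma phi_ge0 x : 0 <= phi x. Proof. exact: powR_ge0. Qed.

Lemma sum_kern_row x i :
  \sum_j kern x i j *: row j M = row i M - delta_mx 0 i + absorb i *: (x *m M).
Proof.
apply/matrixP => k l; rewrite ord1 {k} summxE.
under eq_bigr do rewrite /kern !mxE mulrDl.
rewrite big_split [RHS]mxE /=; congr (_ + _).
  have /matrixP /(_ i l) := PhM; rewrite !mxE => ->.
  by rewrite eqxx [l == i]eq_sym.
rewrite !mxE mulr_sumr; apply: eq_bigr => j _; by rewrite mulrA.
Qed.

Lemma sum_kern_lifetime x i :
  \sum_j kern x i j * lifetime j 0 = lifetime i 0 - 1 + absorb i * (x *m lifetime) 0 0.
Proof.
under eq_bigr do rewrite mulrDl.
rewrite big_split /=; congr (_ + _).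
  have /matrixP /(_ i 0) : Ph *m lifetime = lifetime - const_mx 1.
    by rewrite /lifetime mulmxA PhM mulmxBl mul1mx.
  by rewrite !mxE.
rewrite mxE mulr_sumr; apply: eq_bigr => j _; by rewrite mulrA.
Qed.

(** The rank-one part of the kernel adds [absorb i *: (x *m M)] to the mean of the rows of [M]. It
    adds the same to the mean of the subtracted term, because [phi x] times [x *m lifetime] is 1,
    and the two cancel. *)
Lemma sum_kern_poisson x i : simp x ->
  \sum_j kern x i j *: poisson x j = corr x i.
Proof.
move=> sx; rewrite /corr /poisson -dpsiB.
under eq_bigr do rewrite -dpsiZ.
rewrite -dpsi_sum; congr (dpsi x _).
under eq_bigr do rewrite scalerBr scalerA mulrA.
rewrite sumrB sum_kern_row -scaler_suml -mulr_suml sum_kern_lifetime.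
have p := phi_lifetime sx.
have -> : (lifetime i 0 - 1 + absorb i * (x *m lifetime) 0 0) * phi x =
  lifetime i 0 * phi x - phi x + absorb i.
  transitivity (lifetime i 0 * phi x - phi x + absorb i * (phi x * (x *m lifetime) 0 0)).
    by ring.
  by rewrite p mulr1.
apply/matrixP => k l; rewrite !mxE; ring.
Qed.

Lemma sum_kern_noise x i : simp x -> \sum_j kern x i j *: noise x i j = 0.
Proof.
move=> sx; under eq_bigr do rewrite scalerBr.
by rewrite sumrB sum_kern_poisson // -scaler_suml kern_sum // scale1r subrr.
Qed.

Lemma psi_r x : simp x -> psi x *m r = 0.
Proof.
move=> /mass_gt0 t0; have xr : x *m r = (mass x)%:M by exact: mx11_scalar.
rewrite /psi mulmxBl -!scalemxAl nur xr !scale_scalar_mx mulr1.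
by rewrite powRB1_mulr // subrr.
Qed.

(** Apart from the scalar [phi x] the result is linear in [psi x], without quadratic remainder; this
    makes the later estimates global on the simplex. *)
Lemma dpsi_drift x : simp x ->
  dpsi x (phi x *: (x *m M) - x) = phi x *: (psi x *m drift_mx) - b *: psi x.
Proof.
move=> sx; have t0 := mass_gt0 sx.
have e1 : mass x `^ (b - 1) * mass x = mass x `^ b by rewrite powRB1_mulr.
have e2 : mass x `^ (b - 1 - 1) * mass x = mass x `^ (b - 1) by rewrite powRB1_mulr.
have tm : mass (x *m M) = th * mass x by rewrite /mass -mulmxA Mr -scalemxAr mxE.
have -> : psi x *m drift_mx = psi x *m M - (th - b * th) *: psi x.
  by rewrite /drift_mx !mulmxBr mul_mx_scalar -scalemxAr mulmxA psi_r // mul0mx scaler0 subr0.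
rewrite dpsiB dpsiZ /dpsi tm {1 3}/psi mulmxBl -!scalemxAl nuM.
apply/matrixP => k l; rewrite !mxE -e1 -e2; ring.
Qed.

Lemma lip_mass (e : R) : lip (fun x => mass x `^ e).
Proof. exact: lip_powR. Qed.

Lemma lip_phi : lip phi.
Proof. exact: lip_powR. Qed.

Lemma lipv_psi : lipv psi.
Proof.
apply: lipvB; apply: lipvZ; [exact: lip_mass | exact: lipv_id | exact: lip_mass |].
exact: lipv_cst.
Qed.

Lemma lipv_dpsi (F : 'rV[R]_d -> 'rV[R]_d) : lipv F -> lipv (fun x => dpsi x (F x)).
Proof.
move=> hF; apply: lipvD; apply: lipvZ => //; first exact: lip_mass.
  exact: (lipvM r hF 0).
apply: lipvB; apply: lipvZ.
- by apply: lip_mul; [exact: lip_cst | exact: lip_mass].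
- exact: lipv_id.
- by apply: lip_mul; [exact: lip_cst | exact: lip_mass].
exact: lipv_cst.
Qed.

Lemma lipv_mulM : lipv (fun x : 'rV[R]_d => x *m M).
Proof. by move=> k; apply: lipvM; exact: lipv_id. Qed.

Lemma lipv_poisson i : lipv (fun x => poisson x i).
Proof.
apply: lipv_dpsi; apply: lipvB; first exact: lipv_cst.
apply: lipvZ; last exact: lipv_mulM.
by apply: lip_mul; [exact: lip_cst | exact: lip_phi].
Qed.

Lemma lipv_corr i : lipv (fun x => corr x i).
Proof.
apply: lipvB; first exact: lipv_poisson.
apply: lipv_dpsi; apply: lipvB; first exact: lipv_cst.
by apply: lipvZ; [exact: lip_phi | exact: lipv_mulM].
Qed.

Lemma lipv_noise i j : lipv (fun x => noise x i j).
Proof. by apply: lipvB; [exact: lipv_poisson | exact: lipv_corr]. Qed.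

Lemma lip_kern i j : lip (fun x => kern x i j).
Proof.
apply: lip_add; first exact: lip_cst.
by apply: lip_mul; [exact: lip_cst | exact: lip_coord].
Qed.

Lemma psi_taylor : exists2 C, 0 <= C & forall x y, simp x -> simp y ->
  l1 (psi y - psi x - dpsi x (y - x)) <= C * l1 (y - x) ^+ 2.
Proof.
have [t0 [t1 [t0_gt0 ht]]] := lin_range r_gt0.
have [C1 C1_ge0 h1] := powR_taylor t1 (b - 1) t0_gt0.
have [C2 C2_ge0 h2] := powR_lipschitz t1 (b - 1) t0_gt0.
have [C3 C3_ge0 h3] := powR_taylor t1 b t0_gt0.
have [D [D_ge0 _ hD]] := lip_lin r.
exists (d%:R * (C1 * D ^+ 2 + C2 * D + C3 * D ^+ 2)).
  by rewrite mulr_ge0 // !addr_ge0 // mulr_ge0 // sqr_ge0.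
move=> x y sx sy; set L := l1 (y - x).
have L0 : 0 <= L by exact: l1_ge0.
have tau : `|mass y - mass x| <= D * L by exact: hD.
have tau2 : `|mass y - mass x| ^+ 2 <= D ^+ 2 * L ^+ 2.
  by rewrite -exprMn ler_pXn2r ?nnegrE // mulr_ge0.
have t1x := ht _ sx; have t1y := ht _ sy.
have main k : `|(psi y - psi x - dpsi x (y - x)) 0 k| <=
    (C1 * D ^+ 2 + C2 * D + C3 * D ^+ 2) * L ^+ 2.
  (* Two Taylor remainders of powers of the mass, and one product of two increments. *)
  have -> : (psi y - psi x - dpsi x (y - x)) 0 k =
    x 0 k * (mass y `^ (b - 1) - mass x `^ (b - 1)
       - (b - 1) * mass x `^ (b - 1 - 1) * (mass y - mass x))
    + (y 0 k - x 0 k) * (mass y `^ (b - 1) - mass x `^ (b - 1))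
    - nu 0 k * (mass y `^ b - mass x `^ b - b * mass x `^ (b - 1) * (mass y - mass x)).
    rewrite /psi /dpsi -[mass (y - x)]/(mass (y + - x)) massD -[- x]scaleN1r massZ !mxE; ring.
  have n1 : `|x 0 k| <= 1 by case/andP: (simp_coord k sx) => ? ?; rewrite ger0_norm.
  have n2 : `|nu 0 k| <= 1 by case/andP: (simp_coord k nu_simp) => ? ?; rewrite ger0_norm.
  have n3 : `|y 0 k - x 0 k| <= L.
    by apply: le_trans (coord_le_l1 _ k); rewrite !mxE.
  apply: le_trans (ler_normB _ _) _.
  apply: le_trans (lerD (ler_normD _ _) (lexx _)) _.
  have -> : (C1 * D ^+ 2 + C2 * D + C3 * D ^+ 2) * L ^+ 2 =
    C1 * (D ^+ 2 * L ^+ 2) + C2 * (D * L ^+ 2) + C3 * (D ^+ 2 * L ^+ 2) by ring.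
  rewrite !normrM; apply: lerD; first apply: lerD.
  - rewrite -[leRHS]mul1r; apply: ler_pM => //.
    by apply: le_trans (h1 _ _ t1y t1x) _; rewrite ler_wpM2l.
  - have -> : C2 * (D * L ^+ 2) = L * (C2 * (D * L)) by ring.
    apply: ler_pM => //; apply: le_trans (h2 _ _ t1y t1x) _.
    by rewrite ler_wpM2l.
  rewrite -[leRHS]mul1r; apply: ler_pM => //.
  by apply: le_trans (h3 _ _ t1y t1x) _; rewrite ler_wpM2l.
rewrite /l1 -mulrA -[d in d%:R]card_ord mulr_natl -sumr_const.
by apply: ler_sum => k _.
Qed.

Lemma corr_bounds : exists C, [/\ 0 <= C,
  forall x i, simp x -> l1 (corr x i) <= C &
  forall x y i, simp x -> simp y -> l1 (corr x i - corr y i) <= C * l1 (x - y)].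
Proof.
pose C i := sval (cid (lipv_bounds (lipv_corr i))).
have hC i := svalP (cid (lipv_bounds (lipv_corr i))).
have C0 i : 0 <= C i by case: (hC i).
have Ci i : C i <= \sum_i C i by rewrite (bigD1 i) //= lerDl sumr_ge0.
exists (\sum_i C i); split; first exact: sumr_ge0.
  by move=> x i sx; apply: le_trans (Ci i); case: (hC i) => _ h _; exact: h.
move=> x y i sx sy; apply: (@le_trans _ _ (C i * l1 (x - y))).
  by case: (hC i) => _ _; exact.
by rewrite ler_wpM2r // l1_ge0.
Qed.

Definition upd (g : R) (x : 'rV[R]_d) (j : 'I_d) : 'rV[R]_d :=
  (1 - g) *: x + g *: delta_mx 0 j.

Lemma upd_simp g x j : 0 <= g <= 1 -> simp x -> simp (upd g x j).
Proof. by move=> g01 sx; apply: simp_convex => //; exact: simp_delta. Qed.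

(** By the Poisson equation the fluctuation [delta_mx 0 j - phi x *: (x *m M)] enters as
    [poisson x j - corr x j]. The new corrector [g' *: corr y j] cancels [- g *: corr x j] up to
    second order, and the old one, [g *: corr x i], centres [poisson x j] into [noise x i j]. The
    bound on [g - g'] allows the exchange of [g'] for [g]. *)
Lemma zcorr_step (C0 : R) : 0 <= C0 -> exists2 C, 0 <= C &
  forall g g' x i j, simp x -> 0 < g' -> g' <= g -> g <= 1 -> g - g' <= C0 * g ^+ 2 ->
  l1 (zcorr g' (upd g x j) j - (zcorr g x i
       + g *: (phi x *: (zcorr g x i *m drift_mx) - b *: zcorr g x i)
       + g *: noise x i j)) <= C * g ^+ 2.
Proof.
move=> C0_ge0.
have [C1 C1_ge0 h1] := psi_taylor.
have [C2 [C2_ge0 h2 h3]] := corr_bounds.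
have [C4 C4_ge0 h4] := l1_mulmx drift_mx.
have [C5 [C5_ge0 h5 _]] := lip_phi.
exists (C1 * 4 + (C2 * 2 + C0 * C2 + (C5 * (C4 * C2) + `|b| * C2))).
  by rewrite !addr_ge0 ?mulr_ge0.
move=> g g' x i j sx g'0 g'g g1 gg.
have g0 : 0 <= g by rewrite (le_trans (ltW g'0)).
have sy : simp (upd g x j) by apply: upd_simp => //; rewrite g0.
set y := upd g x j in sy *.
have yx : y - x = g *: (delta_mx 0 j - x).
  by apply/matrixP => k l; rewrite !mxE; ring.
have lyx : l1 (y - x) <= 2 * g by apply: l1_convex => //; exact: simp_delta.
have e : dpsi x (y - x) = g *: (poisson x j - corr x j
    + (phi x *: (psi x *m drift_mx) - b *: psi x)).
  have cE : poisson x j - corr x j = dpsi x (delta_mx 0 j - phi x *: (x *m M)).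
    by rewrite /corr opprB addrC subrK.
  by rewrite yx dpsiZ cE -dpsi_drift // -dpsiD addrA subrK.
have -> : zcorr g' y j - (zcorr g x i
       + g *: (phi x *: (zcorr g x i *m drift_mx) - b *: zcorr g x i) + g *: noise x i j)
  = (psi y - psi x - dpsi x (y - x)) + (g' *: (corr y j - corr x j)
    - (g - g') *: corr x j
    - g ^+ 2 *: (phi x *: (corr x i *m drift_mx) - b *: corr x i)).
  rewrite e /noise /zcorr mulmxDl -scalemxAl.
  move: (psi y) (psi x) (psi x *m drift_mx) (corr x i *m drift_mx) (poisson x j)
    (corr y j) (corr x j) (corr x i) (phi x) => v1 v2 v3 v4 v5 v6 v7 v8 v9.
  by apply/matrixP => k l; rewrite !mxE; ring.
rewrite mulrDl; apply: le_trans (l1D _ _) _; apply: lerD.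
  apply: le_trans (h1 _ _ sx sy) _; rewrite -mulrA ler_wpM2l //.
  rewrite -(_ : (2 * g) ^+ 2 = 4 * g ^+ 2); last by ring.
  by rewrite ler_pXn2r ?nnegrE ?l1_ge0 // mulr_ge0.
rewrite mulrDl; apply: le_trans (l1B _ _) _; apply: lerD; last first.
  rewrite l1Z ger0_norm ?sqr_ge0 // mulrC ler_wpM2r ?sqr_ge0 //.
  apply: le_trans (l1B _ _) _; rewrite !l1Z; apply: lerD.
    apply: ler_pM; rewrite ?l1_ge0 ?h5 //; apply: le_trans (h4 _) _.
    by rewrite ler_wpM2l // h2.
  by rewrite ler_wpM2l // h2.
rewrite mulrDl; apply: le_trans (l1B _ _) _; apply: lerD; rewrite l1Z.
  rewrite (ger0_norm (ltW g'0)) (_ : C2 * 2 * g ^+ 2 = g * (C2 * (2 * g))); last by ring.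
  apply: ler_pM; rewrite ?l1_ge0 ?(ltW g'0) //; apply: le_trans (h3 _ _ _ sy sx) _.
  by rewrite ler_wpM2l.
by rewrite ger0_norm ?subr_ge0 // mulrAC ler_pM ?l1_ge0 ?subr_ge0 ?h2.
Qed.

End Model.

(** * Quadratic forms given by a factor *)

Section Eform.
Variables (R : realType) (d m : nat) (E : 'M[R]_(d, m)).
Implicit Types x y z : 'rV[R]_d.

Lemma eformE y z : eform E y z = \sum_k (y *m E) 0 k * (z *m E) 0 k.
Proof. by rewrite /eform mxE; apply: eq_bigr => k _; rewrite [(_^T) _ _]mxE. Qed.

Lemma eformC y z : eform E y z = eform E z y.
Proof. by rewrite !eformE; apply: eq_bigr => k _; rewrite mulrC. Qed.

Lemma eformDl x y z : eform E (x + y) z = eform E x z + eform E y z.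
Proof. by rewrite /eform !mulmxDl mxE. Qed.

Lemma eformZl (c : R) y z : eform E (c *: y) z = c * eform E y z.
Proof. by rewrite /eform -!scalemxAl mxE. Qed.

Lemma eformDr x y z : eform E x (y + z) = eform E x y + eform E x z.
Proof. by rewrite eformC eformDl !(eformC _ x). Qed.

Lemma eformZr (c : R) y z : eform E y (c *: z) = c * eform E y z.
Proof. by rewrite eformC eformZl eformC. Qed.

Lemma eform_sq x y :
  eform E (x + y) (x + y) = eform E x x + 2 * eform E x y + eform E y y.
Proof. rewrite eformDl !eformDr (eformC y x); ring. Qed.

Lemma eform_sumr (I : finType) y (k : I -> R) (v : I -> 'rV[R]_d) :
  eform E y (\sum_j k j *: v j) = \sum_j k j * eform E y (v j).
Proof.
rewrite /eform mulmx_suml linear_sum mulmx_sumr summxE.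
by apply: eq_bigr => j _; rewrite -scalemxAl linearZ -scalemxAr mxE.
Qed.

Lemma eform_ge0 z : 0 <= eform E z z.
Proof. by rewrite eformE sumr_ge0 // => k _; rewrite -expr2 sqr_ge0. Qed.

Lemma eform_bound : exists2 C, 0 <= C &
  forall y z, `|eform E y z| <= C * (l1 y * l1 z).
Proof.
have [C C0 hC] := l1_mulmx E.
exists (C ^+ 2); first exact: sqr_ge0.
move=> y z; rewrite eformE; apply: le_trans (ler_norm_sum _ _ _) _.
apply: (@le_trans _ _ (l1 (y *m E) * l1 (z *m E))).
  rewrite /l1 mulr_suml ler_sum // => k _; rewrite normrM ler_wpM2l //.
  exact: coord_le_l1.
have -> : C ^+ 2 * (l1 y * l1 z) = (C * l1 y) * (C * l1 z) by ring.
by apply: ler_pM; rewrite ?l1_ge0.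
Qed.

Lemma l1_eform C : (forall z k, z 0 k ^+ 2 <= C * eform E z z) ->
  exists2 C', 0 < C' & forall z, l1 z ^+ 2 <= C' * eform E z z.
Proof.
move=> hC; exists (1 + d%:R * (d%:R * `|C|)); first by rewrite ltr_wpDr // !mulr_ge0.
move=> z; apply: le_trans (sum_sqr_le _) _.
apply: (@le_trans _ _ (d%:R * (d%:R * `|C|) * eform E z z)); last first.
  by rewrite ler_wpM2r ?eform_ge0 // lerDr.
rewrite -mulrA ler_wpM2l // -mulrA -[d in d%:R]card_ord mulr_natl -sumr_const.
apply: ler_sum => k _; rewrite real_normK ?num_real //.
by apply: le_trans (hC _ _) _; rewrite ler_wpM2r ?eform_ge0 // ler_norm.
Qed.

End Eform.

(** The tangent at the barycentre lies below the exponential; average it over the two endpoints. *)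
Lemma expR_convex (R : realType) (l w c : R) : 0 <= l <= 1 ->
  expR ((1 - l) * w + l * c) <= (1 - l) * expR w + l * expR c.
Proof.
move=> /andP[l0 l1]; set m := (1 - l) * w + l * c.
have tan u : expR m * (1 + (u - m)) <= expR u.
  have -> : expR u = expR m * expR (u - m) by rewrite -expRD addrC subrK.
  by rewrite ler_wpM2l ?expR_ge0 // expR_ge1Dx.
have h1 : (1 - l) * (expR m * (1 + (w - m))) <= (1 - l) * expR w.
  by rewrite ler_wpM2l // subr_ge0.
have h2 : l * (expR m * (1 + (c - m))) <= l * expR c by rewrite ler_wpM2l.
apply: le_trans (lerD h1 h2); rewrite le_eqVlt; apply/orP; left; apply/eqP.
rewrite /m; ring.
Qed.

Lemma recursion_bounded (R : realType) (u del : nat -> R) (B : R) (N : nat) :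
  (forall n, (N <= n)%N -> 0 <= del n <= 1) ->
  (forall n, (N <= n)%N -> u n.+1 <= (1 - del n) * u n + del n * B) ->
  forall n, (N <= n)%N -> u n <= Num.max (u N) B.
Proof.
move=> hd hu; elim=> [|n IHn]; first by rewrite leqn0 => /eqP ->; rewrite le_max lexx.
rewrite leq_eqVlt => /predU1P[<-|]; first by rewrite le_max lexx.
rewrite ltnS => Nn; have /andP[d0 d1] := hd _ Nn; apply: le_trans (hu _ Nn) _.
set mx := Num.max _ _; have -> : mx = (1 - del n) * mx + del n * mx by ring.
by apply: lerD; apply: ler_wpM2l; rewrite ?subr_ge0 ?IHn // le_max lexx orbT.
Qed.

(** * Expectations along the chain *)

Section Chain.
Variables (R : realType) (d : nat).
Variables (kern : 'rV[R]_d -> 'I_d -> 'I_d -> R) (gam : nat -> R).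
Variables (p0 : 'I_d -> R) (xi : 'I_d -> 'rV[R]_d).
Implicit Types (x : 'rV[R]_d) (f h : 'I_d -> 'rV[R]_d -> R).

Definition chain_step (g : R) f : 'I_d -> 'rV[R]_d -> R :=
  fun i x => \sum_j kern x i j * f j (upd g x j).

(* The expectation of [f X_n x_n] when [X_0] has law [p0] and [x_0 = xi X_0]. *)
Fixpoint chain_exp n f : R :=
  if n is n'.+1 then chain_exp n' (chain_step (gam n') f)
  else \sum_i p0 i * f i (xi i).

Hypothesis kern_ge0 : forall x i j, simp x -> 0 <= kern x i j.
Hypothesis kern_sum : forall x i, simp x -> \sum_j kern x i j = 1.
Hypothesis gam01 : forall n, 0 < gam n <= 1.
Hypothesis p0_ge0 : forall i, 0 <= p0 i.
Hypothesis p0_sum : \sum_i p0 i = 1.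
Hypothesis xi_simp : forall i, simp (xi i).

Lemma upd_gam_simp n x j : simp x -> simp (upd (gam n) x j).
Proof. by apply: upd_simp; case/andP: (gam01 n) => /ltW -> ->. Qed.

Lemma chain_exp_le n f h : (forall i x, simp x -> f i x <= h i x) ->
  chain_exp n f <= chain_exp n h.
Proof.
elim: n f h => [|n IHn] f h fh /=.
  by apply: ler_sum => i _; rewrite ler_wpM2l // fh.
apply: IHn => i x sx; apply: ler_sum => j _.
by rewrite ler_wpM2l ?kern_ge0 // fh //; exact: upd_gam_simp.
Qed.

Lemma chain_exp_eq n f h : (forall i x, simp x -> f i x = h i x) ->
  chain_exp n f = chain_exp n h.
Proof.
by move=> fh; apply/eqP; rewrite eq_le !chain_exp_le // => i x sx; rewrite fh.
Qed.

Lemma chain_expD n f h :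
  chain_exp n (fun i x => f i x + h i x) = chain_exp n f + chain_exp n h.
Proof.
elim: n f h => [|n IHn] f h /=.
  by rewrite -big_split; apply: eq_bigr => i _; rewrite mulrDr.
rewrite -IHn; apply: chain_exp_eq => i x _.
by rewrite /chain_step -big_split; apply: eq_bigr => j _; rewrite mulrDr.
Qed.

Lemma chain_expZ n (c : R) f :
  chain_exp n (fun i x => c * f i x) = c * chain_exp n f.
Proof.
elim: n f => [|n IHn] f /=.
  by rewrite mulr_sumr; apply: eq_bigr => i _; rewrite mulrCA.
rewrite -IHn; apply: chain_exp_eq => i x _.
by rewrite /chain_step mulr_sumr; apply: eq_bigr => j _; rewrite mulrCA.
Qed.

Lemma chain_expB n f h :
  chain_exp n (fun i x => f i x - h i x) = chain_exp n f - chain_exp n h.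
Proof.
rewrite -mulN1r -chain_expZ -chain_expD.
by apply: chain_exp_eq => i x _; rewrite mulN1r.
Qed.

Lemma chain_exp_cst n (c : R) : chain_exp n (fun _ _ => c) = c.
Proof.
elim: n => [|n IHn] /=; first by rewrite -mulr_suml p0_sum mul1r.
rewrite -[RHS]IHn; apply: chain_exp_eq => i x sx.
by rewrite /chain_step -mulr_suml kern_sum // mul1r.
Qed.

Lemma chain_exp_norm n f : `|chain_exp n f| <= chain_exp n (fun i x => `|f i x|).
Proof.
rewrite ler_norml -mulN1r -chain_expZ !chain_exp_le // => i x _.
  exact: ler_norm.
by rewrite mulN1r lerNl; have := ler_norm (- f i x); rewrite normrN lerNl.
Qed.

End Chain.

Ltac nonneg := solve [ repeat first [ assumption | done | by apply: ltW
  | exact: sqr_ge0 | exact: normr_ge0 | exact: expR_ge0 | exact: l1_ge0 | exact: eform_ge0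
  | apply: addr_ge0 | apply: mulr_ge0 | rewrite invr_ge0 ] ].

(** * Exponential moments *)

Section ExponentialMoment.
Variables (R : realType) (d m : nat).
Variables (kern : 'rV[R]_d -> 'I_d -> 'I_d -> R) (gam : nat -> R).
Variables (p0 : 'I_d -> R) (xi : 'I_d -> 'rV[R]_d).
Variables (zcorr : R -> 'rV[R]_d -> 'I_d -> 'rV[R]_d).
Variables (noise : 'rV[R]_d -> 'I_d -> 'I_d -> 'rV[R]_d).
Variables (phi : 'rV[R]_d -> R) (A : 'M[R]_d) (b : R) (E : 'M[R]_(d, m)).
Variables (Cn Cs Cz Cp Ce kap : R) (N0 : nat).
Implicit Types x : 'rV[R]_d.
Hypothesis kern_ge0 : forall x i j, simp x -> 0 <= kern x i j.
Hypothesis kern_sum : forall x i, simp x -> \sum_j kern x i j = 1.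
Hypothesis gam01 : forall n, 0 < gam n <= 1.
Hypothesis gam_cvg0 : forall e, 0 < e -> exists N, forall n, (N <= n)%N -> gam n <= e.
Hypothesis gam_ratio : forall n, (N0 <= n)%N -> gam n / gam n.+1 <= 1 + kap * gam n.
Hypothesis p0_ge0 : forall i, 0 <= p0 i.
Hypothesis p0_sum : \sum_i p0 i = 1.
Hypothesis xi_simp : forall i, simp (xi i).
Hypothesis noise_mean : forall x i, simp x -> \sum_j kern x i j *: noise x i j = 0.
Hypothesis noise_bound : forall x i j, simp x -> l1 (noise x i j) <= Cn.
Hypothesis zcorr_bound : forall g x i, simp x -> 0 <= g <= 1 -> l1 (zcorr g x i) <= Cz.
Hypothesis phi_bound : forall x, simp x -> 0 <= phi x <= Cp.
Hypothesis zcorr_step : forall n x i j, simp x ->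
  l1 (zcorr (gam n.+1) (upd (gam n) x j) j - (zcorr (gam n) x i
     + gam n *: (phi x *: (zcorr (gam n) x i *m A) - b *: zcorr (gam n) x i)
     + gam n *: noise x i j)) <= Cs * gam n ^+ 2.
Hypothesis E_bound : forall z : 'rV[R]_d, l1 z ^+ 2 <= Ce * eform E z z.
Hypothesis E_diss : forall z : 'rV[R]_d, eform E (z *m A) z <= 0.
Hypothesis Ce_gt0 : 0 < Ce.
Hypothesis kap_ge0 : 0 <= kap.
Hypothesis kap_lt : kap < 2 * b.
Hypothesis d_gt0 : (0 < d)%N.

Local Notation W z := (eform E z z).
Local Notation EE := (chain_exp kern gam p0 xi).

Let gam_gt0 n : 0 < gam n. Proof. by case/andP: (gam01 n). Qed.

(** The [A] part of the drift is discarded by [E_diss] whatever the value of [phi x >= 0], so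
    [- b z] supplies the decay. The martingale term is kept apart with two bounds: a constant one,
    to expand the exponential, and one of its square by [W], to absorb that square into the
    decay. *)
Lemma energy_step : exists C1 C2 C3, [/\ 0 <= C1, 0 <= C2 & 0 <= C3] /\
  forall n x i j, simp x ->
   let z := zcorr (gam n) x i in
   let z' := z + gam n *: (phi x *: (z *m A) - b *: z) in
   [/\ W (zcorr (gam n.+1) (upd (gam n) x j) j) <=
       (1 - 2 * b * gam n + C1 * gam n ^+ 2) * W z
         + 2 * gam n * eform E z' (noise x i j) + C2 * gam n ^+ 2,
       eform E z' (noise x i j) ^+ 2 <= C3 * W z &
       `|eform E z' (noise x i j)| <= C3].
Proof.
have [Cf Cf0 hf] := eform_bound E.
have [Ca Ca0 ha] := l1_mulmx A.
pose i0 := Ordinal d_gt0; have sd : simp (delta_mx 0 i0 : 'rV[R]_d) by exact: simp_delta.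
have Cp0 : 0 <= Cp by case/andP: (phi_bound sd) => h1 h2; exact: le_trans h2.
have Cn0 : 0 <= Cn by apply: le_trans (noise_bound i0 i0 sd); exact: l1_ge0.
have Cz0 : 0 <= Cz by apply: le_trans (zcorr_bound (g := 0) i0 sd _); rewrite ?l1_ge0 ?lexx ?ler01.
have Cs0 : 0 <= Cs.
  have := zcorr_step 0 i0 i0 sd; set L := l1 _ => h.
  by rewrite -(pmulr_lge0 _ (exprn_gt0 2 (gam_gt0 0))) (le_trans _ h) // l1_ge0.
pose D := Cp * Ca + `|b|; have D0 : 0 <= D by rewrite addr_ge0 ?mulr_ge0.
pose C3 := (Cf * ((1 + D) * Cn)) ^+ 2 * Ce + Cf * ((1 + D) * Cz * Cn).
exists (Cf * D ^+ 2 * Ce), (2 * (Cf * ((1 + D) * Cz * Cs)) + Cf * (Cn + Cs) ^+ 2), C3.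
have Ce0 := ltW Ce_gt0.
have D1_0 : 0 <= 1 + D by rewrite addr_ge0.
have s0 (u : R) : 0 <= u ^+ 2 := sqr_ge0 u.
have sq_le (u v : R) : 0 <= u -> u <= v -> u ^+ 2 <= v ^+ 2.
  by move=> u0 uv; rewrite ler_pXn2r ?nnegrE // (le_trans u0).
split; first by split; rewrite /C3; do ?[exact: s0 | by [] | apply: addr_ge0 | apply: mulr_ge0].
move=> n x i j sx; set g := gam n; set z := zcorr g x i => /=.
have g0 : 0 < g := gam_gt0 n. have g1 : g <= 1 by case/andP: (gam01 n).
set D1 := phi x *: (z *m A) - b *: z; set z' := z + g *: D1.
have /andP[p1 p2] := phi_bound sx.
have lD : l1 D1 <= D * l1 z.
  apply: le_trans (l1B _ _) _; rewrite !l1Z mulrDl lerD // -mulrA (ger0_norm p1).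
  by apply: ler_pM; rewrite ?l1_ge0.
have lz : l1 z <= Cz by apply: zcorr_bound => //; rewrite (ltW g0).
have lz' : l1 z' <= (1 + D) * l1 z.
  apply: le_trans (l1D _ _) _; rewrite mulrDl mul1r lerD2l l1Z (ger0_norm (ltW g0)).
  by apply: le_trans lD; rewrite ler_piMl // l1_ge0.
have lz'' : l1 z' <= (1 + D) * Cz.
  by apply: le_trans lz' _; rewrite ler_wpM2l // addr_ge0.
have ln := noise_bound i j sx.
have bound1 : `|eform E z' (noise x i j)| <= Cf * ((1 + D) * Cn) * l1 z.
  apply: le_trans (hf _ _) _.
  have -> : Cf * ((1 + D) * Cn) * l1 z = Cf * (((1 + D) * l1 z) * Cn) by ring.
  by rewrite ler_wpM2l // ler_pM // l1_ge0.
split; last first.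
- apply: le_trans (hf _ _) _; rewrite /C3.
  apply: (@le_trans _ _ (Cf * ((1 + D) * Cz * Cn))); first by rewrite ler_wpM2l // ler_pM // l1_ge0.
  by rewrite lerDr mulr_ge0.
- rewrite -real_normK ?num_real //.
  apply: (@le_trans _ _ ((Cf * ((1 + D) * Cn) * l1 z) ^+ 2)).
    exact: sq_le.
  apply: (@le_trans _ _ ((Cf * ((1 + D) * Cn)) ^+ 2 * Ce * W z)).
    by rewrite exprMn -mulrA ler_wpM2l.
  rewrite /C3 ler_wpM2r ?eform_ge0 // lerDl.
  by do ?[by [] | apply: mulr_ge0].
set rho := zcorr (gam n.+1) (upd g x j) j - (z' + g *: noise x i j).
have lrho : l1 rho <= Cs * g ^+ 2 by exact: zcorr_step.
have -> : zcorr (gam n.+1) (upd g x j) j = z' + (g *: noise x i j + rho).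
  by rewrite addrA addrC subrK.
have Wz' : W z' <= (1 - 2 * b * g + Cf * D ^+ 2 * Ce * g ^+ 2) * W z.
  rewrite /z' eformDl !eformDr !eformZl !eformZr (eformC _ z D1).
  have e1 : eform E D1 z <= - b * W z.
    rewrite /D1 -scaleNr eformDl !eformZl gerDr.
    by rewrite mulr_ge0_le0.
  have e2 : eform E D1 D1 <= Cf * D ^+ 2 * Ce * W z.
    apply: le_trans (ler_norm _) _; apply: le_trans (hf _ _) _.
    have -> : Cf * D ^+ 2 * Ce * W z = Cf * (D ^+ 2 * (Ce * W z)) by ring.
    rewrite ler_wpM2l // -expr2.
    apply: (@le_trans _ _ ((D * l1 z) ^+ 2)).
      by apply: sq_le => //; exact: l1_ge0.
    by rewrite exprMn ler_wpM2l ?sqr_ge0.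
  have := ler_wpM2l (ltW g0) e1; have := ler_wpM2l (sqr_ge0 g) e2; nra.
have cross : 2 * eform E z' rho + W (g *: noise x i j + rho) <=
   (2 * (Cf * ((1 + D) * Cz * Cs)) + Cf * (Cn + Cs) ^+ 2) * g ^+ 2.
  rewrite [leRHS]mulrDl; apply: lerD.
    rewrite -mulrA ler_pM2l //; apply: le_trans (ler_norm _) _.
    apply: le_trans (hf _ _) _.
    have -> : Cf * ((1 + D) * Cz * Cs) * g ^+ 2 = Cf * (((1 + D) * Cz) * (Cs * g ^+ 2)) by ring.
    by rewrite ler_wpM2l // ler_pM // l1_ge0.
  apply: le_trans (ler_norm _) _; apply: le_trans (hf _ _) _.
  rewrite -mulrA ler_wpM2l // -expr2 -exprMn; apply: sq_le; first exact: l1_ge0.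
  apply: le_trans (l1D _ _) _; rewrite l1Z (ger0_norm (ltW g0)) mulrDl lerD //.
    by rewrite mulrC ler_wpM2r // (ltW g0).
  apply: le_trans lrho _; by rewrite ler_wpM2l // expr2 ler_piMr // (ltW g0).
move: Wz' cross; rewrite eform_sq [eform E z' (_ + rho)]eformDr eformZr.
lra.
Qed.

Lemma exp_moment_step : exists al B del N, [/\ 0 < al, 0 < del,
  forall n, (N <= n)%N -> 0 <= del * gam n <= 1 &
  forall n i x, (N <= n)%N -> simp x ->
    chain_step kern (gam n)
      (fun i x => expR (al * (W (zcorr (gam n.+1) x i) / gam n.+1))) i x <=
    (1 - del * gam n) * expR (al * (W (zcorr (gam n) x i) / gam n))
      + del * gam n * B].
Proof.
have [C1 [C2 [C3 [[C1_0 C2_0 C3_0] hstep]]]] := energy_step.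
(* The spare dissipation is cut in three: for second-order errors of the step, for the square of the
   martingale term, and for the remaining contraction. *)
pose del := (2 * b - kap) / 3.
have del0 : 0 < del by move: kap_lt; rewrite /del; lra.
have b0 : 0 < b by move: kap_ge0 kap_lt; lra.
(* The first bound keeps [|t j| <= 1 / 2], the second gives [2 * t j ^+ 2 <= del * g * w]. *)
pose al := Num.min (8 * (1 + C3))^-1 (del / (32 * (1 + C3))).
have C3p : 0 < 1 + C3 by rewrite ltr_wpDr.
have p8 : 0 < 8 * (1 + C3) by lra.
have p32 : 0 < 32 * (1 + C3) by lra.
have al0 : 0 < al by rewrite /al lt_min invr_gt0 p8 divr_gt0.
have al1 : al * (8 * (1 + C3)) <= 1.
  by rewrite -ler_pdivlMr // mul1r ge_min lexx.
have al2 : al * (32 * (1 + C3)) <= del.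
  by rewrite -ler_pdivlMr // ge_min lexx orbT.
pose e := Num.min (Num.min (1 + kap)^-1 (2 * b)^-1)
   (Num.min (del / (1 + C1 + kap * C1)) (1 + del)^-1).
have k1 : 0 < 1 + kap by rewrite ltr_wpDr.
have k2 : 0 < 1 + C1 + kap * C1 by rewrite ltr_wpDr ?mulr_ge0 // ltr_wpDr.
have d1 : 0 < 1 + del by rewrite addr_gt0.
have b2 : 0 < 2 * b by lra.
have e0 : 0 < e by rewrite /e !lt_min !invr_gt0 divr_gt0 // k1 d1 b2.
have [N1 hN1] := gam_cvg0 e0.
(* The additive error [2 * al * C2 * g] is [del * g] times the logarithm of this value, so convexity
   of the exponential yields an affine recursion. *)
exists al, (expR (2 * al * C2 / del)), del, (maxn N0 N1).
have small n : (maxn N0 N1 <= n)%N -> [/\ gam n / gam n.+1 <= 1 + kap * gam n,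
    kap * gam n <= 1, 2 * b * gam n <= 1, (C1 + kap * C1) * gam n <= del &
    del * gam n <= 1].
  rewrite geq_max => /andP[nN0 nN1]; have := hN1 _ nN1.
  have inv1 (c u : R) : 0 < c -> u <= c^-1 -> c * u <= 1.
    by move=> c0 uc; rewrite -(divff (lt0r_neq0 c0)) ler_pM2l.
  rewrite /e !le_min => /andP[/andP[h1 h2] /andP[h3 h4]]; split.
  - exact: gam_ratio.
  - by apply: le_trans (inv1 _ _ k1 h1); rewrite ler_wpM2r ?(ltW (gam_gt0 _)) // lerDr.
  - exact: inv1.
  - move: h3; rewrite ler_pdivlMr // mulrC; apply: le_trans.
    by rewrite ler_wpM2r ?(ltW (gam_gt0 _)) // -addrA lerDr.
  by apply: le_trans (inv1 _ _ d1 h4); rewrite ler_wpM2r ?(ltW (gam_gt0 _)) // lerDr.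
have gdel n : (maxn N0 N1 <= n)%N -> 0 <= del * gam n <= 1.
  by move=> /small [_ _ _ _ ->]; rewrite mulr_ge0 // ltW.
split=> //.
move=> n i x /[dup] /gdel dg /small [s1 s2 s3 s4 s5] sx.
set g := gam n in dg s1 s2 s3 s4 s5 *; set g' := gam n.+1 in s1 *.
have g0 : 0 < g := gam_gt0 n.
have g1 : g <= 1 by case/andP: (gam01 n).
have g'0 : 0 < g' := gam_gt0 n.+1.
set z := zcorr g x i; set w := al * (W z / g).
have w0 : 0 <= w by rewrite /w; nonneg.
set z' := z + g *: (phi x *: (z *m A) - b *: z).
set rho := g / g' in s1.
have rho0 : 0 <= rho by rewrite /rho; nonneg.
have rho2 : rho <= 2 by apply: le_trans s1 _; rewrite -[2]/(1 + 1) lerD2l.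
pose t j := 2 * al * rho * eform E z' (noise x i j).
have step1 j : al * (W (zcorr g' (upd g x j) j) / g') <=
    (1 - 2 * del * g) * w + 2 * al * C2 * g + t j.
  have [h _ _] := hstep n x i j sx; rewrite -/g -/g' -/z -/z' in h.
  have q0 : 0 <= 1 - 2 * b * g + C1 * g ^+ 2.
    by rewrite addr_ge0 ?subr_ge0 // mulr_ge0 // sqr_ge0.
  have -> : al * (W (zcorr g' (upd g x j) j) / g') =
      (al * rho / g) * W (zcorr g' (upd g x j) j).
    rewrite /rho; field; by rewrite !gt_eqF.
  have c0 : 0 <= al * rho / g by nonneg.
  apply: le_trans (ler_wpM2l c0 h) _.
  have -> : al * rho / g * ((1 - 2 * b * g + C1 * g ^+ 2) * W z +
      2 * g * eform E z' (noise x i j) + C2 * g ^+ 2) =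
     rho * (1 - 2 * b * g + C1 * g ^+ 2) * w + al * C2 * g * rho + t j.
    rewrite /t /w; field; by rewrite gt_eqF.
  rewrite lerD2r; apply: lerD; last first.
    have -> : 2 * al * C2 * g = al * C2 * g * 2 by ring.
    by rewrite ler_wpM2l //; nonneg.
  rewrite ler_wpM2r //; apply: le_trans (ler_wpM2r q0 s1) _.
  have e1 : 3 * del = 2 * b - kap by rewrite /del; field.
  have -> : (1 + kap * g) * (1 - 2 * b * g + C1 * g ^+ 2) =
    1 - (2 * b - kap) * g + ((C1 + kap * C1 * g) * g - 2 * b * kap * g) * g by ring.
  have h1 : (C1 + kap * C1 * g) * g <= del.
    apply: le_trans s4; rewrite ler_wpM2r ?(ltW g0) // lerD2l ler_piMr // mulr_ge0 //.
  have h2 : 0 <= 2 * b * kap * g by nonneg.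
  have h3 : ((C1 + kap * C1 * g) * g - 2 * b * kap * g) * g <= del * g.
    by rewrite ler_wpM2r ?(ltW g0) // lerBlDr (le_trans h1) // lerDl.
  rewrite -e1; lra.
have tb j : `|t j| <= 2^-1 /\ 2 * t j ^+ 2 <= del * g * w.
  have [_ h2 h3] := hstep n x i j sx; rewrite -/g -/z -/z' in h2 h3.
  split.
    rewrite /t normrM ger0_norm; last nonneg.
    apply: (@le_trans _ _ (2 * al * 2 * C3)).
      apply: ler_pM => //; first nonneg.
      by rewrite ler_wpM2l //; nonneg.
    have : 0 <= al by exact: ltW.
    move: al1; lra.
  have -> : 2 * t j ^+ 2 = 8 * al ^+ 2 * (rho ^+ 2 * eform E z' (noise x i j) ^+ 2).
    by rewrite /t; ring.
  apply: (@le_trans _ _ (8 * al ^+ 2 * (4 * (C3 * W z)))).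
    apply: ler_wpM2l; first nonneg.
    apply: ler_pM => //; rewrite ?sqr_ge0 //.
    have -> : 4 = 2 ^+ 2 :> R by ring.
    by rewrite ler_pXn2r ?nnegrE.
  have -> : 8 * al ^+ 2 * (4 * (C3 * W z)) = (al * (32 * C3)) * g * w.
    rewrite /w; field; by rewrite gt_eqF.
  rewrite ler_wpM2r // ler_wpM2r ?(ltW g0) //; apply: le_trans al2.
  by rewrite ler_wpM2l ?(ltW al0) // ler_wpM2l // lerDr.
have tmean : \sum_j kern x i j * t j = 0.
  under eq_bigr do rewrite /t mulrCA.
  rewrite -mulr_sumr -eform_sumr noise_mean // (_ : eform E z' 0 = 0) ?mulr0 //.
  by rewrite -(scale0r 0) eformZr mul0r.
rewrite /chain_step.
set c := (1 - 2 * del * g) * w + 2 * al * C2 * g.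
(* Quadratic expansion of [expR (t j)]: the linear term has mean 0 by [tmean], the square is
   dominated by [del * g * w]. *)
have h1 : \sum_j kern x i j * expR (al * (W (zcorr g' (upd g x j) j) / g')) <=
    \sum_j expR c * (kern x i j + kern x i j * t j + kern x i j * (del * g * w)).
  apply: ler_sum => j _; have [t1 t2] := tb j.
  have -> : expR c * (kern x i j + kern x i j * t j + kern x i j * (del * g * w)) =
    kern x i j * (expR c * (1 + t j + del * g * w)) by ring.
  rewrite ler_wpM2l ?kern_ge0 //.
  apply: (@le_trans _ _ (expR (c + t j))); first by rewrite ler_expR step1.
  rewrite expRD ler_wpM2l ?expR_ge0 //; apply: le_trans (expR_le_quad t1) _.
  by rewrite lerD2l.
apply: le_trans h1 _; rewrite -mulr_sumr !big_split /= tmean addr0 -mulr_suml.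
rewrite kern_sum // mul1r.
apply: (@le_trans _ _ (expR c * expR (del * g * w))).
  by rewrite ler_wpM2l ?expR_ge0 // expR_ge1Dx.
rewrite -expRD; apply: le_trans (expR_convex w (2 * al * C2 / del) dg).
rewrite ler_expR /c le_eqVlt; apply/orP; left; apply/eqP.
by field; rewrite gt_eqF.
Qed.

Lemma exp_moment : exists al B, 0 < al /\
  forall n, EE n (fun i x => expR (al * (W (zcorr (gam n) x i) / gam n))) <= B.
Proof.
have [al [B [del [N [al0 del0 dg hs]]]]] := exp_moment_step.
pose u n := EE n (fun i x => expR (al * (W (zcorr (gam n) x i) / gam n))).
have hu n : (N <= n)%N -> u n.+1 <= (1 - del * gam n) * u n + del * gam n * B.
  move=> nN; rewrite /u /=.
  apply: (@le_trans _ _ (EE n (fun i x => (1 - del * gam n) *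
     expR (al * (W (zcorr (gam n) x i) / gam n)) + del * gam n * B))).
    by apply: chain_exp_le => // i x sx; exact: hs.
  by rewrite chain_expD // chain_expZ // chain_exp_cst.
have hb := recursion_bounded dg hu.
(* The recursion starts at [N]; earlier values are nonnegative and covered by their sum. *)
exists al, (\sum_(k < N) u k + Num.max (u N) B); split=> // n.
have u0 k : 0 <= u k.
  rewrite -(chain_exp_cst kern_ge0 kern_sum gam01 p0_ge0 p0_sum xi_simp k 0).
  by apply: chain_exp_le => // i x _; exact: expR_ge0.
have m0 : 0 <= Num.max (u N) B by rewrite le_max u0.
have [nN|Nn] := ltnP n N; last by apply: le_trans (hb n Nn) _; rewrite lerDr sumr_ge0.
rewrite -/(u n) (bigD1 (Ordinal nN)) //= -addrA lerDl addr_ge0 // sumr_ge0 //.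
Qed.

End ExponentialMoment.

(** Once the error is small, the excess of [u] over [e / 2] is multiplied by at most [1 - c * g n].
    The product of these factors is below the exponential of [- c] times the sum of [g], which
    diverges. *)
Lemma recursion_vanishes (R : realType) (g u eta : nat -> R) (c C : R) (N : nat) :
  0 < c -> 0 <= C -> (forall n, 0 < g n) ->
  (forall n, (N <= n)%N -> c * g n <= 1) ->
  (forall B, exists n0, forall n, (n0 <= n)%N -> B <= \sum_(k < n) g k) ->
  (forall e, 0 < e -> exists n0, forall n, (n0 <= n)%N -> eta n <= e) ->
  (forall n, (N <= n)%N -> u n.+1 <= (1 - c * g n) * u n + C * (g n * eta n)) ->
  forall e, 0 < e -> exists n0, forall n, (n0 <= n)%N -> u n <= e.
Proof.
move=> c0 C0 g0 cg gsum eta0 hu e e0.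
have C1 : 0 < 1 + C by rewrite ltr_wpDr.
have e1 : 0 < c * (e / 2) / (1 + C) by rewrite !divr_gt0 ?mulr_gt0 ?divr_gt0.
have [N1 hN1] := eta0 _ e1; pose N2 := maxn N N1.
have small n : (N2 <= n)%N -> u n.+1 - e / 2 <= (1 - c * g n) * (u n - e / 2).
  rewrite geq_max => /andP[nN nN1]; have h := hN1 _ nN1.
  have h2 : C * eta n <= c * (e / 2).
    move: h; rewrite ler_pdivlMr // => h.
    have [et|/ltW et] := leP 0 (eta n).
      by apply: le_trans h; rewrite mulrC ler_wpM2l // lerDr.
    by apply: (@le_trans _ _ 0); rewrite ?mulr_ge0_le0 // ?mulr_ge0 ?divr_ge0 // ltW.
  have h3 : C * (g n * eta n) <= g n * (c * (e / 2)).
    by rewrite mulrCA ler_pM2l.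
  have := hu _ nN; lra.
pose K := `|u N2 - e / 2|.
have iter n : u (N2 + n)%N - e / 2 <= expR (- c * \sum_(k < n) g (N2 + k)%N) * K.
  elim: n => [|n IHn]; first by rewrite addn0 big_ord0 mulr0 expR0 mul1r ler_norm.
  rewrite addnS; apply: le_trans (small _ (leq_addr _ _)) _.
  rewrite big_ord_recr /= [- c * (_ + _)]mulrDr [- c * _ + _]addrC expRD -mulrA.
  have q0 : 0 <= 1 - c * g (N2 + n)%N.
    by rewrite subr_ge0 cg // (leq_trans (leq_maxl N N1)) // leq_addr.
  apply: le_trans (ler_wpM2l q0 IHn) _; apply: ler_wpM2r.
    by rewrite mulr_ge0 ?expR_ge0 // normr_ge0.
  by have := expR_ge1Dx (- c * g (N2 + n)%N); rewrite mulNr.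
pose B := K / (c * (e / 2)).
have [n0 hn0] := gsum (B + \sum_(k < N2) g k).
exists (maxn N2 n0) => n; rewrite geq_max => /andP[nN2 nn0].
have := hn0 _ nn0; have := iter (n - N2)%N; rewrite subnKC //.
set S := \sum_(k < n - N2) _.
have -> : \sum_(k < n) g k = \sum_(k < N2) g k + S.
  have split k : \sum_(i < N2 + k) g i = \sum_(i < N2) g i + \sum_(i < k) g (N2 + i)%N.
    by rewrite big_split_ord.
  by have := split (n - N2)%N; rewrite subnKC.
move=> h; rewrite [B + _]addrC lerD2l => BS.
have K0 : 0 <= K by exact: normr_ge0.
have ce : 0 < c * (e / 2) by rewrite mulr_gt0 // divr_gt0.
have hK : K <= c * S * (e / 2).
  by move: BS; rewrite /B ler_pdivrMr // mulrA [S * c]mulrC.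
have x0 : 0 < 1 + c * S.
  rewrite ltr_wpDr // mulr_ge0 ?(ltW c0) //; apply: le_trans BS.
  by rewrite /B divr_ge0 // ltW.
have hx : expR (- c * S) * K <= e / 2.
  have : expR (- c * S) <= (1 + c * S)^-1.
    rewrite mulNr expRN lef_pV2 ?posrE ?expR_gt0 //.
    exact: expR_ge1Dx.
  move=> hx; apply: le_trans (ler_wpM2r K0 hx) _.
  by rewrite mulrC ler_pdivrMr // mulrC mulrDl mul1r ler_wpDl // divr_ge0 // ltW.
by move: h hx; lra.
Qed.

(** * Linear functionals and bilinear forms *)

Section Pairing.
Variables (R : realType) (d : nat).
Implicit Types (z : 'rV[R]_d) (w t : 'cV[R]_d) (Q : 'M[R]_d).

Definition pairing z t : R := (z *m t) 0 0.

Definition bilin Q t w : R := (t^T *m Q *m w) 0 0.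

Lemma pairingDl z z' t : pairing (z + z') t = pairing z t + pairing z' t.
Proof. by rewrite /pairing mulmxDl mxE. Qed.

Lemma pairingZl (c : R) z t : pairing (c *: z) t = c * pairing z t.
Proof. by rewrite /pairing -scalemxAl mxE. Qed.

Lemma pairingBl z z' t : pairing (z - z') t = pairing z t - pairing z' t.
Proof. by rewrite /pairing mulmxBl !mxE. Qed.

Lemma pairing_bound z t : `|pairing z t| <= l1 z * l1 t^T.
Proof.
rewrite /pairing mxE; apply: le_trans (ler_norm_sum _ _ _) _.
rewrite /l1 mulr_suml ler_sum // => i _; rewrite normrM ler_wpM2l //.
by have := coord_le_l1 t^T i; rewrite mxE.
Qed.

Lemma bilin_bound Q : exists2 C, 0 <= C &
  forall t w, `|bilin Q t w| <= C * (l1 t^T * l1 w^T).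
Proof.
have [C C0 hC] := l1_mulmx Q; exists C => // t w.
apply: le_trans (pairing_bound _ _) _; rewrite mulrA ler_wpM2r ?l1_ge0 //.
Qed.

Lemma bilin_bound_fam (I : finType) (Q : I -> 'M[R]_d) : exists2 C, 0 <= C &
  forall i t w, `|bilin (Q i) t w| <= C * (l1 t^T * l1 w^T).
Proof.
pose C i := s2val (cid2 (bilin_bound (Q i))).
have C0 i : 0 <= C i := s2valP (cid2 (bilin_bound (Q i))).
have hC i := s2valP' (cid2 (bilin_bound (Q i))).
exists (\sum_i C i); first exact: sumr_ge0.
move=> i t w; apply: le_trans (hC i t w) _.
rewrite ler_wpM2r ?mulr_ge0 ?l1_ge0 // -/(C i) (bigD1 i) //= lerDl.
exact: sumr_ge0.
Qed.

Lemma bilin_mulmx_bound (L : 'M[R]_d) : exists2 C, 0 <= C &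
  forall t, l1 (L *m t)^T <= C * l1 t^T.
Proof.
have [C C0 hC] := l1_mulmx L^T; exists C => // t; by rewrite trmx_mul.
Qed.

Lemma bilinDl Q t t' w : bilin Q (t + t') w = bilin Q t w + bilin Q t' w.
Proof. by rewrite /bilin linearD /= !mulmxDl mxE. Qed.

Lemma bilinDr Q t w w' : bilin Q t (w + w') = bilin Q t w + bilin Q t w'.
Proof. by rewrite /bilin mulmxDr mxE. Qed.

Lemma bilinZl Q (c : R) t w : bilin Q (c *: t) w = c * bilin Q t w.
Proof. by rewrite /bilin linearZ /= -!scalemxAl mxE. Qed.

Lemma bilinZr Q (c : R) t w : bilin Q t (c *: w) = c * bilin Q t w.
Proof. by rewrite /bilin -scalemxAr mxE. Qed.

Lemma bilinD Q Q' t w : bilin (Q + Q') t w = bilin Q t w + bilin Q' t w.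
Proof. by rewrite /bilin mulmxDr mulmxDl mxE. Qed.

(** The coefficient of [g] is the Lyapunov operator applied to [Q]; this is where the covariance
    equation enters. *)
Lemma bilin_perturb Q (L : 'M[R]_d) (g : R) t :
  bilin Q (t + g *: (L *m t)) (t + g *: (L *m t)) =
  bilin Q t t + g * bilin (L^T *m Q + Q *m L) t t + g ^+ 2 * bilin Q (L *m t) (L *m t).
Proof.
have e1 : bilin Q t (L *m t) = bilin (Q *m L) t t by rewrite /bilin !mulmxA.
have e2 : bilin Q (L *m t) t = bilin (L^T *m Q) t t by rewrite /bilin trmx_mul !mulmxA.
rewrite bilinDl !bilinDr !bilinZl !bilinZr e1 e2 bilinD; ring.
Qed.

End Pairing.

(** * Characteristic functions *)

Section CharFun.
Variables (R : realType) (d m : nat).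
Variables (kern : 'rV[R]_d -> 'I_d -> 'I_d -> R) (gam eta : nat -> R).
Variables (zcorr : R -> 'rV[R]_d -> 'I_d -> 'rV[R]_d).
Variables (noise : 'rV[R]_d -> 'I_d -> 'I_d -> 'rV[R]_d).
Variables (phi : 'rV[R]_d -> R) (A : 'M[R]_d) (b : R).
Variables (Gm : 'M[R]_d) (co : 'I_d -> 'M[R]_d).
Variables (Cn Cs Cp Cq Cv Ct C0 kap phi0 : R).
Implicit Types (x : 'rV[R]_d) (t : 'cV[R]_d).
Hypothesis kern_ge0 : forall x i j, simp x -> 0 <= kern x i j.
Hypothesis kern_sum : forall x i, simp x -> \sum_j kern x i j = 1.
Hypothesis gam01 : forall n, 0 < gam n <= 1.
Hypothesis gam_decr : forall n, gam n.+1 <= gam n.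
Hypothesis gam_diff : forall n, gam n - gam n.+1 <= C0 * gam n ^+ 2.
Hypothesis eta_ge : forall n, Num.sqrt (gam n) <= eta n.
Hypothesis eta_le : forall n, eta n <= Ct.
Hypothesis eta_ratio : forall n,
  `|Num.sqrt (gam n) / Num.sqrt (gam n.+1) - 1 - kap / 2 * gam n| <= gam n * eta n.
Hypothesis noise_mean : forall x i, simp x -> \sum_j kern x i j *: noise x i j = 0.
Hypothesis noise_bound : forall x i j, simp x -> l1 (noise x i j) <= Cn.
Hypothesis phi_bound : forall x, simp x -> 0 <= phi x <= Cp.
Hypothesis phi_near : forall g x i, simp x -> 0 <= g <= 1 ->
  `|phi x - phi0| <= Cq * (l1 (zcorr g x i) + g).
Hypothesis variance : forall g x i t, simp x -> 0 <= g <= 1 ->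
  `|\sum_j kern x i j * (pairing (noise x i j) t ^+ 2 / 2) - \sum_j kern x i j * bilin (co j) t t
    - (bilin Gm t t / 2 - bilin (co i) t t)| <= Cv * l1 t^T ^+ 2 * (l1 (zcorr g x i) + g).
Hypothesis zcorr_step : forall n x i j, simp x ->
  l1 (zcorr (gam n.+1) (upd (gam n) x j) j - (zcorr (gam n) x i
     + gam n *: (phi x *: (zcorr (gam n) x i *m A) - b *: zcorr (gam n) x i)
     + gam n *: noise x i j)) <= Cs * gam n ^+ 2.
Hypothesis Cst_ge0 : [/\ 0 <= Cn, 0 <= Cs, 0 <= Cp, 0 <= Cq & 0 <= Cv].
Hypothesis C0_ge0 : 0 <= C0.
Hypothesis kap_ge0 : 0 <= kap.

Let sg n : R := Num.sqrt (gam n).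

Definition scaled n x i : 'rV[R]_d := (sg n)^-1 *: zcorr (gam n) x i.

(* The shift [kap / 2] comes from the ratio of consecutive normalisations
   [Num.sqrt (gam n)]. *)
Definition scaled_drift : 'M[R]_d := phi0 *: A - (b - kap / 2)%:M.

(* The term of order [gam n] is a Poisson corrector that replaces the
   conditional variance of the noise by its stationary mean [Gm]. *)
Definition test_fun n t : 'I_d -> 'rV[R]_d -> R :=
  fun i x => cos (pairing (scaled n x i) t) * (1 + gam n * bilin (co i) t t).

Let gam_gt0 n : 0 < gam n. Proof. by case/andP: (gam01 n). Qed.
Let gam_le1 n : gam n <= 1. Proof. by case/andP: (gam01 n). Qed.
Let sg_gt0 n : 0 < sg n. Proof. by rewrite sqrtr_gt0. Qed.
Let sg_sqr n : sg n * sg n = gam n.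
Proof. by rewrite -expr2 sqr_sqrtr // ltW. Qed.
Let sg_le1 n : sg n <= 1.
Proof. by rewrite -[leRHS]sqrtr1 ler_sqrt. Qed.
Let gam_le_sg n : gam n <= sg n.
Proof. by rewrite -sg_sqr ler_piMr // ltW. Qed.
Let eta_gt0 n : 0 < eta n. Proof. exact: lt_le_trans (sg_gt0 n) (eta_ge n). Qed.

Lemma scaled_step : exists2 C, 0 <= C & forall n x i j, simp x ->
  l1 (scaled n.+1 (upd (gam n) x j) j -
      (scaled n x i + gam n *: (scaled n x i *m scaled_drift) + sg n *: noise x i j))
  <= C * (gam n * eta n) * (1 + l1 (scaled n x i) ^+ 2).
Proof.
have [Cn0 Cs0 Cp0 Cq0 Cv0] := Cst_ge0.
have [Ca Ca0 ha] := l1_mulmx A.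
have Ct0 : 0 <= Ct by apply: le_trans (eta_le 0); exact: ltW.
pose K := Ct + kap / 2; have K0 : 0 <= K by rewrite addr_ge0 ?divr_ge0.
pose D := Cp * Ca + `|b|; have D0 : 0 <= D by rewrite addr_ge0 ?mulr_ge0.
exists (2 + K * D + 2 * (Cq * Ca) + K * Cn + (1 + K) * Cs).
  by do ?[by [] | apply: addr_ge0 | apply: mulr_ge0].
move=> n x i j sx; set g := gam n; set s := sg n; set s' := sg n.+1.
have g0 : 0 < g := gam_gt0 n. have s0 : 0 < s := sg_gt0 n. have s'0 : 0 < s' := sg_gt0 n.+1.
have ge0 : 0 < g * eta n by rewrite mulr_gt0.
set V := scaled n x i; set v := l1 V.
have v0 : 0 <= v by exact: l1_ge0.
have zV : zcorr g x i = s *: V by rewrite /V /scaled scalerA divff ?scale1r // gt_eqF.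
clearbody V.
set q := s / s'.
have q1 : `|q - 1 - kap / 2 * g| <= g * eta n by exact: eta_ratio.
have q2 : `|q - 1| <= K * g.
  have -> : q - 1 = (q - 1 - kap / 2 * g) + kap / 2 * g by ring.
  apply: le_trans (ler_normD _ _) _; rewrite [K * g]mulrDl; apply: lerD.
    by apply: le_trans q1 _; rewrite mulrC ler_wpM2r ?(ltW g0).
  by rewrite ger0_norm // mulr_ge0 ?divr_ge0 // ltW.
have q3 : `|q| <= 1 + K.
  have -> : q = 1 + (q - 1) by ring.
  apply: le_trans (ler_normD _ _) _; rewrite normr1 lerD2l.
  by apply: le_trans q2 _; rewrite ler_piMr // gam_le1.
set y := upd g x j.
set rr := zcorr (gam n.+1) y j - (zcorr g x i + g *: (phi x *: (zcorr g x i *m A) - b *: zcorr g x i)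
   + g *: noise x i j).
have lr : l1 rr <= Cs * g ^+ 2 by exact: zcorr_step.
have zE : zcorr (gam n.+1) y j = s *: V + (g * s) *: (phi x *: (V *m A) - b *: V)
    + g *: noise x i j + rr.
  rewrite /rr zV -scalemxAl; move: (zcorr _ _ _) (V *m A) (noise x i j) => a1 a2 a3.
  apply/matrixP => k l; rewrite !mxE; ring.
have e1 : scaled n.+1 y j = q *: V + (q * g) *: (phi x *: (V *m A) - b *: V)
    + (q * s) *: noise x i j + (q / s) *: rr.
  rewrite /scaled -/s' zE /q -[g]sg_sqr -/s.
  move: (V) (V *m A) (noise x i j) (rr) => a1 a2 a3 a4.
  by apply/matrixP => k l; rewrite !mxE; field; rewrite !gt_eqF.
(* The errors are, in order: the normalisation beyond [kap / 2 * g], its effect on the drift, the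
   freezing of [phi x] at [phi0], the normalisation of the noise, and the remainder of [zcorr_step].
   Freezing [phi] costs a multiple of [s * (1 + v)] times [v], hence the quadratic weight. *)
have e2 : scaled n.+1 y j - (V + g *: (V *m scaled_drift) + s *: noise x i j) =
    (q - 1 - kap / 2 * g) *: V + ((q - 1) * g) *: (phi x *: (V *m A) - b *: V)
    + (g * (phi x - phi0)) *: (V *m A) + ((q - 1) * s) *: noise x i j + (q / s) *: rr.
  rewrite e1 /scaled_drift mulmxBr mul_mx_scalar -scalemxAr.
  move: (V) (V *m A) (noise x i j) (rr) => a1 a2 a3 a4.
  by apply/matrixP => k l; rewrite !mxE; ring.
have vv : v <= 1 + v ^+ 2 by have := sqr_ge0 (v - 1); lra.
have ov : 1 <= 1 + v ^+ 2 by rewrite lerDl sqr_ge0.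
have vv2 : v * (v + 1) <= 2 * (1 + v ^+ 2) by have := sqr_ge0 (v - 1); lra.
have ss : s <= eta n by exact: eta_ge.
have gs : g <= s by exact: gam_le_sg.
have lA : l1 (V *m A) <= Ca * v by exact: ha.
have /andP[p1 p2] := phi_bound sx.
have lD : l1 (phi x *: (V *m A) - b *: V) <= D * v.
  apply: le_trans (l1B _ _) _; rewrite !l1Z [D * v]mulrDl; apply: lerD => //.
  by rewrite (ger0_norm p1) -mulrA ler_pM ?l1_ge0.
have ov0 : 0 <= 1 + v ^+ 2 by exact: le_trans ler01 ov.
rewrite e2; set T := 1 + v ^+ 2 in vv ov vv2 ov0 *; set h := g * eta n.
have h0 : 0 <= h by exact: ltW.
have -> : (2 + K * D + 2 * (Cq * Ca) + K * Cn + (1 + K) * Cs) * h * T =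
  h * T + K * D * h * T + (h * T + 2 * (Cq * Ca) * h * T) + K * Cn * h * T
    + (1 + K) * Cs * h * T by ring.
have gsh : g * s <= h by rewrite ler_wpM2l // (ltW g0).
have sgh : s * g <= h by rewrite mulrC.
apply: le_trans (l1D _ _) _; apply: lerD; [apply: le_trans (l1D _ _) _; apply: lerD; [apply: le_trans (l1D _ _) _; apply: lerD;
  [apply: le_trans (l1D _ _) _; apply: lerD|]|]|]; rewrite l1Z.
- by apply: ler_pM; rewrite ?l1_ge0.
- rewrite normrM (ger0_norm (ltW g0)).
  have -> : K * D * h * T = (K * h) * (D * T) by ring.
  apply: ler_pM; rewrite ?l1_ge0 ?mulr_ge0 ?(ltW g0) //; last first.
    by apply: le_trans lD _; rewrite ler_wpM2l.
  apply: le_trans (ler_wpM2r (ltW g0) q2) _; rewrite -mulrA ler_wpM2l //.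
  by rewrite ler_wpM2l ?(ltW g0) // (le_trans gs).
- rewrite normrM (ger0_norm (ltW g0)).
  have gg : 0 <= g <= 1 by rewrite (ltW g0) gam_le1.
  have hp := phi_near i sx gg.
  have hz : l1 (zcorr g x i) + g <= s * (v + 1).
    by rewrite zV l1Z (ger0_norm (ltW s0)) mulrDr mulr1 lerD2l.
  have hp2 : `|phi x - phi0| <= Cq * (s * (v + 1)) by apply: le_trans hp _; rewrite ler_wpM2l.
  apply: (@le_trans _ _ ((g * (Cq * (s * (v + 1)))) * (Ca * v))).
    by apply: ler_pM; rewrite ?l1_ge0 ?mulr_ge0 ?(ltW g0) // ler_wpM2l // (ltW g0).
  apply: (@le_trans _ _ (2 * (Cq * Ca) * h * T)); last by rewrite lerDr; nonneg.
  have -> : g * (Cq * (s * (v + 1))) * (Ca * v) = (Cq * Ca * (g * s)) * (v * (v + 1)) by ring.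
  have -> : 2 * (Cq * Ca) * h * T = (Cq * Ca * h) * (2 * T) by ring.
  apply: ler_pM => //; rewrite ?mulr_ge0 ?addr_ge0 ?(ltW g0) ?(ltW s0) //.
  by rewrite ler_wpM2l // mulr_ge0.
- rewrite normrM (ger0_norm (ltW s0)).
  apply: (@le_trans _ _ (K * Cn * h)); last by rewrite ler_peMr //; nonneg.
  have -> : K * Cn * h = (K * h) * Cn by ring.
  apply: ler_pM; rewrite ?l1_ge0 ?mulr_ge0 ?(ltW s0) ?noise_bound //.
  apply: le_trans (ler_wpM2r (ltW s0) q2) _; rewrite -mulrA ler_wpM2l //.
apply: (@le_trans _ _ ((1 + K) * Cs * h)); last by rewrite ler_peMr //; nonneg.
rewrite normrM normfV (gtr0_norm s0) -!mulrA; apply: ler_pM; rewrite ?mulr_ge0 ?invr_ge0 ?l1_ge0 ?(ltW s0) //.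
rewrite mulrC ler_pdivrMr //; apply: le_trans lr _; rewrite -mulrA ler_wpM2l //.
by rewrite expr2 -{2}[g]sg_sqr -/s mulrA ler_wpM2r // ltW.
Qed.

Lemma corrector_perturb : exists2 C, 0 <= C & forall n i t,
  `|bilin (co i) t t| <= C * l1 t^T ^+ 2 /\
  `|bilin (co i) (t + gam n *: (scaled_drift *m t)) (t + gam n *: (scaled_drift *m t)) - bilin (co i) t t|
    <= C * (gam n * l1 t^T ^+ 2).
Proof.
have [Ca Ca0 ha] := bilin_bound_fam co.
have [Cb Cb0 hb] := bilin_bound_fam (fun i => scaled_drift^T *m co i + co i *m scaled_drift).
have [Cc Cc0 hc] := bilin_mulmx_bound scaled_drift.
exists (Ca + (Cb + Ca * Cc ^+ 2)); first nonneg.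
move=> n i t; rewrite bilin_perturb; split.
  rewrite expr2; apply: le_trans (ha _ _ _) _; rewrite ler_wpM2r ?mulr_ge0 ?l1_ge0 // lerDl.
  nonneg.
have g0 := ltW (gam_gt0 n).
have cancel (p q u : R) : p + q + u - p = q + u by ring.
rewrite cancel.
apply: le_trans (ler_normD _ _) _; rewrite (normrM (gam n)) (normrM (gam n ^+ 2)).
apply: (@le_trans _ _ ((Cb + Ca * Cc ^+ 2) * (gam n * l1 t^T ^+ 2))); last first.
  by rewrite ler_wpM2r ?lerDr //; nonneg.
rewrite [leRHS]mulrDl; apply: lerD.
  rewrite (ger0_norm g0) mulrCA ler_wpM2l // expr2; exact: hb.
rewrite (ger0_norm (sqr_ge0 _)).
have -> : Ca * Cc ^+ 2 * (gam n * l1 t^T ^+ 2) = gam n * (Ca * ((Cc * l1 t^T) * (Cc * l1 t^T))) by ring.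
apply: ler_pM; rewrite ?sqr_ge0 ?normr_ge0 //; first by rewrite expr2 ler_piMl // gam_le1.
apply: le_trans (ha _ _ _) _; rewrite ler_wpM2l //; apply: ler_pM; rewrite ?l1_ge0 ?hc //.
Qed.

(** The drift is moved from [V] to [t], and the cosine is expanded to second order in the noise: the
    linear term averages to 0 and the conditional variance is turned into [Gm] by the corrector. One
    factor [l1 t^T] is retained because the bound is iterated along a contracting [t]. *)
Lemma test_fun_step (H : R) : 0 <= H -> exists2 C, 0 <= C & forall n x i t, simp x -> l1 t^T <= H ->
  `|chain_step kern (gam n) (test_fun n.+1 t) i x
     - (1 - gam n / 2 * bilin Gm t t) * test_fun n (t + gam n *: (scaled_drift *m t)) i x|
  <= C * (l1 t^T * (gam n * eta n) * (1 + l1 (scaled n x i) ^+ 2)).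
Proof.
move=> H0; have [Cn0 Cs0 Cp0 Cq0 Cv0] := Cst_ge0.
have [C1 C1_0 h1] := scaled_step.
have [Cc Cc0 hc] := corrector_perturb.
have [CG CG0 hG] := bilin_bound Gm.
(* [A1] pays for the expansion of the cosine, [A2] for the change of the corrector term from time
   [n.+1] to [n], [A3] for the variance away from stationarity, [A4] for replacing [t] by [t'] in
   the corrector and for the product of the two first-order factors. *)
pose A1 := C1 + 3 * (Cn ^+ 3 * H ^+ 2).
pose A2 := Cc * (C0 * H + (Cn * H ^+ 2 + C1 * H ^+ 2)).
pose A3 := 2 * (Cv * H).
pose A4 := Cc * H + CG * H * (2 * Cc * H ^+ 2).
exists (A1 + A2 + A3 + A4); first by rewrite /A1 /A2 /A3 /A4; nonneg.
move=> n x i t sx hH.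
set h := l1 t^T in hH *; have h0 : 0 <= h by exact: l1_ge0.
set g := gam n; set s := sg n; set V := scaled n x i; set v := l1 V.
have g0 : 0 < g := gam_gt0 n. have s0 : 0 < s := sg_gt0 n. have gle1 : g <= 1 := gam_le1 n.
have sle1 : s <= 1 := sg_le1 n. have ss : s * s = g := sg_sqr n.
have v0 : 0 <= v by exact: l1_ge0.
have se : s <= eta n := eta_ge n. have gs : g <= s := gam_le_sg n. have et0 := eta_gt0 n.
have ge : g <= eta n by exact: le_trans se.
set T := 1 + v ^+ 2; have T1 : 1 <= T by rewrite lerDl sqr_ge0.
set X := h * (g * eta n) * T.
have hg0 : 0 <= h * (g * eta n) by nonneg.
have XT : h * (g * eta n) <= X by rewrite /X ler_peMr.
have X0 : 0 <= X by exact: le_trans XT.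
set t' := t + g *: (scaled_drift *m t).
set a := pairing V t'.
have aE : a = pairing (V + g *: (V *m scaled_drift)) t.
  rewrite /a /t' (pairingDl V) (pairingZl g) /pairing (mulmxDr V t) -scalemxAr.
  by rewrite -mulmxA [LHS]mxE; congr (_ + _); rewrite [LHS]mxE.
pose y j := upd g x j.
pose e j := s * pairing (noise x i j) t.
pose P j := pairing (scaled n.+1 (y j) j) t.
pose rest j := P j - (a + e j).
have he j : `|e j| <= s * (Cn * h).
  rewrite normrM (ger0_norm (ltW s0)) ler_wpM2l ?(ltW s0) //.
  by apply: le_trans (pairing_bound _ _) _; rewrite ler_wpM2r // noise_bound.
have hr j : `|rest j| <= C1 * X.
  have -> : rest j = pairing (scaled n.+1 (y j) j - (V + g *: (V *m scaled_drift) + s *: noise x i j)) t.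
    by rewrite /rest /P aE /e -pairingZl -pairingDl -pairingBl.
  apply: le_trans (pairing_bound _ _) _.
  apply: le_trans (ler_wpM2r h0 (h1 n x i j sx)) _.
  by rewrite -/g -/V -/v -/T le_eqVlt /X; apply/orP; left; apply/eqP; ring.
have d1 j : `|cos (P j) - (cos a - e j * sin a - e j ^+ 2 / 2 * cos a)| <= A1 * X.
  have -> : cos (P j) - (cos a - e j * sin a - e j ^+ 2 / 2 * cos a) =
    (cos (P j) - cos (a + e j)) +
    (cos (a + e j) - cos a + e j * sin a + e j ^+ 2 / 2 * cos a) by ring.
  apply: le_trans (ler_normD _ _) _; rewrite [A1 * X]mulrDl; apply: lerD.
    exact: le_trans (cos_lipschitz _ _) (hr j).
  apply: le_trans (cos_add_taylor _ _) _; rewrite -mulrA ler_wpM2l //.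
  apply: (@le_trans _ _ ((s * (Cn * h)) ^+ 3)); first by rewrite ler_pXn2r ?nnegrE //; nonneg.
  have -> : (s * (Cn * h)) ^+ 3 = Cn ^+ 3 * h ^+ 2 * (h * (s * s * s)) by ring.
  apply: ler_pM; rewrite ?exprn_ge0 ?mulr_ge0 ?exprn_ge0 ?(ltW s0) //.
    by rewrite ler_wpM2l ?exprn_ge0 // ler_pXn2r ?nnegrE.
  apply: le_trans XT; rewrite ss ler_wpM2l // ler_wpM2l // ltW //.
pose q j := bilin (co j) t t.
have hq j : `|q j| <= Cc * h ^+ 2 by case: (hc n j t).
set g' := gam n.+1.
have h2X : g * (g * h ^+ 2) <= H * X.
  have -> : g * (g * h ^+ 2) = h * (h * (g * g)) by ring.
  by apply: ler_pM; rewrite ?mulr_ge0 ?(ltW g0) //; apply: le_trans XT; rewrite ler_wpM2l // ler_wpM2l // ltW.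
have d2 j : `|g' * cos (P j) * q j - g * cos a * q j| <= A2 * X.
  have -> : g' * cos (P j) * q j - g * cos a * q j =
    q j * (- (g - g') * cos (P j) + g * (cos (P j) - cos a)) by ring.
  rewrite normrM /A2.
  apply: (@le_trans _ _ ((Cc * h ^+ 2) * (C0 * g ^+ 2 + g * (s * (Cn * h) + C1 * X)))).
    apply: ler_pM => //; apply: le_trans (ler_normD _ _) _; apply: lerD; rewrite normrM.
      apply: (@le_trans _ _ (`|- (g - g')| * 1)); first by rewrite ler_wpM2l // cos_max.
      by rewrite mulr1 normrN ger0_norm ?subr_ge0 ?gam_decr // gam_diff.
    rewrite (ger0_norm (ltW g0)) ler_wpM2l ?(ltW g0) //.
    apply: le_trans (cos_lipschitz _ _) _.
    have -> : P j - a = e j + rest j by rewrite /rest; ring.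
    by apply: le_trans (ler_normD _ _) _; apply: lerD.
  have -> : Cc * h ^+ 2 * (C0 * g ^+ 2 + g * (s * (Cn * h) + C1 * X)) =
    Cc * (C0 * (g * (g * h ^+ 2)) + (Cn * (h ^+ 2 * (h * (g * s))) + C1 * ((g * h ^+ 2) * X))) by ring.
  have -> : Cc * (C0 * H + (Cn * H ^+ 2 + C1 * H ^+ 2)) * X =
    Cc * (C0 * (H * X) + (Cn * (H ^+ 2 * X) + C1 * (H ^+ 2 * X))) by ring.
  have hH2 : h ^+ 2 <= H ^+ 2 by rewrite ler_pXn2r ?nnegrE.
  apply: ler_wpM2l => //; apply: lerD; last apply: lerD; apply: ler_wpM2l => //.
    apply: ler_pM => //; [nonneg | nonneg |].
    by apply: le_trans XT; rewrite ler_wpM2l // ler_wpM2l // ltW.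
  apply: ler_wpM2r => //; rewrite -[leRHS]mul1r; apply: ler_pM => //; nonneg.
set S2 := \sum_j kern x i j * (pairing (noise x i j) t ^+ 2 / 2).
set Sq := \sum_j kern x i j * q j.
have mean0 : \sum_j kern x i j * e j = 0.
  transitivity (s * pairing (\sum_j kern x i j *: noise x i j) t).
    rewrite /pairing mulmx_suml summxE mulr_sumr; apply: eq_bigr => j _.
    by rewrite /e /pairing -scalemxAl [in RHS]mxE mulrCA.
  by rewrite noise_mean // /pairing mul0mx mxE mulr0.
have sumE : \sum_j kern x i j * (cos a - e j * sin a - e j ^+ 2 / 2 * cos a + g * cos a * q j)
   = cos a * (1 - g * (S2 - Sq)).
  transitivity (cos a * (\sum_j kern x i j) - sin a * (\sum_j kern x i j * e j)
     - cos a * g * S2 + cos a * g * Sq).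
    rewrite /S2 /Sq !mulr_sumr -!sumrB -big_split /=; apply: eq_bigr => j _.
    by rewrite /e exprMn expr2 ss; ring.
  by rewrite mean0 kern_sum //; ring.
have D1 : `|chain_step kern g (test_fun n.+1 t) i x - cos a * (1 - g * (S2 - Sq))| <= (A1 + A2) * X.
  rewrite -sumE /chain_step -sumrB; apply: le_trans (ler_norm_sum _ _ _) _.
  apply: (@le_trans _ _ (\sum_j kern x i j * ((A1 + A2) * X))); last first.
    by rewrite -mulr_suml kern_sum // mul1r.
  apply: ler_sum => j _.
  rewrite -mulrBr normrM (ger0_norm (kern_ge0 _ _ sx)) ler_wpM2l ?kern_ge0 //.
  have -> : test_fun n.+1 t j (upd g x j) = cos (P j) * (1 + g' * q j) by [].
  have -> : cos (P j) * (1 + g' * q j) -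
      (cos a - e j * sin a - e j ^+ 2 / 2 * cos a + g * cos a * q j) =
    (cos (P j) - (cos a - e j * sin a - e j ^+ 2 / 2 * cos a)) +
    (g' * cos (P j) * q j - g * cos a * q j) by ring.
  by apply: le_trans (ler_normD _ _) _; rewrite mulrDl lerD.
have g01 : 0 <= g <= 1 by rewrite (ltW g0).
set Gt := bilin Gm t t; set c := bilin (co i) t t; set c' := bilin (co i) t' t'.
have D2 : `|cos a * (1 - g * (S2 - Sq)) - cos a * (1 - g * (Gt / 2 - c))| <= A3 * X.
  have -> : cos a * (1 - g * (S2 - Sq)) - cos a * (1 - g * (Gt / 2 - c)) =
    - (cos a * (g * (S2 - Sq - (Gt / 2 - c)))) by ring.
  rewrite normrN normrM; apply: (@le_trans _ _ (1 * `|g * (S2 - Sq - (Gt / 2 - c))|)).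
    by rewrite ler_wpM2r // cos_max.
  rewrite mul1r normrM (ger0_norm (ltW g0)).
  apply: le_trans (ler_wpM2l (ltW g0) (variance i t sx g01)) _.
  have -> : l1 (zcorr g x i) = s * v.
    rewrite /v /V /scaled l1Z -/s -/g ger0_norm ?invr_ge0 ?(ltW s0) //.
    by rewrite mulrA divff ?mul1r // gt_eqF.
  rewrite -/h /A3.
  apply: (@le_trans _ _ (g * (Cv * h ^+ 2 * (s * (v + 1))))).
    by rewrite ler_wpM2l ?(ltW g0) // ler_wpM2l ?mulr_ge0 ?sqr_ge0 // mulrDr mulr1 lerD2l.
  have -> : g * (Cv * h ^+ 2 * (s * (v + 1))) = Cv * (h * ((h * (g * s)) * (v + 1))) by ring.
  have -> : 2 * (Cv * H) * X = Cv * (H * ((h * (g * eta n)) * (2 * T))) by rewrite /X; ring.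
  rewrite ler_wpM2l //; apply: ler_pM => //; first nonneg.
  apply: ler_pM; [nonneg | nonneg | |].
    by rewrite ler_wpM2l // ler_wpM2l // ltW.
  by rewrite /T; have := sqr_ge0 (v - 1); have := sqr_ge0 v; lra.
have D3 : `|cos a * (1 - g * (Gt / 2 - c)) - (1 - g / 2 * Gt) * test_fun n t' i x| <= A4 * X.
  have -> : test_fun n t' i x = cos a * (1 + g * c') by [].
  have -> : cos a * (1 - g * (Gt / 2 - c)) - (1 - g / 2 * Gt) * (cos a * (1 + g * c')) =
    cos a * (- (g * (c' - c)) + g * g * Gt / 2 * c') by ring.
  have [k1 k2] := hc n i t; rewrite -/t' -/c -/c' -/h -/g in k1 k2.
  have k3 : `|c'| <= 2 * Cc * H ^+ 2.
    have -> : c' = c + (c' - c) by ring.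
    apply: le_trans (ler_normD _ _) _.
    have hh : h ^+ 2 <= H ^+ 2 by rewrite ler_pXn2r ?nnegrE.
    have := ler_wpM2l Cc0 hh; have : g * h ^+ 2 <= h ^+ 2 by rewrite ler_piMl ?sqr_ge0.
    move/(ler_wpM2l Cc0); lra.
  rewrite normrM; apply: (@le_trans _ _ (1 * `|- (g * (c' - c)) + g * g * Gt / 2 * c'|)).
    by rewrite ler_wpM2r // cos_max.
  rewrite mul1r; apply: le_trans (ler_normD _ _) _; rewrite [A4 * X]mulrDl; apply: lerD.
    rewrite normrN normrM (ger0_norm (ltW g0)).
    apply: le_trans (ler_wpM2l (ltW g0) k2) _.
    by rewrite mulrCA -mulrA ler_wpM2l.
  rewrite normrM.
  have -> : CG * H * (2 * Cc * H ^+ 2) * X = (CG * (H * X)) * (2 * Cc * H ^+ 2) by ring.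
  apply: ler_pM => //.
  have -> : g * g * Gt / 2 = (g * g / 2) * Gt by ring.
  rewrite normrM (ger0_norm (_ : 0 <= g * g / 2)); last nonneg.
  apply: (@le_trans _ _ ((g * g) * (CG * (h * h)))).
    apply: ler_pM => //; [nonneg | | exact: hG].
    by rewrite ler_pdivrMr // ler_peMr ?ler1n // mulr_ge0 // ltW.
  have -> : g * g * (CG * (h * h)) = CG * (g * (g * h ^+ 2)) by ring.
  by rewrite ler_wpM2l.
have -> : (A1 + A2 + A3 + A4) * X = (A1 + A2) * X + A3 * X + A4 * X by ring.
have -> : chain_step kern g (test_fun n.+1 t) i x - (1 - g / 2 * Gt) * test_fun n t' i x =
  (chain_step kern g (test_fun n.+1 t) i x - cos a * (1 - g * (S2 - Sq))) +
  (cos a * (1 - g * (S2 - Sq)) - cos a * (1 - g * (Gt / 2 - c))) +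
  (cos a * (1 - g * (Gt / 2 - c)) - (1 - g / 2 * Gt) * test_fun n t' i x) by ring.
apply: le_trans (ler_normD _ _) _; apply: lerD => //.
by apply: le_trans (ler_normD _ _) _; apply: lerD.
Qed.
End CharFun.

(** To first order the equation for [Q] raises the exponent by [g / 2 * bilin Gm t t], which the
    prefactor compensates; the rest is of order [g ^+ 2]. *)
Lemma gauss_step (R : realType) (d : nat) (Q Gm L : 'M[R]_d) (H : R) :
  L^T *m Q + Q *m L = - Gm -> 0 <= H ->
  exists C e, [/\ 0 <= C, 0 < e & forall (g : R) (t : 'cV[R]_d), 0 < g <= e -> l1 t^T <= H ->
   `|expR (- (bilin Q t t / 2)) - (1 - g / 2 * bilin Gm t t) *
       expR (- (bilin Q (t + g *: (L *m t)) (t + g *: (L *m t)) / 2))|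
   <= C * (l1 t^T * g ^+ 2)].
Proof.
move=> QL H0.
have [CG CG0 hG] := bilin_bound Gm; have [CQ CQ0 hQ] := bilin_bound Q.
have [CL CL0 hL] := bilin_mulmx_bound L.
pose C2 := CQ * CL ^+ 2; have C20 : 0 <= C2 by rewrite /C2; nonneg.
pose K := CG + C2; have K0 : 0 <= K by rewrite addr_ge0.
pose D := C2 * H + (2 * K ^+ 2 * H ^+ 3 + 2 * CG * K * H ^+ 3).
have D0 : 0 <= D by rewrite /D; do ?[by [] | exact: exprn_ge0 | apply: addr_ge0 | apply: mulr_ge0].
have k1 : 0 < 2 * (1 + K * H ^+ 2) by rewrite mulr_gt0 // ltr_wpDr // mulr_ge0 // sqr_ge0.
exists (expR (CQ * H ^+ 2) * D), (Num.min 1 (2 * (1 + K * H ^+ 2))^-1); split.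
- by rewrite mulr_ge0 // expR_ge0.
- by rewrite lt_min ltr01 invr_gt0.
move=> g t /andP[g0]; rewrite le_min => /andP[g1 g2] tH.
set h := l1 t^T in tH *; have h0 : 0 <= h by exact: l1_ge0.
have hH2 : h ^+ 2 <= H ^+ 2 by rewrite ler_pXn2r ?nnegrE.
have hH3 : h ^+ 3 <= H ^+ 3 by rewrite ler_pXn2r ?nnegrE.
rewrite bilin_perturb QL.
have -> : bilin (- Gm) t t = - bilin Gm t t by rewrite /bilin mulmxN mulNmx mxE.
set q := bilin Q t t; set G := bilin Gm t t; set q2 := bilin Q (L *m t) (L *m t).
have bG : `|G| <= CG * h ^+ 2 by rewrite expr2 hG.
have bq : `|q| <= CQ * h ^+ 2 by rewrite expr2 hQ.
have bq2 : `|q2| <= C2 * h ^+ 2.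
  have -> : C2 * h ^+ 2 = CQ * ((CL * h) * (CL * h)) by rewrite /C2; ring.
  apply: le_trans (hQ _ _) _; rewrite ler_wpM2l //; apply: ler_pM; rewrite ?l1_ge0 ?hL //.
pose u := (g * G - g ^+ 2 * q2) / 2.
have -> : - ((q + g * - G + g ^+ 2 * q2) / 2) = - (q / 2) + u by rewrite /u; field.
have bu : `|u| <= g * (K * h ^+ 2).
  rewrite /u normrM [`|2^-1|]ger0_norm // ler_pdivrMr //.
  apply: le_trans (ler_normB _ _) _; rewrite (normrM g) (normrM (g ^+ 2)).
  rewrite (ger0_norm (ltW g0)) (ger0_norm (sqr_ge0 g)).
  have e1 : g * `|G| <= g * (CG * h ^+ 2) by rewrite ler_wpM2l // ltW.
  have e2 : g ^+ 2 * `|q2| <= g * (C2 * h ^+ 2).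
    apply: ler_pM; rewrite ?sqr_ge0 //; by rewrite expr2 ler_piMl // ltW.
  have p1 : 0 <= g * (CG * h ^+ 2) by nonneg.
  have p2 : 0 <= g * (C2 * h ^+ 2) by nonneg.
  move: e1 e2; rewrite /K; lra.
have bu2 : `|u| <= 2^-1.
  apply: le_trans bu _.
  have : g * (2 * (1 + K * H ^+ 2)) <= 1 by rewrite -ler_pdivlMr // mul1r.
  have : K * h ^+ 2 <= K * H ^+ 2 by rewrite ler_wpM2l.
  move/(ler_wpM2l (ltW g0)); lra.
pose e := expR u - 1 - u.
have be : `|e| <= 2 * `|u| ^+ 2.
  by rewrite real_normK ?num_real //; exact: expR_taylor1.
have -> : expR (- (q / 2)) - (1 - g / 2 * G) * expR (- (q / 2) + u) =
   expR (- (q / 2)) * (g ^+ 2 * q2 / 2 - e + g / 2 * G * (u + e)).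
  by rewrite expRD /e /u; field.
rewrite normrM -[leRHS]mulrA; apply: ler_pM; rewrite ?normr_ge0 //.
  rewrite ger0_norm ?expR_ge0 // ler_expR.
  apply: le_trans (ler_norm _) _; rewrite normrN normrM [`|2^-1|]ger0_norm // ler_pdivrMr //.
  apply: le_trans bq _.
  have : CQ * h ^+ 2 <= CQ * H ^+ 2 by rewrite ler_wpM2l.
  have : 0 <= CQ * H ^+ 2 by nonneg.
  lra.
have u2 : `|u| ^+ 2 <= g ^+ 2 * (K ^+ 2 * h ^+ 4).
  have -> : g ^+ 2 * (K ^+ 2 * h ^+ 4) = (g * (K * h ^+ 2)) ^+ 2 by ring.
  by rewrite ler_pXn2r ?nnegrE //; nonneg.
have uu : 2 * `|u| ^+ 2 <= `|u|.
  rewrite expr2 mulrA -[leRHS]mul1r ler_wpM2r //; move: bu2; lra.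
have -> : D * (h * g ^+ 2) = g ^+ 2 * C2 * (H * h) + 2 * (g ^+ 2 * (K ^+ 2 * (h * H ^+ 3)))
   + 2 * (g * CG) * (g * K * (h * H ^+ 3)) by rewrite /D; ring.
have hh4 : h ^+ 4 <= h * H ^+ 3 by rewrite exprS ler_wpM2l.
apply: le_trans (ler_normD _ _) _; apply: lerD; first (apply: le_trans (ler_normB _ _) _; apply: lerD).
- rewrite -[leRHS]mulrA mulrAC normrM.
  rewrite ger0_norm; last by rewrite divr_ge0 // sqr_ge0.
  apply: (@le_trans _ _ (g ^+ 2 * (C2 * h ^+ 2))).
    apply: ler_pM; rewrite ?divr_ge0 ?sqr_ge0 // ler_pdivrMr // ler_peMr ?sqr_ge0 // ler1n //.
  by rewrite ler_wpM2l ?sqr_ge0 // ler_wpM2l // [h ^+ 2]expr2 ler_wpM2r.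
- apply: le_trans be _; rewrite ler_wpM2l //; apply: le_trans u2 _.
  by rewrite ler_wpM2l ?sqr_ge0 // ler_wpM2l ?sqr_ge0.
rewrite normrM.
rewrite (normrM (g / 2)) (ger0_norm (_ : 0 <= g / 2)); last by rewrite divr_ge0 // ltW.
apply: (@le_trans _ _ ((g / 2 * (CG * h ^+ 2)) * (2 * (g * (K * h ^+ 2))))).
  apply: ler_pM => //; first by rewrite mulr_ge0 // divr_ge0 // ltW.
    by rewrite ler_wpM2l // divr_ge0 // ltW.
  apply: le_trans (ler_normD _ _) _; move: be uu bu; lra.
have -> : g / 2 * (CG * h ^+ 2) * (2 * (g * (K * h ^+ 2))) = (g * CG) * (g * K * h ^+ 4) by field.
have p : 0 <= g * CG * (g * K * h ^+ 4).
  by do ?[by [] | exact: ltW | exact: exprn_ge0 | apply: mulr_ge0].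
have : g * CG * (g * K * h ^+ 4) <= g * CG * (g * K * (h * H ^+ 3)).
  by rewrite ler_wpM2l //; [nonneg | rewrite ler_wpM2l //; nonneg].
move: p; rewrite -[2 * (g * CG) * _]mulrA; lra.
Qed.

(** * Limit of the characteristic functions *)

Section CharFunLimit.
Variables (R : realType) (d m : nat) (E : 'M[R]_(d, m)) (L Gm : 'M[R]_d).
Variables (gam eta : nat -> R) (Phi : nat -> 'cV[R]_d -> R) (Psi : 'cV[R]_d -> R).
Variables (Ce c1 : R).
Implicit Types (t : 'cV[R]_d) (z : 'rV[R]_d).
Hypothesis gam_gt0 : forall n, 0 < gam n.
Hypothesis gam_cvg0 : forall e, 0 < e -> exists N, forall n, (N <= n)%N -> gam n <= e.
Hypothesis gam_sum : forall B, exists n0, forall n, (n0 <= n)%N -> B <= \sum_(k < n) gam k.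
Hypothesis eta_cvg0 : forall e, 0 < e -> exists N, forall n, (N <= n)%N -> eta n <= e.
Hypothesis eta_ge0 : forall n, 0 <= eta n.
Hypothesis E_bound : forall z, l1 z ^+ 2 <= Ce * eform E z z.
Hypothesis c1_gt0 : 0 < c1.
Hypothesis L_diss : forall z, eform E (z *m L) z <= - c1 * eform E z z.
Hypothesis Gm_ge0 : forall t, 0 <= bilin Gm t t.
Hypothesis Phi_step : forall H, 0 <= H -> exists C N, 0 <= C /\
  forall n t, (N <= n)%N -> l1 t^T <= H ->
  `|Phi n.+1 t - (1 - gam n / 2 * bilin Gm t t) * Phi n (t + gam n *: (L *m t))|
    <= C * (l1 t^T * (gam n * eta n)).
Hypothesis Psi_step : forall H, 0 <= H -> exists C N, 0 <= C /\
  forall n t, (N <= n)%N -> l1 t^T <= H ->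
  `|Psi t - (1 - gam n / 2 * bilin Gm t t) * Psi (t + gam n *: (L *m t))|
    <= C * (l1 t^T * (gam n * eta n)).
Hypothesis Phi_init : forall n H, 0 <= H -> exists2 C, 0 <= C & forall t, l1 t^T <= H ->
  `|Phi n t - Psi t| <= C * l1 t^T.

Local Notation W z := (eform E z z).

(* [rho] bounds the norm of [t] dual to the Lyapunov norm [W], in which the
   backward iteration [t + g L t] is a contraction. *)
Definition dual_bound t (rho : R) := forall z, pairing z t ^+ 2 <= rho ^+ 2 * W z.

Lemma dual_bound_l1 : exists2 C, 0 <= C & forall t rho, 0 <= rho -> dual_bound t rho ->
  l1 t^T <= C * rho.
Proof.
pose e k : 'rV[R]_d := delta_mx 0 k.
exists (\sum_k Num.sqrt (W (e k))); first by rewrite sumr_ge0 // => k _; exact: sqrtr_ge0.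
move=> t rho rho0 ht; rewrite /l1 mulr_suml ler_sum // => k _; rewrite mxE.
have := ht (e k); have -> : pairing (e k) t = t k 0.
  rewrite /pairing mxE (bigD1 k) //= big1 ?addr0; last first.
    by move=> j jk; rewrite mxE (negbTE jk) andbF mul0r.
  by rewrite mxE !eqxx mul1r.
rewrite mulrC -(ler_pXn2r (n := 2)) ?nnegrE //; last by rewrite mulr_ge0 // sqrtr_ge0.
by rewrite real_normK ?num_real // exprMn sqr_sqrtr ?eform_ge0.
Qed.

Lemma dual_bound_exists t : exists2 rho, 0 <= rho & dual_bound t rho.
Proof.
have Ce' z : l1 z ^+ 2 <= `|Ce| * W z.
  by apply: le_trans (E_bound z) _; rewrite ler_wpM2r ?eform_ge0 // ler_norm.
exists (Num.sqrt (`|Ce|) * l1 t^T); first by rewrite mulr_ge0 ?sqrtr_ge0 // l1_ge0.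
move=> z; rewrite exprMn sqr_sqrtr // mulrAC.
apply: le_trans (ler_wpM2r (sqr_ge0 _) (Ce' z)).
by rewrite -real_normK ?num_real // -exprMn ler_pXn2r ?nnegrE ?pairing_bound // mulr_ge0 // l1_ge0.
Qed.

(** Moved onto [z], the step changes [W] by at most [- 2 * c1 * g * W] plus a quadratic term. For
    small [g] half of the gain pays for that term, and [1 - c1 * g] is below the square of
    [1 - c1 / 2 * g]. *)
Lemma dual_bound_contract : exists2 N, forall n, (N <= n)%N -> c1 / 2 * gam n <= 1 &
  forall n t rho, (N <= n)%N -> 0 <= rho -> dual_bound t rho ->
  dual_bound (t + gam n *: (L *m t)) ((1 - c1 / 2 * gam n) * rho).
Proof.
have [Cf Cf0 hf] := eform_bound E; have [CL CL0 hL] := l1_mulmx L.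
pose K := Cf * CL ^+ 2 * `|Ce|; have K0 : 0 <= K by rewrite /K; nonneg.
have K1 : 0 < 1 + K by rewrite ltr_wpDr.
have e0 : 0 < Num.min (c1 / (1 + K)) (2 / c1) by rewrite lt_min !divr_gt0.
have [N hN] := gam_cvg0 e0.
have small n : (N <= n)%N -> gam n * (1 + K) <= c1 /\ c1 / 2 * gam n <= 1.
  move=> /hN; rewrite le_min => /andP[h1 h2]; split; first by rewrite -ler_pdivlMr.
  by move: h2; rewrite ler_pdivlMr // => h2; lra.
exists N => [n /small[]//|n t rho /small [s1 s2] rho0 ht z].
have -> : pairing z (t + gam n *: (L *m t)) = pairing (z + gam n *: (z *m L)) t.
  rewrite pairingDl pairingZl /pairing (mulmxDr z t) -scalemxAr.
  by rewrite -mulmxA [LHS]mxE; congr (_ + _); rewrite [LHS]mxE.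
apply: le_trans (ht _) _.
have -> : ((1 - c1 / 2 * gam n) * rho) ^+ 2 * W z =
  rho ^+ 2 * ((1 - c1 / 2 * gam n) ^+ 2 * W z) by rewrite exprMn mulrAC mulrC.
rewrite ler_wpM2l ?sqr_ge0 //.
rewrite eform_sq eformZl !eformZr eformC.
have g0 := ltW (gam_gt0 n).
have e1 : eform E (z *m L) (z *m L) <= K * W z.
  apply: le_trans (ler_norm _) _; apply: le_trans (hf _ _) _.
  have -> : K * W z = Cf * (CL ^+ 2 * (`|Ce| * W z)) by rewrite /K; ring.
  rewrite ler_wpM2l // -expr2; apply: (@le_trans _ _ ((CL * l1 z) ^+ 2)).
    by rewrite ler_pXn2r ?nnegrE ?l1_ge0 ?hL // mulr_ge0 ?l1_ge0.
  rewrite exprMn ler_wpM2l ?sqr_ge0 //; apply: le_trans (E_bound z) _.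
  by rewrite ler_wpM2r ?eform_ge0 // ler_norm.
have W0 := eform_ge0 E z.
have e2 : gam n * (gam n * eform E (z *m L) (z *m L)) <= c1 * gam n * W z.
  have -> : c1 * gam n * W z = gam n * (c1 * W z) by ring.
  rewrite ler_wpM2l //; apply: le_trans (ler_wpM2l g0 e1) _.
  rewrite mulrA ler_wpM2r //; apply: le_trans s1; rewrite ler_wpM2l // lerDr //.
have e3 := ler_wpM2l g0 (L_diss z).
have e4 : 0 <= (c1 / 2 * gam n) ^+ 2 * W z by rewrite mulr_ge0 ?sqr_ge0.
rewrite eformC in e3 *.
have -> : (1 - c1 / 2 * gam n) ^+ 2 * W z =
  W z - c1 * gam n * W z + (c1 / 2 * gam n) ^+ 2 * W z by field.
move: e2 e3 e4; rewrite [eform E z (z *m L)]eformC; lra.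
Qed.

(** The two functions obey the same recursion up to [gam n * eta n], with a factor of modulus at
    most 1. Measuring their difference by [u n * rho], linearly in the dual norm, turns the
    contraction of [t] into a contraction of [u]. *)
Lemma charfun_cvg t e : 0 < e -> exists N, forall n, (N <= n)%N -> `|Phi n t - Psi t| <= e.
Proof.
move=> e0; have [rho0 rho0_ge0 ht0] := dual_bound_exists t.
have [Cb Cb0 hb] := dual_bound_l1; have [N1 hN1 hc] := dual_bound_contract.
have H0 : 0 <= Cb * rho0 by rewrite mulr_ge0.
have [CP [N2 [CP0 hP]]] := Phi_step H0; have [CS [N3 [CS0 hS]]] := Psi_step H0.
have [CG CG0 hG] := bilin_bound Gm.
have CGp : 0 < 1 + CG * (Cb * rho0) ^+ 2 by rewrite ltr_wpDr // mulr_ge0 ?sqr_ge0.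
have CGi : 0 < (1 + CG * (Cb * rho0) ^+ 2)^-1 by rewrite invr_gt0.
have [N4 hN4] := gam_cvg0 CGi.
pose N := maxn (maxn N1 N2) (maxn N3 N4).
have [CI CI0 hI] := Phi_init N H0.
pose C := Cb * (CP + CS).
(* The bound is defined as the solution of the recursion with equality; at [N] it has the value
   given by [Phi_init]. *)
pose u := fix u n := if n is n'.+1 then
  if (N <= n')%N then (1 - c1 / 2 * gam n') * u n' + C * (gam n' * eta n') else CI * Cb
  else CI * Cb.
have uE k : (k <= N)%N -> u k = CI * Cb.
  by case: k => [//|k] kN; rewrite /= leqNgt kN.
have uN : u N = CI * Cb by exact: uE.
have main n : (N <= n)%N -> 0 <= u n /\ forall t rho, 0 <= rho <= rho0 ->
    dual_bound t rho -> `|Phi n t - Psi t| <= u n * rho.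
  move=> Nn; rewrite -(subnKC Nn); elim: (n - N)%N => [|k].
    rewrite addn0 uN; split; first by rewrite mulr_ge0.
    move=> t' rho /andP[r0 r1] ht; apply: le_trans (hI t' _) _.
      by apply: le_trans (hb _ _ r0 ht) _; rewrite ler_wpM2l.
    by rewrite -mulrA ler_wpM2l // hb.
  have {Nn} : (N <= N + k)%N by exact: leq_addr.
  rewrite addnS; move: (N + k)%N => {}n Nn [u0 IH]; rewrite /= Nn.
  have := Nn; rewrite !geq_max => /andP[/andP[n1 n2] /andP[n3 n4]].
  have q0 : 0 <= 1 - c1 / 2 * gam n by rewrite subr_ge0 hN1.
  have g0 := ltW (gam_gt0 n).
  have q1 : 1 - c1 / 2 * gam n <= 1 by rewrite gerBl mulr_ge0 // divr_ge0 // ltW.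
  have ge0 : 0 <= gam n * eta n by rewrite mulr_ge0.
  split; first by rewrite /C; nonneg.
  move=> t' rho /andP[r0 r1] ht; have hl := hb _ _ r0 ht.
  have hl0 : l1 t'^T <= Cb * rho0 by apply: le_trans hl _; rewrite ler_wpM2l.
  have hp := hP _ _ n2 hl0; have hs := hS _ _ n3 hl0.
  have hi : `|Phi n (t' + gam n *: (L *m t')) - Psi (t' + gam n *: (L *m t'))|
     <= u n * ((1 - c1 / 2 * gam n) * rho).
    apply: IH; last exact: hc.
    by rewrite mulr_ge0 //= (le_trans _ r1) // ler_piMl.
  have gG : `|1 - gam n / 2 * bilin Gm t' t'| <= 1.
    have G0 := Gm_ge0 t'.
    have hg : gam n * (1 + CG * (Cb * rho0) ^+ 2) <= 1.
      by rewrite -ler_pdivlMr // mul1r hN4.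
    have G1 : bilin Gm t' t' <= CG * (Cb * rho0) ^+ 2.
      apply: le_trans (ler_norm _) _; apply: le_trans (hG _ _) _.
      by rewrite ler_wpM2l // -expr2 ler_pXn2r ?nnegrE ?l1_ge0.
    have G2 := ler_wpM2l g0 G1; have G3 := mulr_ge0 g0 G0.
    by rewrite ler_norml; apply/andP; split; lra.
  set a := 1 - gam n / 2 * _ in hp hs gG; set t2 := t' + _ in hp hs hi.
  have -> : Phi n.+1 t' - Psi t' = (Phi n.+1 t' - a * Phi n t2) + a * (Phi n t2 - Psi t2)
     - (Psi t' - a * Psi t2) by ring.
  apply: le_trans (ler_normB _ _) _; apply: le_trans (lerD (ler_normD _ _) hs) _.
  rewrite -addrA; apply: le_trans (lerD hp (lexx _)) _.
  have h3 : `|a * (Phi n t2 - Psi t2)| <= u n * ((1 - c1 / 2 * gam n) * rho).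
    by rewrite normrM -[leRHS]mul1r; apply: ler_pM.
  have h4 : l1 t'^T * (gam n * eta n) <= Cb * rho * (gam n * eta n) by rewrite ler_wpM2r.
  have := ler_wpM2l CP0 h4; have := ler_wpM2l CS0 h4; rewrite /C; move: h3.
  set X := gam n * eta n; set Y := l1 _ * X; nra.
have C0 : 0 <= C by rewrite /C; nonneg.
have hu n : (N <= n)%N -> u n.+1 <= (1 - c1 / 2 * gam n) * u n + C * (gam n * eta n).
  by move=> Nn; rewrite /= Nn.
have hcg n : (N <= n)%N -> c1 / 2 * gam n <= 1.
  by rewrite !geq_max => /andP[/andP[n1 _] _]; exact: hN1.
have c20 : 0 < c1 / 2 by rewrite divr_gt0.
have r1 : 0 < 1 + rho0 by rewrite ltr_wpDr.
have e1 : 0 < e / (1 + rho0) by rewrite divr_gt0.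
have [n0 hn0] := recursion_vanishes c20 C0 gam_gt0 hcg gam_sum eta_cvg0 hu e1.
exists (maxn N n0) => n; rewrite geq_max => /andP[Nn n0n].
have [u0 hm] := main n Nn.
apply: le_trans (hm t rho0 _ ht0) _; first by rewrite rho0_ge0 lexx.
apply: le_trans (ler_wpM2r rho0_ge0 (hn0 n n0n)) _.
by rewrite mulrAC ler_pdivrMr // ler_wpM2l ?(ltW e0) // lerDr.
Qed.

End CharFunLimit.

(** * Convergence of absolute moments *)

Section Bernstein.
Variable R : realType.
Implicit Types (x y v c e : R) (f h : nat -> R).

(* Iterated from [k = 0], the averaging [bstep x] computes the expectation of
   [f] under the binomial law of parameter [x]. *)
Definition bstep x f k : R := (1 - x) * f k + x * f k.+1.

Lemma iter_bstep_le x f h m : 0 <= x <= 1 -> (forall k, f k <= h k) ->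
  forall k, iter m (bstep x) f k <= iter m (bstep x) h k.
Proof.
move=> /andP[x0 x1] fh; elim: m => [//|m IHm] k /=.
by apply: lerD; apply: ler_wpM2l; rewrite ?subr_ge0.
Qed.

Lemma iter_bstepD x f h m k :
  iter m (bstep x) (fun k => f k + h k) k = iter m (bstep x) f k + iter m (bstep x) h k.
Proof.
elim: m k => [//|m IHm] k; rewrite !iterS {1}/bstep !IHm /bstep; ring.
Qed.

Lemma iter_bstepZ x c f m k :
  iter m (bstep x) (fun k => c * f k) k = c * iter m (bstep x) f k.
Proof. elim: m k => [//|m IHm] k; rewrite !iterS {1}/bstep !IHm /bstep; ring. Qed.

Lemma iter_bstep_cst x c m k : iter m (bstep x) (fun=> c) k = c.
Proof. elim: m k => [//|m IHm] k; rewrite !iterS /bstep !IHm; ring. Qed.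

Lemma iter_bstep_sqr x c m k :
  iter m (bstep x) (fun k => (k%:R + c) ^+ 2) k =
  (k%:R + c + m%:R * x) ^+ 2 + m%:R * (x * (1 - x)).
Proof.
elim: m k => [|m IHm] k; first by rewrite /= !mul0r !addr0.
by rewrite iterS /bstep !IHm -!natr1; ring.
Qed.

(** With a quadratic modulus of continuity, Bernstein's estimate reduces to the binomial variance
    [x * (1 - x) / m]. *)
Lemma bernstein_bound x v f m (a K : R) : 0 <= x <= 1 -> (0 < m)%N -> 0 <= K ->
  (forall k, `|f k - v| <= a + K * (k%:R / m%:R - x) ^+ 2) ->
  `|iter m (bstep x) f 0 - v| <= a + K / m%:R.
Proof.
move=> x01 m0 K0 hf; have m0' : 0 < m%:R :> R by rewrite ltr0n.
pose q k := a + K / m%:R ^+ 2 * (k%:R + - (m%:R * x)) ^+ 2.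
have hq k : `|f k - v| <= q k.
  apply: le_trans (hf k) _; rewrite /q le_eqVlt; apply/orP; left; apply/eqP.
  by field; rewrite gt_eqF.
have qE : iter m (bstep x) q 0 = a + K / m%:R * (x * (1 - x)).
  rewrite /q iter_bstepD iter_bstep_cst iter_bstepZ iter_bstep_sqr.
  by field; rewrite gt_eqF.
have qle : iter m (bstep x) q 0 <= a + K / m%:R.
  case/andP: x01 => x0 x1.
  rewrite qE lerD2l ler_piMr ?divr_ge0 ?(ltW m0') //.
  have := sqr_ge0 x; rewrite expr2; lra.
rewrite ler_norml; apply/andP; split.
  rewrite lerBrDr; apply: (@le_trans _ _ (v + -1 * iter m (bstep x) q 0)).
    by rewrite mulN1r addrC lerD2l lerN2.
  rewrite -{1}(iter_bstep_cst x v m 0) -iter_bstepZ -iter_bstepD.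
  apply: iter_bstep_le => // k; rewrite mulN1r.
  by have := hq k; rewrite ler_norml => /andP[h _]; rewrite addrC -lerBrDr.
rewrite lerBlDr; apply: (@le_trans _ _ (v + iter m (bstep x) q 0)).
  rewrite -{1}(iter_bstep_cst x v m 0) -iter_bstepD.
  apply: iter_bstep_le => // k.
  by have := hq k; rewrite ler_norml => /andP[_ h]; rewrite addrC -lerBlDr.
by rewrite addrC lerD2r.
Qed.

Lemma sin_le_mono x y : 0 <= x <= y -> x + y <= pi -> sin x <= sin y.
Proof.
move=> /andP[x0 xy] xypi; rewrite -subr_ge0.
have -> : sin y - sin x = 2 * cos ((x + y) / 2) * sin ((y - x) / 2).
  have -> : sin y = sin ((x + y) / 2 + (y - x) / 2) by congr sin; field.
  have -> : sin x = sin ((x + y) / 2 - (y - x) / 2) by congr sin; field.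
  rewrite sinB sinD; ring.
have p0 := pi_gt0 R.
rewrite !mulr_ge0 //.
  by apply: cos_ge0_pihalf; apply/andP; split; lra.
by apply: sin_ge0_pi; apply/andP; split; lra.
Qed.

(** In the product formula for [cos x - cos y] both sines are at least [sin (e / 2)]. It converts
    distance of angles into squared distance of cosines, as [bernstein_bound] requires. *)
Lemma cos_separated (e : R) : 0 < e <= pi -> exists2 del, 0 < del &
  forall x y, 0 <= x <= pi -> 0 <= y <= pi -> e <= `|x - y| -> del <= (cos x - cos y) ^+ 2.
Proof.
move=> /andP[e0 epi].
have s0 : 0 < sin (e / 2) by apply: sin_gt0_pi; apply/andP; split; lra.
have sp : 0 < 2 * sin (e / 2) ^+ 2 by rewrite mulr_gt0 // exprn_gt0.
exists ((2 * sin (e / 2) ^+ 2) ^+ 2); first by rewrite exprn_gt0.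
move=> x y; wlog xy : x y / x <= y => [hw|] hx hy exy.
  have [xy|/ltW yx] := leP x y; first exact: hw.
  have -> : (cos x - cos y) ^+ 2 = (cos y - cos x) ^+ 2 by ring.
  by apply: hw => //; rewrite distrC.
move: hx hy exy => /andP[x0 x1] /andP[y0 y1].
rewrite distrC ger0_norm ?subr_ge0 // => exy.
have -> : cos x - cos y = 2 * (sin ((x + y) / 2) * sin ((y - x) / 2)).
  have -> : cos y = cos ((x + y) / 2 + (y - x) / 2) by congr cos; field.
  have -> : cos x = cos ((x + y) / 2 - (y - x) / 2) by congr cos; field.
  rewrite cosB cosD; ring.
have h1 : sin (e / 2) <= sin ((y - x) / 2).
  by apply: sin_le_mono; [apply/andP; split|]; lra.
have h2 : sin (e / 2) <= sin ((x + y) / 2).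
  apply: le_trans h1 _; apply: sin_le_mono; [apply/andP; split|]; lra.
have s0' := ltW s0.
have lo : 2 * sin (e / 2) ^+ 2 <= 2 * (sin ((x + y) / 2) * sin ((y - x) / 2)).
  by rewrite ler_pM2l // expr2 ler_pM.
by rewrite ler_pXn2r ?nnegrE ?(ltW sp) ?(le_trans (ltW sp) lo).
Qed.

(** The derivative rule for powers holds at positive points, so the endpoint 0 is treated by
    factoring [x] out of its power. *)
Lemma powR_lipschitz0 (p M : R) : 1 <= p -> 0 <= M ->
  forall x y, 0 <= x <= M -> 0 <= y <= M ->
    `|x `^ p - y `^ p| <= p * M `^ (p - 1) * `|x - y|.
Proof.
move=> p1 M0; have p0 : 0 < p by exact: lt_le_trans p1.
have pm : 0 <= p - 1 by rewrite subr_ge0.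
move=> x y; wlog xy : x y / y <= x => [hw|] hx hy.
  have [yx|/ltW xy] := leP y x; first exact: hw.
  by rewrite distrC [in leRHS]distrC; exact: hw.
case/andP: hx => x0 xM; case/andP: hy => y0 yM.
have [y_eq0|y_neq0] := eqVneq y 0.
  rewrite y_eq0 powR0 ?gt_eqF // !subr0 !ger0_norm ?powR_ge0 //.
  rewrite -(mulr_powRB1 x0 p0) mulrC ler_wpM2r //.
  apply: (@le_trans _ _ (M `^ (p - 1))); first by apply: ge0_ler_powR; rewrite ?nnegrE.
  by rewrite ler_peMl // powR_ge0.
have yp : 0 < y by rewrite lt_neqAle eq_sym y_neq0.
have dp z : y <= z <= M -> is_derive z 1 (fun z : R => z `^ p) (p * z `^ (p - 1)).
  by move=> /andP[yz _]; apply: is_derive1_powR; exact: lt_le_trans yz.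
have hy : y <= y <= M by rewrite lexx.
have hx : y <= x <= M by rewrite xy.
have [c [/andP[yc cM] _ ->]] := mvt_between dp hy hx.
rewrite normrM ler_wpM2r // normrM (gtr0_norm p0) ler_wpM2l ?(ltW p0) //.
rewrite ger0_norm ?powR_ge0 //; apply: ge0_ler_powR; rewrite ?nnegrE //.
exact: le_trans y0 yc.
Qed.

End Bernstein.

Section MomentConvergence.
(** [L n f] plays the expectation of [f] of a real variable at time [n]. *)
Variables (R : realType) (L : nat -> (R -> R) -> R) (q : R).
Implicit Types (f h : R -> R).
Hypothesis LD : forall n f h, L n (fun t => f t + h t) = L n f + L n h.
Hypothesis LZ : forall n (c : R) f, L n (fun t => c * f t) = c * L n f.
Hypothesis L_le : forall n f h, (forall t, f t <= h t) -> L n f <= L n h.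
Hypothesis L1 : forall n (c : R), L n (fun=> c) = c.
Hypothesis L_cos : forall w : R, (fun n => L n (fun t => cos (w * t))) @ \oo --> expR (- (w ^+ 2 * q / 2)).
Hypothesis L_mom : forall k, exists B, forall n, L n (fun t => t ^+ (2 * k)) <= B.
Hypothesis q_gt0 : 0 < q.

Lemma L_ext n f h : f =1 h -> L n f = L n h.
Proof. by move=> fh; apply/eqP; rewrite eq_le !L_le // => t; rewrite fh. Qed.

Lemma L_dist n f h g : (forall t, `|f t - h t| <= g t) -> `|L n f - L n h| <= L n g.
Proof.
move=> hfg; have e : L n f - L n h = L n (fun t => f t + -1 * h t).
  by rewrite LD LZ mulN1r.
have eg : - L n g = L n (fun t => -1 * g t) by rewrite LZ mulN1r.
rewrite e ler_norml eg; apply/andP; split; apply: L_le => t.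
  by have := hfg t; rewrite ler_norml !mulN1r => /andP[].
by have := hfg t; rewrite ler_norml !mulN1r => /andP[].
Qed.

(** Convergence is demanded after multiplication by any cosine, so that the class is stable under
    such products and thus under Bernstein averaging with weight [(1 + cos (s * t)) / 2]. *)
Definition trig f := forall w : R, cvgn (fun n => L n (fun t => f t * cos (w * t))).

Lemma trig_ext f h : f =1 h -> trig f -> trig h.
Proof.
move=> fh hf w; have <- : (fun n => L n (fun t => f t * cos (w * t))) =
    (fun n => L n (fun t => h t * cos (w * t))).
  by apply/funext => n; apply: L_ext => t; rewrite fh.
exact: hf.
Qed.

Lemma trig_cst (c : R) : trig (fun=> c).
Proof.
move=> w; have -> : (fun n => L n (fun t => c * cos (w * t))) =
    (fun n => c * L n (fun t => cos (w * t))) by apply/funext => n; rewrite LZ.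
by apply: is_cvgMr; apply/cvg_ex; exists (expR (- (w ^+ 2 * q / 2))); exact: L_cos.
Qed.

Lemma trigD f h : trig f -> trig h -> trig (fun t => f t + h t).
Proof.
move=> hf hh w; have -> : (fun n => L n (fun t => (f t + h t) * cos (w * t))) =
    (fun n => L n (fun t => f t * cos (w * t)) + L n (fun t => h t * cos (w * t))).
  by apply/funext => n; rewrite -LD; apply: L_ext => t; rewrite mulrDl.
by apply: is_cvgD; [exact: hf | exact: hh].
Qed.

Lemma trig_cosM (s c : R) f : trig f -> trig (fun t => c * cos (s * t) * f t).
Proof.
move=> hf w; have -> : (fun n => L n (fun t => c * cos (s * t) * f t * cos (w * t))) =
    (fun n => (c / 2) * L n (fun t => f t * cos ((s + w) * t))
            + (c / 2) * L n (fun t => f t * cos ((s - w) * t))).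
  apply/funext => n; rewrite -!LZ -LD; apply: L_ext => t.
  by rewrite mulrDl cosD mulrBl cosB; field.
by apply: is_cvgD; apply: is_cvgMr; exact: hf.
Qed.

Lemma trig_cvg f : trig f -> cvgn (fun n => L n f).
Proof.
move=> hf; have <- : (fun n => L n (fun t => f t * cos (0 * t))) = (fun n => L n f).
  by apply/funext => n; apply: L_ext => t; rewrite mul0r cos0 mulr1.
exact: hf.
Qed.

Lemma trig_bernstein (s : R) (f : nat -> R) m k :
  trig (fun t => iter m (bstep ((1 + cos (s * t)) / 2)) f k).
Proof.
elim: m k => [|m IHm] k; first exact: trig_cst.
(* Constant coefficients carry a factor [cos (0 * t)] so that [trig_cosM] handles all four terms. *)
apply: (@trig_ext (fun t =>
   (2^-1 * cos (0 * t) * iter m (bstep ((1 + cos (s * t)) / 2)) f k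
  + (- 2^-1) * cos (s * t) * iter m (bstep ((1 + cos (s * t)) / 2)) f k)
  + (2^-1 * cos (0 * t) * iter m (bstep ((1 + cos (s * t)) / 2)) f k.+1
  + 2^-1 * cos (s * t) * iter m (bstep ((1 + cos (s * t)) / 2)) f k.+1))).
  by move=> t; rewrite iterS {5}/bstep mul0r cos0; field.
by do 2![apply: trigD]; apply: trig_cosM; exact: IHm.
Qed.

Lemma approx_cvg (a : nat -> R) :
  (forall e, 0 < e -> exists2 b, cvgn b & forall n, `|a n - b n| <= e) -> cvgn a.
Proof.
move=> h; apply: cauchy_cvg; apply: cauchy_exP => e e0.
have e3 : 0 < e / 3 by rewrite divr_gt0.
have [b /cvg_ex[l /cvgrPdist_le /(_ _ e3) [N _ hN]] hb] := h _ e3.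
exists l; exists N => // n Nn /=; have := hN n Nn; have := hb n.
rewrite /ball /= => h1 h2; rewrite distrC.
have -> : a n - l = (a n - b n) - (l - b n) by ring.
apply: le_lt_trans (ler_normB _ _) _; lra.
Qed.

(* Periodise [|t|^p] outside [-M, M] and apply Bernstein's theorem in the
   variable [cos (pi t / M)]. *)
Lemma powR_trig_approx (p : R) : 1 <= p -> exists k, forall e, 0 < e ->
  exists2 f, trig f & forall t, `|(`|t| `^ p - f t)| <= e + e * t ^+ (2 * k).
Proof.
move=> p1; have p0 : 0 < p by exact: lt_le_trans p1.
have [k hk] : exists k : nat, p + 1 <= k%:R.
  by exists (Num.bound (p + 1)); apply: ltW; apply: le_lt_trans (archi_boundP _); rewrite ?addr_ge0 // ltW.
exists k => e e0.
have pi0 := pi_gt0 R.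
(* Outside [[-M, M]] one has [1 <= e * |t|], so the power [p] is at most [e] times the power
   [p + 1], hence at most [e * t ^+ (2 * k)]. *)
pose M := 1 + e^-1; have M1 : 1 <= M by rewrite lerDl invr_ge0 ltW.
have M0 : 0 < M by exact: lt_le_trans M1.
have eM : 1 <= e * M by rewrite mulrDr mulr1 divff ?gt_eqF // lerDr ltW.
pose s := pi / M; have s0 : 0 < s by rewrite divr_gt0.
(* The function to approximate, in terms of the angle [al = s * |t|]. *)
pose F (al : R) := (al * (M / pi)) `^ p.
have range al : 0 <= al <= pi -> 0 <= al * (M / pi) <= M.
  move=> /andP[a0 a1]; rewrite mulr_ge0 ?divr_ge0 ?(ltW M0) ?(ltW pi0) //=.
  rewrite mulrA ler_pdivrMr // mulrC ler_pM2l //.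
pose CF := p * M `^ (p - 1) * (M / pi).
have pw := powR_ge0 M (p - 1).
have CF0 : 0 <= CF by rewrite /CF; nonneg.
have F_lip al be : 0 <= al <= pi -> 0 <= be <= pi -> `|F al - F be| <= CF * `|al - be|.
  move=> ha hb; apply: le_trans (powR_lipschitz0 p1 (ltW M0) (range _ ha) (range _ hb)) _.
  rewrite -mulrBl normrM [`|M / pi|]ger0_norm; last by rewrite divr_ge0 ?(ltW M0) ?(ltW pi0).
  by rewrite [`|al - be| * _]mulrC mulrA.
have F_range al : 0 <= al <= pi -> 0 <= F al <= M `^ p.
  move=> /range /andP[a0 a1]; rewrite powR_ge0 /=.
  by apply: ge0_ler_powR; rewrite ?nnegrE ?(ltW p0) ?(ltW M0).
have CF1 : 0 < 1 + CF by rewrite ltr_wpDr.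
pose e1 := Num.min pi (e / 2 / (1 + CF)).
have e1_0 : 0 < e1 <= pi.
  have e20 : 0 < e / 2 / (1 + CF) by rewrite divr_gt0 // divr_gt0.
  by rewrite /e1 lt_min pi0 ge_min lexx e20.
have [del del0 hdel] := cos_separated e1_0.
pose K1 := CF * pi / del.
have K1_0 : 0 <= K1 by rewrite /K1; nonneg.
(* Close angles are handled by the Lipschitz bound; for distant ones the cosines are separated and a
   large multiple of their squared distance dominates. *)
have F_mod al be : 0 <= al <= pi -> 0 <= be <= pi ->
    `|F al - F be| <= e / 2 + K1 * (cos al - cos be) ^+ 2.
  move=> ha hb; apply: le_trans (F_lip _ _ ha hb) _.
  have [sep|near] := leP e1 `|al - be|.
    apply: (@le_trans _ _ (K1 * (cos al - cos be) ^+ 2)); last by rewrite lerDr divr_ge0 // ltW.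
    have d1 : `|al - be| <= pi.
      case/andP: ha => a0 a1; case/andP: hb => b0 b1.
      by rewrite ler_norml; apply/andP; split; lra.
    apply: (@le_trans _ _ (CF * pi)); first by rewrite ler_wpM2l.
    apply: le_trans (ler_wpM2l K1_0 (hdel _ _ ha hb sep)).
    by rewrite /K1 divfK // gt_eqF.
  apply: (@le_trans _ _ (e / 2)); last by rewrite lerDl mulr_ge0 ?sqr_ge0.
  have : `|al - be| <= e / 2 / (1 + CF).
    by apply: le_trans (ltW near) _; rewrite /e1 ge_min lexx orbT.
  rewrite ler_pdivlMr // => h; apply: le_trans h.
  by rewrite mulrC ler_wpM2l // lerDr.
pose m := (Num.bound (4 * K1 / (e / 2))).+1.
have m0 : 0 < m%:R :> R by rewrite ltr0n.
have mK : 4 * K1 / m%:R <= e / 2.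
  rewrite ler_pdivrMr // -ler_pdivrMl ?divr_gt0 // [leLHS]mulrC.
  have e20 : 0 <= 4 * K1 / (e / 2) by nonneg.
  by apply: le_trans (ltW (archi_boundP e20)) _; rewrite ler_nat.
(* Truncation keeps [2 * node j - 1] in the domain of [acos] for every [j]; indices beyond [m] carry
   no binomial weight. *)
pose node (j : nat) : R := Num.min (j%:R / m%:R) 1.
have node01 j : 0 <= node j <= 1.
  by rewrite /node le_min ge_min divr_ge0 // lexx orbT ler01.
have nodeI j : -1 <= 2 * node j - 1 <= 1.
  by case/andP: (node01 j) => n0 n1; apply/andP; split; lra.
pose fk j := F (acos (2 * node j - 1)).
exists (fun t => iter m (bstep ((1 + cos (s * t)) / 2)) fk 0); first exact: trig_bernstein.
move=> t; set x := (1 + cos (s * t)) / 2.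
have x01 : 0 <= x <= 1.
  by have := cos_le1 (s * t); have := cos_geN1 (s * t); rewrite /x => *; apply/andP; split; lra.
have cI : -1 <= cos (s * t) <= 1 by rewrite cos_geN1 cos_le1.
pose a0 := acos (cos (s * t)).
have a0I : 0 <= a0 <= pi by rewrite acos_ge0 // acos_lepi.
have ca0 : cos a0 = cos (s * t) by rewrite acosK // in_itv.
have hf : `|iter m (bstep x) fk 0 - F a0| <= e.
  have K4 : 0 <= 4 * K1 by rewrite mulr_ge0.
  have hb j : `|fk j - F a0| <= e / 2 + 4 * K1 * (j%:R / m%:R - x) ^+ 2.
    have aI : 0 <= acos (2 * node j - 1) <= pi by rewrite acos_ge0 // acos_lepi.
    apply: le_trans (F_mod _ _ aI a0I) _; rewrite lerD2l ca0 acosK; last by rewrite in_itv; exact: nodeI.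
    have -> : (2 * node j - 1 - cos (s * t)) ^+ 2 = 4 * (node j - x) ^+ 2.
      by rewrite /x; field.
    rewrite mulrCA mulrA ler_wpM2l //.
    case/andP: x01 => x0 x1; rewrite /node.
    have [h|/ltW h] := leP (j%:R / m%:R) 1; first by [].
    by rewrite ler_pXn2r ?nnegrE ?subr_ge0 ?lerD2r ?h ?x1 ?(le_trans x1 h).
  have := @bernstein_bound _ x (F a0) fk m (e / 2) (4 * K1) x01 isT K4 hb.
  by move=> h; apply: le_trans h _; move: mK; lra.
have [tM|Mt] := leP `|t| M.
  apply: (@le_trans _ _ e); last by rewrite lerDl mulr_ge0 ?(ltW e0) // exprM exprn_ge0 ?sqr_ge0.
  have st : s * `|t| \in `[0, pi].
    rewrite in_itv /= mulr_ge0 ?(ltW s0) //= /s mulrAC ler_pdivrMr // ler_pM2l //.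
  have a0E : a0 = s * `|t|.
    rewrite /a0; have -> : cos (s * t) = cos (s * `|t|).
      by case: (ger0P t) => // _; rewrite mulrN cosN.
    by rewrite cosK.
  have FE : F a0 = `|t| `^ p.
    have e2 : s * (M / pi) = 1 by rewrite /s mulrA divfK ?(gt_eqF M0) // divff // gt_eqF.
    by rewrite /F a0E mulrAC e2 mul1r.
  by rewrite distrC -FE.
have t0 : 0 < `|t| by exact: lt_trans Mt.
have t1 : 1 <= `|t| by exact: le_trans (ltW Mt).
have tp : `|t| `^ p <= e * t ^+ (2 * k).
  have -> : t ^+ (2 * k) = `|t| `^ (2 * k)%:R.
    by rewrite powR_mulrn ?normr_ge0 // !exprM real_normK ?num_real.
  apply: (@le_trans _ _ (e * `|t| `^ (p + 1))).
    rewrite powRD; last by rewrite (gt_eqF t0) implybT.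
    rewrite powRr1 ?normr_ge0 // mulrCA -{1}[`|t| `^ p]mulr1 ler_wpM2l ?powR_ge0 //.
    by apply: le_trans eM _; rewrite ler_wpM2l ?(ltW e0) // ltW.
  rewrite ler_wpM2l ?(ltW e0) //; apply: ler_powR => //.
  by apply: le_trans hk _; rewrite ler_nat leq_pmull.
case/andP: (F_range _ a0I) => f0 f1.
have Mp : M `^ p <= `|t| `^ p.
  by apply: ge0_ler_powR; rewrite ?nnegrE ?(ltW p0) ?(ltW M0) ?(ltW Mt).
have -> : `|t| `^ p - iter m (bstep x) fk 0 =
  (`|t| `^ p - F a0) - (iter m (bstep x) fk 0 - F a0) by ring.
apply: le_trans (ler_normB _ _) _; rewrite addrC lerD //.
rewrite ger0_norm ?subr_ge0 ?(le_trans f1) //.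
by apply: le_trans tp; rewrite gerBl.
Qed.

Lemma L_powR_cvg (p : R) : 1 <= p ->
  exists l : R, 0 < l /\ (fun n => L n (fun t => `|t| `^ p)) @ \oo --> l.
Proof.
move=> p1; have p0 : 0 < p by exact: lt_le_trans p1.
have [k hk] := powR_trig_approx p1; have [B hB] := L_mom k.
have B1 : 0 < 1 + `|B| by rewrite ltr_wpDr.
have : cvgn (fun n => L n (fun t => `|t| `^ p)).
  apply: approx_cvg => e e0.
  have e1 : 0 < e / (1 + `|B|) by rewrite divr_gt0.
  have [f tf hf] := hk _ e1; exists (fun n => L n f); first exact: trig_cvg.
  move=> n; apply: le_trans (L_dist n hf) _.
  rewrite LD L1 LZ -[X in X + _]mulr1 -mulrDr mulrAC ler_pdivrMr // ler_wpM2l ?(ltW e0) //.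
  by rewrite lerD2l (le_trans (hB n)) // ler_norm.
move=> /cvg_ex[l hl]; exists l; split=> //.
(* Half of the limit of [1 - L n cos]: in the limit of [key], the other half bounds the moment away
   from 0. *)
pose e := (1 - expR (- (q / 2))) / 2.
have x1 : expR (- (q / 2)) < 1 by rewrite -expR0 ltr_expR oppr_lt0 divr_gt0.
have e0 : 0 < e by rewrite divr_gt0 // subr_gt0.
have key t : 1 - cos (1 * t) <= e + 2 * e `^ (- p) * `|t| `^ p.
  rewrite mul1r; have [te|et] := leP `|t| e.
    apply: (@le_trans _ _ e); last by rewrite lerDl !mulr_ge0 ?powR_ge0.
    apply: le_trans te; apply: le_trans (ler_norm _) _.
    by have := cos_lipschitz 0 t; rewrite cos0 sub0r normrN.
  apply: (@le_trans _ _ 2); first by have := cos_geN1 t; lra.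
  rewrite -[leLHS]add0r lerD ?(ltW e0) // -mulrA ler_peMr // powRN mulrC.
  rewrite ler_pdivlMr ?powR_gt0 // mul1r.
  by apply: ge0_ler_powR; rewrite ?nnegrE ?(ltW p0) ?(ltW e0) ?(ltW et).
have hn n : 1 - L n (fun t => cos (1 * t)) <= e + 2 * e `^ (- p) * L n (fun t => `|t| `^ p).
  have -> : 1 - L n (fun t => cos (1 * t)) = L n (fun t => 1 + -1 * cos (1 * t)).
    by rewrite LD L1 LZ mulN1r.
  apply: (@le_trans _ _ (L n (fun t => e + 2 * e `^ (- p) * `|t| `^ p))).
    by apply: L_le => t; rewrite mulN1r.
  by rewrite LD L1 LZ.
have : 1 - expR (- (1 ^+ 2 * q / 2)) <= e + 2 * e `^ (- p) * l.
  have c1 : (fun n => 1 - L n (fun t => cos (1 * t))) @ \oo --> 1 - expR (- (1 ^+ 2 * q / 2)).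
    by apply: cvgB; [exact: cvg_cst | exact: L_cos].
  have c2 : (fun n => e + 2 * e `^ (- p) * L n (fun t => `|t| `^ p)) @ \oo --> e + 2 * e `^ (- p) * l.
    by apply: cvgD; [exact: cvg_cst | apply: cvgMr].
  by apply: (ler_cvg_to c1 c2); apply: nearW => n; exact: hn.
rewrite expr1n mul1r => h; have h2 : e <= 2 * e `^ (- p) * l by move: h; rewrite /e; lra.
have : 0 < 2 * e `^ (- p) * l by exact: lt_le_trans h2.
by rewrite pmulr_rgt0 // mulr_gt0 // powR_gt0.
Qed.

End MomentConvergence.

(** * The Lyapunov equation *)

Section Sylvester.
Variables (R : realType) (d m : nat) (E : 'M[R]_(d, m)) (L : 'M[R]_d).
Variables (Ce c1 : R).
Implicit Types (t w : 'cV[R]_d) (z : 'rV[R]_d) (Q : 'M[R]_d).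
Hypothesis E_bound : forall z, l1 z ^+ 2 <= Ce * eform E z z.
Hypothesis c1_gt0 : 0 < c1.
Hypothesis L_diss : forall z, eform E (z *m L) z <= - c1 * eform E z z.

Local Notation W z := (eform E z z).

Lemma dual_bound_mulmx : exists2 K, 0 <= K & forall t rho, dual_bound E t rho ->
  dual_bound E (L *m t) (K * rho).
Proof.
have [Cf Cf0 hf] := eform_bound E; have [CL CL0 hL] := l1_mulmx L.
pose K := 1 + Cf * CL ^+ 2 * `|Ce|; have K0 : 0 <= K by rewrite /K; nonneg.
exists K => // t rho ht z.
have -> : pairing z (L *m t) = pairing (z *m L) t by rewrite /pairing mulmxA.
apply: le_trans (ht _) _.
have -> : (K * rho) ^+ 2 * W z = rho ^+ 2 * (K * (K * W z)) by ring.
rewrite ler_wpM2l ?sqr_ge0 //.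
have e1 : eform E (z *m L) (z *m L) <= K * W z.
  apply: le_trans (ler_norm _) _; apply: le_trans (hf _ _) _.
  apply: (@le_trans _ _ (Cf * (CL ^+ 2 * (`|Ce| * W z)))).
    rewrite ler_wpM2l // -expr2; apply: (@le_trans _ _ ((CL * l1 z) ^+ 2)).
      by rewrite ler_pXn2r ?nnegrE ?l1_ge0 ?hL // mulr_ge0 ?l1_ge0.
    rewrite exprMn ler_wpM2l ?sqr_ge0 //; apply: le_trans (E_bound z) _.
    by rewrite ler_wpM2r ?eform_ge0 // ler_norm.
  have -> : Cf * (CL ^+ 2 * (`|Ce| * W z)) = (Cf * CL ^+ 2 * `|Ce|) * W z by ring.
  by apply: ler_wpM2r; [exact: eform_ge0 | rewrite /K lerDr].
apply: le_trans e1 _; rewrite ler_peMl ?mulr_ge0 ?eform_ge0 // /K lerDl; nonneg.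
Qed.

(* If [L^T Q + Q L = 0], the form [Q] is invariant up to O(g^2) under the
   contraction [1 + g L], hence vanishes. *)
Lemma lyapunov_operator_inj Q : L^T *m Q + Q *m L = 0 -> Q = 0.
Proof.
move=> QL; have [K K0 hK] := dual_bound_mulmx.
(* This sequence gives access to [dual_bound_contract]; one small value [g = gam n] is fixed
   below. *)
pose gam n : R := n.+1%:R^-1.
have g0 n : 0 < gam n by rewrite invr_gt0.
have gc e : 0 < e -> exists N, forall n, (N <= n)%N -> gam n <= e.
  move=> e0; exists (Num.bound e^-1) => n Nn; rewrite /gam -[e]invrK lef_pV2 ?posrE ?invr_gt0 //.
  have ei : 0 <= e^-1 by rewrite invr_ge0 ltW.
  apply: le_trans (ltW (archi_boundP ei)) _; rewrite ler_nat; exact: leq_trans (leqnSn n).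
have [N1 hN1 hc] := dual_bound_contract g0 gc E_bound c1_gt0 L_diss.
have dp : 0 < c1 / 2 by rewrite divr_gt0.
have e0 : 0 < c1 / 2 / ((c1 / 2) ^+ 2 + K ^+ 2).
  by rewrite divr_gt0 // ltr_wpDr ?sqr_ge0 // exprn_gt0.
have [N2 hN2] := gc _ e0.
pose n := maxn N1 N2; have nN1 : (N1 <= n)%N := leq_maxl _ _.
set c := c1 / 2 in hN1 hc dp e0 hN2.
have gn := g0 n; have cg := hN1 n nN1.
have small : gam n * (c ^+ 2 + K ^+ 2) <= c.
  have := hN2 n (leq_maxr _ _); rewrite ler_pdivlMr // ltr_wpDr ?sqr_ge0 // exprn_gt0 //.
set g := gam n in gn cg small.
(* One iteration costs the contraction of both arguments plus the second-order term; [small] brings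
   the sum below [1 - c * g]. *)
pose kp := (1 - c * g) ^+ 2 + g ^+ 2 * K ^+ 2.
have kp0 : 0 <= kp by rewrite /kp; nonneg.
have kp1 : kp <= 1 - c * g.
  have h : g * (g * (c ^+ 2 + K ^+ 2)) <= g * c by rewrite ler_pM2l.
  by move: h; rewrite /kp; lra.
have [CQ CQ0 hQ] := bilin_bound Q; have [Cb Cb0 hb] := dual_bound_l1 E.
pose u k := CQ * Cb ^+ 2 * kp ^+ k.
have iter k t w rho sig : 0 <= rho -> 0 <= sig -> dual_bound E t rho -> dual_bound E w sig ->
    `|bilin Q t w| <= u k * (rho * sig).
  elim: k t w rho sig => [|k IHk] t w rho sig r0 s0 ht hw.
    apply: le_trans (hQ _ _) _.
    have -> : u 0 * (rho * sig) = CQ * ((Cb * rho) * (Cb * sig)) by rewrite /u expr0; ring.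
    by rewrite ler_wpM2l // ler_pM ?l1_ge0 ?hb.
  have e : bilin Q t w = bilin Q (t + g *: (L *m t)) (w + g *: (L *m w))
      - g ^+ 2 * bilin Q (L *m t) (L *m w).
    rewrite bilinDl !bilinDr !bilinZl !bilinZr.
    have : bilin Q (L *m t) w + bilin Q t (L *m w) = 0.
      rewrite (_ : bilin Q (L *m t) w = bilin (L^T *m Q) t w); last by rewrite /bilin trmx_mul !mulmxA.
      rewrite (_ : bilin Q t (L *m w) = bilin (Q *m L) t w); last by rewrite /bilin !mulmxA.
      by rewrite -bilinD QL /bilin mulmx0 mul0mx mxE.
    move=> h; have -> : bilin Q (L *m t) w = - bilin Q t (L *m w).
      by apply/eqP; rewrite -addr_eq0 h.
    by ring.
  rewrite e; apply: le_trans (ler_normB _ _) _.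
  have q0 : 0 <= 1 - c * g by rewrite subr_ge0.
  have h1 := IHk _ _ _ _ (mulr_ge0 q0 r0) (mulr_ge0 q0 s0)
    (hc n t rho nN1 r0 ht) (hc n w sig nN1 s0 hw).
  have h2 := IHk _ _ _ _ (mulr_ge0 K0 r0) (mulr_ge0 K0 s0) (hK _ _ ht) (hK _ _ hw).
  have -> : u k.+1 * (rho * sig) = u k * ((1 - c * g) * rho * ((1 - c * g) * sig))
     + g ^+ 2 * (u k * (K * rho * (K * sig))) by rewrite /u [kp ^+ k.+1]exprS /kp; ring.
  apply: lerD; first exact: h1.
  by rewrite normrM (ger0_norm (sqr_ge0 g)) ler_wpM2l ?sqr_ge0.
have u0 k : 0 <= u k by rewrite /u; do ?[exact: exprn_ge0 | apply: mulr_ge0 | exact: sqr_ge0].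
have uv e : 0 < e -> exists n0, forall k, (n0 <= k)%N -> u k <= e.
  apply: (@recursion_vanishes R (fun=> g) u (fun=> 0) c 0 0) => //.
  - move=> B; exists (Num.bound (`|B| / g)) => k Nk.
    rewrite sumr_const card_ord -[g *+ k]mulr_natl -ler_pdivrMr //.
    apply: (@le_trans _ _ (`|B| / g)); first by rewrite ler_pM2r ?invr_gt0 // ler_norm.
    have h : 0 <= `|B| / g by nonneg.
    by apply: le_trans (ltW (archi_boundP h)) _; rewrite ler_nat.
  - by move=> e' e'0; exists 0%N => k _; exact: ltW.
  move=> k _; rewrite mul0r addr0 /u [kp ^+ k.+1]exprS mulrCA ler_wpM2r //; exact: u0.
have z0 t w : bilin Q t w = 0.
  have [rho r0 ht] := dual_bound_exists E_bound t; have [sig s0 hw] := dual_bound_exists E_bound w.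
  apply/eqP; rewrite -normr_eq0 eq_le normr_ge0 andbT; apply/ler_addgt0Pl => e e0'.
  have rs : 0 < 1 + rho * sig by rewrite ltr_wpDr // mulr_ge0.
  have [n0 hn0] := uv _ (divr_gt0 e0' rs).
  apply: le_trans (iter n0 _ _ _ _ r0 s0 ht hw) _; rewrite addr0.
  apply: le_trans (ler_wpM2r (mulr_ge0 r0 s0) (hn0 n0 (leqnn _))) _.
  by rewrite mulrAC ler_pdivrMr // ler_wpM2l ?(ltW e0') // lerDr.
apply/matrixP => k l; rewrite mxE -(z0 (delta_mx k 0) (delta_mx l 0)).
by rewrite /bilin trmx_delta -rowE -colE !mxE.
Qed.

(** An injective endomorphism of the finite-dimensional space of matrices is invertible. *)
Lemma lyapunov_operator_surj (G : 'M[R]_d) : exists Q, L^T *m Q + Q *m L = G.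
Proof.
pose S : 'M[R]_(d * d) := lin_mulmx L^T + lin_mulmxr L.
have SE Q : mxvec Q *m S = mxvec (L^T *m Q + Q *m L).
  by rewrite mulmxDr !mul_vec_lin linearD.
have Su : S \in unitmx.
  rewrite unitmxE unitfE; apply/negP => /det0P [v v0 vS]; case/negP: v0.
  rewrite -[v]vec_mxK; apply/eqP.
  rewrite (lyapunov_operator_inj (Q := vec_mx v)) ?linear0 //.
  by apply: (can_inj mxvecK); rewrite -SE vec_mxK vS linear0.
exists (vec_mx (mxvec G *m invmx S)); apply: (can_inj mxvecK).
by rewrite -SE vec_mxK mulmxKV.
Qed.

End Sylvester.

(** * Limit covariance *)

Section ModelFacts.
Variables (R : realType) (d : nat) (Ph M : 'M[R]_d) (nu : 'rV[R]_d) (r : 'cV[R]_d).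
Variables (th b : R).
Implicit Types (x : 'rV[R]_d) (t : 'cV[R]_d).
Hypothesis Ph_ge0 : forall i j, 0 <= Ph i j.
Hypothesis Ph_le1 : forall i, \sum_j Ph i j <= 1.
Hypothesis r_gt0 : forall i, 0 < r i 0.
Hypothesis lifetime_gt0 : forall i, 0 < lifetime M i 0.
Hypothesis PhM : Ph *m M = M - 1%:M.
Hypothesis nuM : nu *m M = th *: nu.
Hypothesis nur : nu *m r = 1%:M.
Hypothesis nu_simp : simp nu.
Hypothesis th_gt0 : 0 < th.

Local Notation kern := (kern Ph).
Local Notation phi := (phi M).
Local Notation psi := (psi nu r b).
Local Notation noise := (noise M nu r b).
Local Notation corr := (corr M nu r b).
Local Notation zcorr := (zcorr M nu r b).
Local Notation mass := (mass r).

Lemma noise_bounds : exists2 C, 0 <= C & forall x i j, simp x -> l1 (noise x i j) <= C.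
Proof.
have [C hC] : exists C : 'I_d -> 'I_d -> R, forall i j, 0 <= C i j /\
    forall x, simp x -> l1 (noise x i j) <= C i j.
  exists (fun i j => sval (cid (lipv_bounds (lipv_noise nu b r_gt0 lifetime_gt0 i j)))) => i j.
  by case: (svalP (cid (lipv_bounds (lipv_noise nu b r_gt0 lifetime_gt0 i j)))).
have C0 i j : 0 <= C i j by case: (hC i j).
exists (\sum_i \sum_j C i j); first by apply: sumr_ge0 => i _; exact: sumr_ge0.
move=> x i j sx; apply: (@le_trans _ _ (C i j)); first by case: (hC i j) => _; exact.
rewrite (bigD1 i) //= (bigD1 j) //= -addrA lerDl addr_ge0 ?sumr_ge0 // => k _.
exact: sumr_ge0.
Qed.

Lemma zcorr_bounds : exists2 C, 0 <= C & forall g x i, simp x -> 0 <= g <= 1 ->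
  l1 (zcorr g x i) <= C.
Proof.
have [C1 [C1_0 h1 _]] := lipv_bounds (lipv_psi nu b r_gt0).
have [C2 [C2_0 h2 _]] := corr_bounds nu b r_gt0 lifetime_gt0.
exists (C1 + C2); first exact: addr_ge0.
move=> g x i sx /andP[g0 g1]; apply: le_trans (l1D _ _) _.
rewrite lerD ?h1 // l1Z ger0_norm // -[leRHS]mul1r ler_pM ?l1_ge0 ?h2 //.
Qed.

Lemma phi_bounds : exists C, forall x, simp x -> 0 <= phi x <= C.
Proof.
have [C [C0 h _]] := lip_phi lifetime_gt0; exists C => x sx.
by rewrite phi_ge0 /= (le_trans (ler_norm _)) // h.
Qed.

(** Subtracting the multiple of the constant column makes the functional vanish on [nu], so that its
    value at [psi x] is proportional to [x 0 k - nu 0 k]. *)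
Definition coord_col k : 'cV[R]_d := delta_mx k 0 - nu 0 k *: const_mx 1.

Lemma mass_nu : mass nu = 1.
Proof. by rewrite /mass nur mxE eqxx. Qed.

Lemma pairing_coord_col (v : 'rV[R]_d) k :
  pairing v (coord_col k) = v 0 k - nu 0 k * \sum_i v 0 i.
Proof.
rewrite /pairing /coord_col mulmxBr -scalemxAr !mxE; congr (_ - _ * _).
  rewrite (bigD1 k) //= mxE !eqxx mulr1 big1 ?addr0 // => i ik.
  by rewrite mxE (negbTE ik) mulr0.
by apply: eq_bigr => i _; rewrite mxE mulr1.
Qed.

Lemma psi_coord x k : simp x ->
  x 0 k - nu 0 k = mass x `^ (1 - b) * pairing (psi x) (coord_col k).
Proof.
move=> sx; have t0 := mass_gt0 r_gt0 sx.
have e1 : mass x `^ b = mass x `^ (b - 1) * mass x by rewrite powRB1_mulr.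
have e2 : mass x `^ (1 - b) * mass x `^ (b - 1) = 1.
  rewrite -powRD; last by rewrite (gt_eqF t0) implybT.
  by rewrite addrA subrK subrr powRr0.
have e3 : pairing (psi x) (coord_col k) = mass x `^ (b - 1) * (x 0 k - nu 0 k).
  rewrite pairing_coord_col /psi; have -> : \sum_i (mass x `^ (b - 1) *: x - mass x `^ b *: nu) 0 i
     = mass x `^ (b - 1) - mass x `^ b.
    under eq_bigr do rewrite !mxE.
    by rewrite sumrB -!mulr_sumr; case: sx => _ ->; case: nu_simp => _ ->; rewrite !mulr1.
  rewrite !mxE e1; ring.
by rewrite e3 mulrA e2 mul1r.
Qed.

Lemma dist_psi : exists2 C, 0 <= C & forall x, simp x -> l1 (x - nu) <= C * l1 (psi x).
Proof.
have [C [C0 h _]] := lip_mass r_gt0 (1 - b).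
exists (\sum_k C * l1 (coord_col k)^T).
  by apply: sumr_ge0 => k _; rewrite mulr_ge0 // l1_ge0.
move=> x sx; rewrite mulr_suml; apply: ler_sum => k _.
rewrite [(x - nu) 0 k]mxE [(- nu) 0 k]mxE psi_coord // normrM -mulrA.
apply: ler_pM; rewrite ?normr_ge0 ?h // mulrC; exact: pairing_bound.
Qed.

Lemma dist_zcorr : exists2 C, 0 <= C & forall g x i, simp x -> 0 <= g <= 1 ->
  l1 (psi x) <= C * (l1 (zcorr g x i) + g) /\ l1 (x - nu) <= C * (l1 (zcorr g x i) + g).
Proof.
have [C1 C1_0 h1] := dist_psi.
have [C2 [C2_0 h2 _]] := corr_bounds nu b r_gt0 lifetime_gt0.
exists ((1 + C1) * (1 + C2)); first nonneg.
move=> g x i sx /andP[g0 g1].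
have hp : l1 (psi x) <= (1 + C2) * (l1 (zcorr g x i) + g).
  have -> : psi x = zcorr g x i - g *: corr x i by rewrite /zcorr addrK.
  apply: le_trans (l1B _ _) _; rewrite l1Z ger0_norm //.
  have h3 := ler_wpM2l g0 (h2 x i sx).
  have := l1_ge0 (zcorr g x i) => z0; have := mulr_ge0 C2_0 z0; move: h3; lra.
have q0 : 0 <= (1 + C2) * (l1 (zcorr g x i) + g) by nonneg.
split.
  by apply: le_trans hp _; rewrite -mulrA ler_peMl // lerDl.
apply: le_trans (h1 _ sx) _; apply: le_trans (ler_wpM2l C1_0 hp) _.
by rewrite -mulrA ler_wpM2r // lerDr.
Qed.

Lemma phi_nu : phi nu = th^-1.
Proof.
rewrite /phi /lifetime mulmxA nuM -scalemxAl mxE.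
have -> : (nu *m const_mx 1 : 'M[R]_1) 0 0 = 1.
  by rewrite mxE -[RHS](proj2 nu_simp); apply: eq_bigr => i _; rewrite mxE mulr1.
by rewrite mulr1 powR_inv1 // ltW.
Qed.

Lemma phi_near : exists2 C, 0 <= C & forall g x i, simp x -> 0 <= g <= 1 ->
  `|phi x - th^-1| <= C * (l1 (zcorr g x i) + g).
Proof.
have [C [C0 _ h]] := lip_phi lifetime_gt0; have [D D0 hD] := dist_zcorr.
exists (C * D); first exact: mulr_ge0.
move=> g x i sx g01; rewrite -phi_nu; apply: le_trans (h _ _ sx nu_simp) _.
by rewrite -mulrA ler_wpM2l //; case: (hD g x i sx g01).
Qed.

Definition cov x i k l : R := \sum_j kern x i j * (noise x i j 0 k * noise x i j 0 l).

Definition cov_mean : 'M[R]_d := \matrix_(k, l) \sum_i nu 0 i * cov nu i k l.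

(** The function [c] with [c - kern nu c = (cov_mean - cov nu) / 2], built from [M] and [lifetime]
    like [poisson]. *)
Definition cov_corr (i : 'I_d) : 'M[R]_d := \matrix_(k, l)
  (((\sum_j nu 0 j * cov nu j k l) * lifetime M i 0 - \sum_j M i j * cov nu j k l) / 2).

Lemma kern_nu_resolvent (f : 'I_d -> R) i :
  \sum_j kern nu i j * (\sum_k M j k * f k) =
  \sum_k M i k * f k - f i + absorb Ph i * (th * \sum_k nu 0 k * f k).
Proof.
have /(congr1 (fun v : 'rV[R]_d => \sum_k v 0 k * f k)) := sum_kern_row PhM nu i.
rewrite nuM => e.
transitivity (\sum_k (\sum_j kern nu i j *: row j M) 0 k * f k).
  rewrite (eq_bigr (fun j => \sum_k kern nu i j * (M j k * f k))); last first.
    by move=> j _; rewrite mulr_sumr.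
  rewrite exchange_big; apply: eq_bigr => k _; rewrite summxE mulr_suml.
  by apply: eq_bigr => j _; rewrite !mxE mulrA.
rewrite e /= mulrCA; set a := absorb Ph i.
have -> : \sum_k (row i M - delta_mx 0 i + a *: (th *: nu)) 0 k * f k =
  \sum_k M i k * f k - \sum_k (k == i)%:R * f k + \sum_k th * (a * (nu 0 k * f k)).
  rewrite -sumrB -big_split; apply: eq_bigr => k _; rewrite !mxE eqxx /=; ring.
rewrite -!mulr_sumr; congr (_ - _ + _).
by rewrite (bigD1 i) //= eqxx mul1r big1 ?addr0 // => k /negbTE ->; rewrite mul0r.
Qed.

Lemma nu_lifetime : (nu *m lifetime M) 0 0 = th.
Proof.
rewrite /lifetime mulmxA nuM -scalemxAl mxE mxE.
rewrite (eq_bigr (fun i => nu 0 i)) => [|i _]; last by rewrite mxE mulr1.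
by case: nu_simp => _ ->; rewrite mulr1.
Qed.

Lemma cov_poisson i k l :
  cov nu i k l / 2 - \sum_j kern nu i j * cov_corr j k l =
  cov_mean k l / 2 - cov_corr i k l.
Proof.
pose f j := cov nu j k l; pose mf := \sum_j nu 0 j * f j.
have cE j : cov_corr j k l = (mf * lifetime M j 0 - \sum_h M j h * f h) / 2 by rewrite mxE.
have -> : \sum_j kern nu i j * cov_corr j k l =
   (mf * (\sum_j kern nu i j * lifetime M j 0) - \sum_j kern nu i j * (\sum_h M j h * f h)) / 2.
  rewrite mulr_sumr -sumrB mulr_suml; apply: eq_bigr => j _; rewrite cE; ring.
rewrite cE mxE -/mf -/(f i) kern_nu_resolvent sum_kern_lifetime // nu_lifetime -/mf; ring.
Qed.

Lemma bilinE (Q : 'M[R]_d) t : bilin Q t t = \sum_k \sum_l t k 0 * t l 0 * Q k l.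
Proof.
rewrite /bilin mxE exchange_big; apply: eq_bigr => l _; rewrite mxE mulr_suml.
by apply: eq_bigr => k _; rewrite mxE; ring.
Qed.

Lemma pairing_sqr (v : 'rV[R]_d) t :
  pairing v t ^+ 2 = \sum_k \sum_l t k 0 * t l 0 * (v 0 k * v 0 l).
Proof.
rewrite /pairing mxE expr2 big_distrlr /=; apply: eq_bigr => k _.
by apply: eq_bigr => l _; ring.
Qed.

Lemma sum_cov x i t :
  \sum_j kern x i j * pairing (noise x i j) t ^+ 2 = \sum_k \sum_l t k 0 * t l 0 * cov x i k l.
Proof.
transitivity (\sum_j \sum_k \sum_l kern x i j * (t k 0 * t l 0 * (noise x i j 0 k * noise x i j 0 l))).
  by apply: eq_bigr => j _; rewrite pairing_sqr mulr_sumr; apply: eq_bigr => k _; rewrite mulr_sumr.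
rewrite exchange_big; apply: eq_bigr => k _; rewrite exchange_big; apply: eq_bigr => l _.
by rewrite /cov mulr_sumr; apply: eq_bigr => j _; rewrite mulrCA.
Qed.

(** At [x = nu] the difference is exactly 0 by [cov_poisson]; it is Lipschitz in [x], and
    [dist_zcorr] bounds the distance to [nu]. *)
Lemma variance_near : exists2 C, 0 <= C & forall g x i t, simp x -> 0 <= g <= 1 ->
  `|\sum_j kern x i j * (pairing (noise x i j) t ^+ 2 / 2)
    - \sum_j kern x i j * bilin (cov_corr j) t t
    - (bilin cov_mean t t / 2 - bilin (cov_corr i) t t)| <=
  C * l1 t^T ^+ 2 * (l1 (zcorr g x i) + g).
Proof.
pose Y i k l x := cov x i k l / 2 - \sum_j kern x i j * cov_corr j k l.
have lipY i k l : lip (Y i k l).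
  apply: lip_add.
    apply: lip_mul; last exact: lip_cst.
    apply: lip_sum => j; apply: lip_mul; first exact: lip_kern.
    by apply: lip_mul; exact: lipv_noise.
  apply: lip_opp; apply: lip_sum => j; apply: lip_mul; first exact: lip_kern.
  exact: lip_cst.
have [C hC] : exists C : 'I_d -> 'I_d -> 'I_d -> R, forall i k l, 0 <= C i k l /\
    forall x, simp x -> `|Y i k l x - Y i k l nu| <= C i k l * l1 (x - nu).
  exists (fun i k l => sval (cid (lipY i k l))) => i k l.
  case: (svalP (cid (lipY i k l))) => c0 _ h; split=> // x sx; exact: h.
have [D D0 hD] := dist_zcorr.
pose S := \sum_i \sum_k \sum_l C i k l.
have C0 i k l : 0 <= C i k l by case: (hC i k l).
have S0 : 0 <= S by apply: sumr_ge0 => i _; apply: sumr_ge0 => k _; exact: sumr_ge0.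
exists (S * D); first exact: mulr_ge0.
move=> g x i t sx g01; set h := l1 t^T.
have tk k : `|t k 0| <= h by have := coord_le_l1 t^T k; rewrite mxE.
have -> : \sum_j kern x i j * (pairing (noise x i j) t ^+ 2 / 2)
    - \sum_j kern x i j * bilin (cov_corr j) t t
    - (bilin cov_mean t t / 2 - bilin (cov_corr i) t t) =
   \sum_k \sum_l t k 0 * t l 0 * (Y i k l x - Y i k l nu).
  have -> : \sum_j kern x i j * (pairing (noise x i j) t ^+ 2 / 2) =
      \sum_k \sum_l t k 0 * t l 0 * (cov x i k l / 2).
    under eq_bigr do rewrite mulrA.
    rewrite -mulr_suml sum_cov mulr_suml; apply: eq_bigr => k _.
    by rewrite mulr_suml; apply: eq_bigr => l _; rewrite mulrA.
  have -> : \sum_j kern x i j * bilin (cov_corr j) t t =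
      \sum_k \sum_l t k 0 * t l 0 * (\sum_j kern x i j * cov_corr j k l).
    transitivity (\sum_j \sum_k \sum_l t k 0 * t l 0 * (kern x i j * cov_corr j k l)).
      apply: eq_bigr => j _; rewrite bilinE mulr_sumr; apply: eq_bigr => k _.
      by rewrite mulr_sumr; apply: eq_bigr => l _; rewrite mulrCA.
    rewrite exchange_big; apply: eq_bigr => k _; rewrite exchange_big; apply: eq_bigr => l _.
    by rewrite mulr_sumr.
  rewrite !bilinE mulr_suml -!sumrB; apply: eq_bigr => k _.
  rewrite mulr_suml -!sumrB; apply: eq_bigr => l _.
  by rewrite {2}/Y cov_poisson /Y; ring.
apply: (@le_trans _ _ (\sum_k \sum_l h ^+ 2 * (C i k l * l1 (x - nu)))).
  apply: le_trans (ler_norm_sum _ _ _) _; apply: ler_sum => k _.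
  apply: le_trans (ler_norm_sum _ _ _) _; apply: ler_sum => l _.
  rewrite !normrM expr2; apply: ler_pM; rewrite ?mulr_ge0 ?normr_ge0 //.
    by apply: ler_pM.
  by case: (hC i k l) => _; exact.
have -> : \sum_k \sum_l h ^+ 2 * (C i k l * l1 (x - nu)) =
   (\sum_k \sum_l C i k l) * (h ^+ 2 * l1 (x - nu)).
  rewrite mulr_suml; apply: eq_bigr => k _; rewrite mulr_suml; apply: eq_bigr => l _; ring.
have -> : S * D * h ^+ 2 * (l1 (zcorr g x i) + g) = S * (h ^+ 2 * (D * (l1 (zcorr g x i) + g))) by ring.
apply: ler_pM.
- by apply: sumr_ge0 => k _; exact: sumr_ge0.
- by rewrite mulr_ge0 ?sqr_ge0 ?l1_ge0.
- rewrite /S [leRHS](bigD1 i) //= lerDl sumr_ge0 // => j _.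
  by apply: sumr_ge0 => k _; exact: sumr_ge0.
rewrite ler_wpM2l ?sqr_ge0 //; by case: (hD g x i sx g01).
Qed.

Lemma bilin_cov_mean t :
  bilin cov_mean t t = \sum_i nu 0 i * \sum_j kern nu i j * pairing (noise nu i j) t ^+ 2.
Proof.
rewrite bilinE.
transitivity (\sum_i \sum_k \sum_l t k 0 * t l 0 * (nu 0 i * cov nu i k l)).
  rewrite [RHS]exchange_big; apply: eq_bigr => k _; rewrite [RHS]exchange_big.
  by apply: eq_bigr => l _; rewrite mxE mulr_sumr.
apply: eq_bigr => i _; rewrite sum_cov mulr_sumr; apply: eq_bigr => k _.
by rewrite mulr_sumr; apply: eq_bigr => l _; rewrite mulrCA.
Qed.

Lemma cov_mean_ge0 t : 0 <= bilin cov_mean t t.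
Proof.
rewrite bilin_cov_mean; apply: sumr_ge0 => i _; apply: mulr_ge0; first by case: nu_simp.
by apply: sumr_ge0 => j _; rewrite mulr_ge0 ?sqr_ge0 // kern_ge0.
Qed.

(* A state [i0] with positive killing rate jumps everywhere under [kern nu],
   so a vanishing variance makes [poisson] constant in the direction
   [coord_col k], contradicting the Poisson equation. *)
Lemma cov_mean_coord_neq0 k : (1 < d)%N -> (forall i, 0 < nu 0 i) ->
  (exists i, 0 < absorb Ph i) -> bilin cov_mean (coord_col k) (coord_col k) != 0.
Proof.
move=> d1 nu0 [i0 ai0]; apply/eqP => z.
set t := coord_col k in z.
have kp j : 0 < kern nu i0 j by rewrite ltr_wpDl // mulr_gt0.
have zero j : pairing (noise nu i0 j) t = 0.
  move: z; rewrite bilin_cov_mean => /eqP; rewrite psumr_eq0; last first.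
    move=> i _; apply: mulr_ge0; first exact: ltW.
    by apply: sumr_ge0 => h _; rewrite mulr_ge0 ?sqr_ge0 // kern_ge0.
  move=> /allP /(_ i0 (mem_index_enum _)) /=; rewrite mulf_eq0 gt_eqF //= psumr_eq0; last first.
    by move=> h _; rewrite mulr_ge0 ?sqr_ge0 // kern_ge0.
  move=> /allP /(_ j (mem_index_enum _)) /=; rewrite mulf_eq0 gt_eqF //=.
  by rewrite sqrf_eq0 => /eqP.
set c := pairing (corr nu i0) t.
have pc j : pairing (poisson M nu r b nu j) t = c.
  by have := zero j; rewrite pairingBl => /eqP; rewrite subr_eq0 => /eqP.
have cc j : pairing (corr nu j) t = c.
  rewrite -(sum_kern_poisson nu r b lifetime_gt0 PhM j nu_simp) /pairing mulmx_suml summxE.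
  transitivity (\sum_h kern nu j h * c); last by rewrite -mulr_suml kern_sum // mul1r.
  by apply: eq_bigr => h _; rewrite -scalemxAl mxE -[X in _ * X]/(pairing _ _) pc.
(* At a state other than [k] the Poisson equation, paired with [t], would read [- nu 0 k = 0]. *)
have [j jk] : exists j : 'I_d, j != k.
  have [k0|k0] := eqVneq (k : nat) 0%N.
    by exists (Ordinal d1); rewrite -val_eqE /= k0.
  by exists (Ordinal (ltnW d1)); rewrite -val_eqE /= eq_sym.
have := cc j; rewrite /corr pairingBl pc => /eqP; rewrite subr_eq addrC -subr_eq subrr eq_sym.
rewrite phi_nu nuM scalerA mulVf ?scale1r; last by rewrite gt_eqF.
rewrite /dpsi mass_nu !powR1 mulr1 mulr1 scale1r pairingDl pairingZl.
have -> : pairing ((b - 1) *: nu - b *: nu) t = 0.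
  rewrite -scalerBl pairingZl pairing_coord_col; case: nu_simp => _ ->.
  by rewrite mulr1 subrr mulr0.
rewrite mulr0 addr0 pairing_coord_col; have [_ nu1] := nu_simp.
have -> : \sum_i (delta_mx 0 j - nu) 0 i = 0.
  under eq_bigr do rewrite mxE [(- nu) _ _]mxE.
  by rewrite sumrB nu1; have [_ ->] := simp_delta R j; rewrite subrr.
by rewrite mulr0 subr0 !mxE eqxx [_ == j]eq_sym (negbTE jk) sub0r oppr_eq0 gt_eqF.
Qed.

End ModelFacts.

Lemma expR_dist1 (R : realType) (u : R) : `|expR u - 1| <= `|u| * expR `|u|.
Proof.
have h1 := expR_ge1Dx u; have h2 := expR_ge1Dx (- u).
have e : expR u - 1 <= u * expR u.
  have : expR u * (1 - u) <= expR u * expR (- u) by rewrite ler_wpM2l ?expR_ge0.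
  rewrite -expRD subrr expR0; lra.
have [u0|u0] := leP 0 u.
  rewrite (ger0_norm u0) ger0_norm //; move: h1; lra.
have le1 : expR u <= 1 by rewrite -expR0 ler_expR ltW.
rewrite ler0_norm ?subr_le0 // (ltr0_norm u0).
have : - u * 1 <= - u * expR (- u) by rewrite ler_wpM2l ?oppr_ge0 ?(ltW u0) // -expR0 ler_expR oppr_ge0 ltW.
by move: h1; lra.
Qed.

Lemma powR_cvg_pos (R : realType) (u : nat -> R) (l e : R) : 0 < l -> u @ \oo --> l ->
  (fun n => u n `^ e) @ \oo --> l `^ e.
Proof.
move=> l0 hu; have -> : l `^ e = expR (e * ln l) by rewrite /powR gt_eqF.
have hc : (fun n => expR (e * ln (u n))) @ \oo --> expR (e * ln l).
  apply: (continuous_cvg _ (@continuous_expR R _)); apply: cvgMr.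
  exact: (continuous_cvg _ (continuous_ln l0) hu).
apply: cvg_trans hc; apply: near_eq_cvg.
near=> n; rewrite /powR gt_eqF //; near: n.
exact: (cvgr_gt _ hu).
Unshelve. all: by end_near.
Qed.

(** * Moment convergence for the reinforced chain *)

Section ChainLimit.
Variables (R : realType) (d m : nat) (Ph M : 'M[R]_d) (nu : 'rV[R]_d) (r : 'cV[R]_d).
Variables (th b K0 : R) (E : 'M[R]_(d, m)) (Ce : R).
Variables (gam eta : nat -> R) (kap C0 Ct : R).
Variables (p0 : 'I_d -> R) (xi : 'I_d -> 'rV[R]_d).
Implicit Types (x : 'rV[R]_d) (t : 'cV[R]_d).
Hypothesis Ph_ge0 : forall i j, 0 <= Ph i j.
Hypothesis Ph_le1 : forall i, \sum_j Ph i j <= 1.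
Hypothesis r_gt0 : forall i, 0 < r i 0.
Hypothesis lifetime_gt0 : forall i, 0 < lifetime M i 0.
Hypothesis PhM : Ph *m M = M - 1%:M.
Hypothesis Mr : M *m r = th *: r.
Hypothesis nuM : nu *m M = th *: nu.
Hypothesis nur : nu *m r = 1%:M.
Hypothesis nu_simp : simp nu.
Hypothesis nu_gt0 : forall i, 0 < nu 0 i.
Hypothesis th_gt0 : 0 < th.
Hypothesis absorb_gt0 : exists i, 0 < absorb Ph i.
Hypothesis d_gt1 : (1 < d)%N.
Hypothesis E_bound : forall z : 'rV[R]_d, l1 z ^+ 2 <= Ce * eform E z z.
Hypothesis Ce_gt0 : 0 < Ce.
Hypothesis E_diss : forall z : 'rV[R]_d, eform E (z *m drift_mx M nu r th b K0) z <= 0.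
Hypothesis gam01 : forall n, 0 < gam n <= 1.
Hypothesis gam_decr : forall n, gam n.+1 <= gam n.
Hypothesis gam_cvg0 : forall e, 0 < e -> exists N, forall n, (N <= n)%N -> gam n <= e.
Hypothesis gam_sum : forall B, exists n0, forall n, (n0 <= n)%N -> B <= \sum_(k < n) gam k.
Hypothesis gam_diff : forall n, gam n - gam n.+1 <= C0 * gam n ^+ 2.
Hypothesis eta_ge : forall n, Num.sqrt (gam n) <= eta n.
Hypothesis eta_le : forall n, eta n <= Ct.
Hypothesis eta_cvg0 : forall e, 0 < e -> exists N, forall n, (N <= n)%N -> eta n <= e.
Hypothesis eta_ratio : forall n,
  `|Num.sqrt (gam n) / Num.sqrt (gam n.+1) - 1 - kap / 2 * gam n| <= gam n * eta n.
Hypothesis C0_ge0 : 0 <= C0.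
Hypothesis kap_ge0 : 0 <= kap.
Hypothesis kap_lt : kap < 2 * b.
Hypothesis p0_ge0 : forall i, 0 <= p0 i.
Hypothesis p0_sum : \sum_i p0 i = 1.
Hypothesis xi_simp : forall i, simp (xi i).

Local Notation kern := (kern Ph).
Local Notation noise := (noise M nu r b).
Local Notation corr := (corr M nu r b).
Local Notation zcorr := (zcorr M nu r b).
Local Notation A := (drift_mx M nu r th b K0).
Local Notation V := (scaled gam zcorr).
Local Notation EE := (chain_exp kern gam p0 xi).
Local Notation Gm := (cov_mean Ph M nu r b).
Local Notation co := (cov_corr Ph M nu r b).
Local Notation L := (scaled_drift A b kap th^-1).
Local Notation W z := (eform E z z).
Local Notation sg n := (Num.sqrt (gam n)).

Let d_gt0 : (0 < d)%N. Proof. exact: ltnW. Qed.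
Let kern0 x i j : simp x -> 0 <= kern x i j. Proof. exact: kern_ge0. Qed.
Let kern1 x i : simp x -> \sum_j kern x i j = 1. Proof. exact: kern_sum. Qed.
Let noise0 x i : simp x -> \sum_j kern x i j *: noise x i j = 0.
Proof. exact: sum_kern_noise. Qed.
Let gam_gt0 n : 0 < gam n. Proof. by case/andP: (gam01 n). Qed.
Let gam_le1 n : gam n <= 1. Proof. by case/andP: (gam01 n). Qed.
Let gam_01 n : 0 <= gam n <= 1. Proof. by rewrite ltW //= gam_le1. Qed.
Let sg_gt0 n : 0 < sg n. Proof. by rewrite sqrtr_gt0. Qed.
Let sg_sqr n : sg n * sg n = gam n. Proof. by rewrite -expr2 sqr_sqrtr // ltW. Qed.
Let sg_le1 n : sg n <= 1. Proof. by rewrite -[leRHS]sqrtr1 ler_sqrt. Qed.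
Let gam_le_sg n : gam n <= sg n. Proof. by rewrite -[leLHS]sg_sqr ler_piMr // ltW. Qed.
Let eta_gt0 n : 0 < eta n. Proof. exact: lt_le_trans (sg_gt0 n) (eta_ge n). Qed.

Let step : exists2 C, 0 <= C & forall n x i j, simp x ->
  l1 (zcorr (gam n.+1) (upd (gam n) x j) j - (zcorr (gam n) x i
     + gam n *: (phi M x *: (zcorr (gam n) x i *m A) - b *: zcorr (gam n) x i)
     + gam n *: noise x i j)) <= C * gam n ^+ 2.
Proof.
have [C C_ge0 hC] := zcorr_step b K0 r_gt0 lifetime_gt0 Mr nuM nur nu_simp C0_ge0.
by exists C => // n x i j sx; apply: hC.
Qed.

Let le_EE n f h : (forall i x, simp x -> f i x <= h i x) -> EE n f <= EE n h.
Proof. exact: chain_exp_le. Qed.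

Lemma gam_ratio : exists kap' N, [/\ 0 <= kap', kap' < 2 * b &
  forall n, (N <= n)%N -> gam n / gam n.+1 <= 1 + kap' * gam n].
Proof.
(* The midpoint leaves room for the error made when the ratio of square roots is squared. *)
pose kap' := (kap + 2 * b) / 2; have kk : kap < kap' by rewrite /kap'; move: kap_lt; lra.
have Ct0 : 0 <= Ct by apply: le_trans (eta_le 0); exact: ltW.
pose D := (kap / 2 + Ct) ^+ 2 + 2; have D0 : 0 < D by rewrite /D ltr_wpDl // sqr_ge0.
have e0 : 0 < (kap' - kap) / D by rewrite divr_gt0 // subr_gt0.
have [N1 h1] := eta_cvg0 e0; exists kap', N1; split.
- exact: ltW (le_lt_trans kap_ge0 kk).
- by rewrite /kap'; move: kap_lt; lra.
move=> n nN; have := eta_ratio n; set s := sg n; set s' := sg n.+1 => hr.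
have s'0 : 0 < s' := sg_gt0 n.+1. have s0 : 0 < s := sg_gt0 n.
rewrite -[gam n in X in X <= _]sg_sqr -[gam n.+1]sg_sqr -/s -/s'.
have -> : s * s / (s' * s') = (s / s') ^+ 2 by field; rewrite gt_eqF.
have q0 : 0 <= s / s' by rewrite divr_ge0 // ltW.
have g0 := gam_gt0 n; have e00 := eta_gt0 n.
have ub : s / s' <= 1 + gam n * (kap / 2 + eta n).
  by move: hr; rewrite ler_norml => /andP[_]; lra.
apply: (@le_trans _ _ ((1 + gam n * (kap / 2 + eta n)) ^+ 2)).
  by rewrite ler_pXn2r ?nnegrE // addr_ge0 // mulr_ge0 ?addr_ge0 ?divr_ge0 // ltW.
have hD : eta n * D <= kap' - kap by rewrite -ler_pdivlMr // h1.
have ge : gam n <= eta n by apply: le_trans (gam_le_sg n) (eta_ge n).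
have hq : (kap / 2 + eta n) ^+ 2 <= (kap / 2 + Ct) ^+ 2.
  by rewrite ler_pXn2r ?nnegrE ?addr_ge0 ?divr_ge0 ?lerD2l // ltW.
have h3 : gam n * (kap / 2 + eta n) ^+ 2 <= eta n * (kap / 2 + Ct) ^+ 2.
  by apply: ler_pM; rewrite ?sqr_ge0 // ltW.
have : gam n * (gam n * (kap / 2 + eta n) ^+ 2 + 2 * eta n) <= gam n * (kap' - kap).
  by rewrite ler_pM2l //; move: hD h3; rewrite /D; lra.
lra.
Qed.

Lemma scaled_exp_moment : exists al B, 0 < al /\
  forall n, EE n (fun i x => expR (al * l1 (V n x i) ^+ 2)) <= B.
Proof.
have [kap' [N [k0 k1 hN]]] := gam_ratio.
have [Cn _ hn] := noise_bounds nu b r_gt0 lifetime_gt0.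
have [Cz _ hz] := zcorr_bounds nu b r_gt0 lifetime_gt0.
have [Cp hp] := phi_bounds lifetime_gt0; have [Cs _ hs] := step.
have [al [B [al0 hB]]] := exp_moment kern0 kern1 gam01 gam_cvg0 hN p0_ge0 p0_sum
  xi_simp noise0 hn hz hp hs E_bound E_diss Ce_gt0 k0 k1 d_gt0.
exists (al / Ce), B; split; first exact: divr_gt0.
move=> n; apply: le_trans (hB n); apply: le_EE => i x sx.
rewrite ler_expR -mulrA ler_wpM2l ?(ltW al0) //.
rewrite /scaled l1Z exprMn real_normK ?num_real // exprVn sqr_sqrtr ?(ltW (gam_gt0 n)) //.
rewrite mulrCA [W _ / _]mulrC ler_wpM2l ?invr_ge0 ?(ltW (gam_gt0 n)) // mulrC ler_pdivrMr //.
by rewrite mulrC E_bound.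
Qed.

Lemma scaled_moment k : exists2 B, 0 <= B &
  forall n, EE n (fun i x => (1 + l1 (V n x i) ^+ 2) ^+ k) <= B.
Proof.
have [al [B [al0 hB]]] := scaled_exp_moment.
(* The successor keeps the quotient meaningful at [k = 0]; only [k%:R * a <= al] matters. *)
pose a := al / k.+1%:R; have a0 : 0 < a by rewrite divr_gt0.
pose D := 1 + a^-1; have D0 : 0 <= D by rewrite addr_ge0 // invr_ge0 ltW.
have ak : k%:R * a <= al.
  by rewrite /a mulrCA ler_piMr ?(ltW al0) // ler_pdivrMr // mul1r ler_nat.
have main (u : R) : 0 <= u -> (1 + u) ^+ k <= D ^+ k * expR (al * u).
  move=> u0; apply: (@le_trans _ _ ((D * expR (a * u)) ^+ k)).
    apply: lerXn2r; rewrite ?nnegrE ?(mulr_ge0 D0) ?expR_ge0 ?(addr_ge0 ler01) //.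
    apply: (@le_trans _ _ (D * (1 + a * u))); last by rewrite ler_wpM2l // expR_ge1Dx.
    have e : a^-1 * (a * u) = u by rewrite mulKf // gt_eqF.
    have p1 : 0 <= a * u by rewrite mulr_ge0 // ltW.
    have p2 : 0 <= a^-1 by rewrite invr_ge0 ltW.
    by move: e; rewrite /D; lra.
  rewrite exprMn -expRM_natl ler_wpM2l ?exprn_ge0 // ler_expR mulrA ler_wpM2r //.
exists (D ^+ k * `|B|); first by rewrite mulr_ge0 ?exprn_ge0.
move=> n; apply: (@le_trans _ _ (EE n (fun i x => D ^+ k * expR (al * l1 (V n x i) ^+ 2)))).
  by apply: le_EE => i x sx; apply: main; rewrite sqr_ge0.
rewrite (chain_expZ kern0) // ler_wpM2l ?exprn_ge0 //.
exact: le_trans (hB n) (ler_norm B).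
Qed.

Let Phi n t := EE n (test_fun gam zcorr co n t).

Lemma chain_charfun_step H : 0 <= H -> exists C N, 0 <= C /\
  forall n t, (N <= n)%N -> l1 t^T <= H ->
  `|Phi n.+1 t - (1 - gam n / 2 * bilin Gm t t) * Phi n (t + gam n *: (L *m t))|
    <= C * (l1 t^T * (gam n * eta n)).
Proof.
move=> H0.
have [Cn Cn0 hn] := noise_bounds nu b r_gt0 lifetime_gt0.
have [Cp hp] := phi_bounds lifetime_gt0; have [Cs Cs0 hs] := step.
have [Cq Cq0 hq] := phi_near b r_gt0 lifetime_gt0 nuM nu_simp th_gt0.
have [Cv Cv0 hv] := variance_near b r_gt0 lifetime_gt0 PhM nuM nu_simp.
have Cp0 : 0 <= Cp by case/andP: (hp nu nu_simp); exact: le_trans.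
have [C C_ge0 hC] := test_fun_step kern0 kern1 gam01 gam_decr gam_diff eta_ge eta_le eta_ratio
  noise0 hn hp hq hv hs (And5 Cn0 Cs0 Cp0 Cq0 Cv0) C0_ge0 kap_ge0 H0.
have [B B0 hB] := scaled_moment 1.
exists (C * B), 0%N; split; first exact: mulr_ge0.
move=> n t _ tH; rewrite /Phi /=.
have lin := chain_expZ kern0 gam01 p0_ge0 xi_simp n.
rewrite -lin -(chain_expB kern0) //; apply: le_trans (chain_exp_norm kern0 gam01 p0_ge0 xi_simp _ _) _.
have X0 : 0 <= l1 t^T * (gam n * eta n).
  by rewrite mulr_ge0 ?l1_ge0 // mulr_ge0 // ltW.
apply: (@le_trans _ _ (EE n (fun i x => C * (l1 t^T * (gam n * eta n)) *
    (1 + l1 (V n x i) ^+ 2) ^+ 1))).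
  by apply: le_EE => i x sx; rewrite expr1 -[leRHS]mulrA; exact: hC.
rewrite lin [leRHS]mulrAC ler_wpM2l ?hB // mulr_ge0 //.
Qed.

Lemma gauss_charfun_step Q H : L^T *m Q + Q *m L = - Gm -> 0 <= H -> exists C N, 0 <= C /\
  forall n t, (N <= n)%N -> l1 t^T <= H ->
  `|expR (- (bilin Q t t / 2)) - (1 - gam n / 2 * bilin Gm t t) *
     expR (- (bilin Q (t + gam n *: (L *m t)) (t + gam n *: (L *m t)) / 2))|
    <= C * (l1 t^T * (gam n * eta n)).
Proof.
move=> hQ H0; have [C [e [C_ge0 e0 hC]]] := gauss_step hQ H0.
have [N hN] := gam_cvg0 e0; exists C, N; split=> // n t nN tH.
apply: le_trans (hC _ _ _ tH) _; first by rewrite gam_gt0 hN.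
rewrite ler_wpM2l // ler_wpM2l ?l1_ge0 // expr2 ler_wpM2l ?(ltW (gam_gt0 n)) //.
exact: le_trans (gam_le_sg n) (eta_ge n).
Qed.

Lemma corrector_near H : 0 <= H -> exists2 C, 0 <= C & forall n x i t, l1 t^T <= H ->
  `|test_fun gam zcorr co n t i x - cos (pairing (V n x i) t)| <= C * l1 t^T * gam n.
Proof.
move=> H0; have [C C_ge0 hC] := bilin_bound_fam co.
exists (C * H); first exact: mulr_ge0.
move=> n x i t tH; rewrite /test_fun mulrDr mulr1 addrC addKr.
rewrite normrM -[leRHS]mul1r; apply: ler_pM; rewrite ?normr_ge0 ?cos_max //.
rewrite normrM gtr0_norm // mulrC ler_wpM2r ?(ltW (gam_gt0 n)) //.
apply: le_trans (hC i t t) _; rewrite -mulrA ler_wpM2l //.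
by rewrite ler_wpM2r ?l1_ge0.
Qed.

(** Both functions equal 1 at [t = 0], and the moments of [V n] control the slope; this starts the
    induction of [charfun_cvg]. *)
Lemma charfun_init Q n H : 0 <= H -> exists2 C, 0 <= C & forall t, l1 t^T <= H ->
  `|Phi n t - expR (- (bilin Q t t / 2))| <= C * l1 t^T.
Proof.
move=> H0; have [B B0 hB] := scaled_moment 1; have [D D0 hD] := corrector_near H0.
have [CQ CQ0 hQ] := bilin_bound Q.
exists (B + D + CQ * H * expR (CQ * H ^+ 2)); first by rewrite !addr_ge0 // !mulr_ge0 ?expR_ge0.
move=> t tH; set h := l1 t^T in tH *; have h0 : 0 <= h by exact: l1_ge0.
set e := expR _.
have -> : Phi n t - e = (Phi n t - 1) - (e - 1) by ring.
apply: le_trans (ler_normB _ _) _; rewrite mulrDl; apply: lerD; last first.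
  have bq : `|- (bilin Q t t / 2)| <= CQ * (h * H).
    rewrite normrN normrM [`|2^-1|]ger0_norm // ler_pdivrMr //.
    apply: le_trans (hQ _ _) _; rewrite -/h -mulrA ler_wpM2l //.
    apply: (@le_trans _ _ (h * H)); first by rewrite ler_wpM2l.
    by rewrite ler_peMr ?mulr_ge0 // ler1n.
  apply: le_trans (expR_dist1 _) _.
  have -> : CQ * H * expR (CQ * H ^+ 2) * h = CQ * (h * H) * expR (CQ * H ^+ 2) by ring.
  apply: ler_pM; rewrite ?normr_ge0 ?expR_ge0 // ler_expR; apply: le_trans bq _.
  by rewrite ler_wpM2l // expr2 ler_wpM2r.
have <- : EE n (fun _ _ => 1) = 1 by exact: chain_exp_cst.
rewrite /Phi -(chain_expB kern0) //; apply: le_trans (chain_exp_norm kern0 gam01 p0_ge0 xi_simp _ _) _.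
apply: (@le_trans _ _ (EE n (fun i x => h * (1 + l1 (V n x i) ^+ 2) ^+ 1 + D * h))).
  apply: le_EE => i x sx; set v := l1 (V n x i); have v0 : 0 <= v by exact: l1_ge0.
  rewrite -(subrK (cos (pairing (V n x i) t)) (test_fun _ _ _ _ _ _ _)) -addrA addrC expr1.
  apply: le_trans (ler_normD _ _) _; apply: lerD.
    have := cos_lipschitz (pairing (V n x i) t) 0; rewrite cos0 subr0 => /le_trans; apply.
    apply: le_trans (pairing_bound _ _) _; rewrite -/v -/h mulrC ler_wpM2l //.
    move: v0; move: (v) => w w0; have := sqr_ge0 (w - 1); lra.
  apply: le_trans (hD n x i t tH) _; rewrite ler_piMr // mulr_ge0 //.
rewrite (chain_expD kern0) // (chain_expZ kern0) // (chain_exp_cst kern0) // mulrDl lerD2r mulrC.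
by rewrite ler_wpM2r.
Qed.

Let c1 := b - kap / 2.
Let c1_gt0 : 0 < c1. Proof. by rewrite /c1; move: kap_lt; lra. Qed.

Let L_diss z : eform E (z *m L) z <= - c1 * eform E z z.
Proof.
rewrite /scaled_drift mulmxBr mul_mx_scalar -scalemxAr -scaleN1r scalerA eformDl !eformZl.
by rewrite mulN1r gerDr mulr_ge0_le0 // invr_ge0 ltW.
Qed.

Lemma scaled_cos_cvg : exists Q, L^T *m Q + Q *m L = - Gm /\
  forall t, (fun n => EE n (fun i x => cos (pairing (V n x i) t))) @ \oo -->
    expR (- (bilin Q t t / 2)).
Proof.
have [Q hQ] := lyapunov_operator_surj E_bound c1_gt0 L_diss (- Gm).
exists Q; split=> // t; apply/cvgrPdist_le => e e0.
have e2 : 0 < e / 2 by rewrite divr_gt0.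
have eta0 n : 0 <= eta n by exact: ltW.
have [N1 h1] := charfun_cvg gam_gt0 gam_cvg0 gam_sum eta_cvg0 eta0 E_bound c1_gt0
  L_diss (cov_mean_ge0 M r b Ph_ge0 Ph_le1 nu_simp) chain_charfun_step
  (fun H => @gauss_charfun_step Q H hQ) (charfun_init Q) t e2.
(* Removing the corrector from the test function costs a multiple of [gam n]. *)
have [D D0 hD] := corrector_near (l1_ge0 t^T).
pose K := D * l1 t^T + 1; have K_gt0 : 0 < K by rewrite ltr_wpDl // mulr_ge0 // l1_ge0.
have eK : 0 < e / 2 / K by rewrite divr_gt0.
have [N2 h2] := gam_cvg0 eK.
exists (maxn N1 N2) => // n /=; rewrite geq_max => /andP[n1 n2].
have -> : e = e / 2 + e / 2 by field.
rewrite -(subrK (Phi n t) (expR _)) -addrA; apply: le_trans (ler_normD _ _) _; apply: lerD.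
  by rewrite distrC h1.
rewrite /Phi -(chain_expB kern0) //; apply: le_trans (chain_exp_norm kern0 gam01 p0_ge0 xi_simp _ _) _.
have : gam n * K <= e / 2 by rewrite -ler_pdivlMr // h2.
apply: le_trans; rewrite -[leRHS](chain_exp_cst kern0 kern1 gam01 p0_ge0 p0_sum xi_simp n).
apply: le_EE => i x sx; apply: le_trans (hD n x i t (lexx _)) _.
by rewrite mulrC ler_wpM2l ?(ltW (gam_gt0 n)) // /K lerDl.
Qed.

(** [Q] is nonnegative as a limit of means of cosines. If it vanished at [t], the step towards
    [t + g *: (L *m t)] would change it by [- g * G] to first order, with [G > 0], making it
    negative. *)
Lemma limit_variance_gt0 Q k : L^T *m Q + Q *m L = - Gm ->
  (forall t, (fun n => EE n (fun i x => cos (pairing (V n x i) t))) @ \oo -->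
    expR (- (bilin Q t t / 2))) ->
  0 < bilin Q (coord_col nu k) (coord_col nu k).
Proof.
move=> hQ hcos.
have Q0 t : 0 <= bilin Q t t.
  suff : expR (- (bilin Q t t / 2)) <= 1.
    by rewrite -[leRHS]expR0 ler_expR oppr_le0 pmulr_lge0 // invr_gt0.
  apply: (ler_cvg_to (hcos t) (cvg_cst (1 : R))); apply: nearW => n.
  by rewrite -[leRHS](chain_exp_cst kern0 kern1 gam01 p0_ge0 p0_sum xi_simp n);
    apply: le_EE => i x sx; exact: cos_le1.
have := cov_mean_coord_neq0 b Ph_ge0 Ph_le1 lifetime_gt0 PhM nuM nur nu_simp th_gt0 k d_gt1 nu_gt0 absorb_gt0.
have := cov_mean_ge0 M r b Ph_ge0 Ph_le1 nu_simp (coord_col nu k).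
set t := coord_col nu k; set G := bilin Gm t t => G0 Gn.
have {G0 Gn} Gp : 0 < G by rewrite lt_neqAle eq_sym Gn.
rewrite lt_neqAle Q0 andbT eq_sym; apply/eqP => z.
pose q2 := bilin Q (L *m t) (L *m t); have q20 : 0 <= q2 by exact: Q0.
(* Small enough that the second-order term [g * q2] stays below [G]. *)
pose g := G / (1 + q2).
have D0 : 0 < 1 + q2 by rewrite ltr_wpDr.
have g0 : 0 < g by rewrite divr_gt0.
have := Q0 (t + g *: (L *m t)); rewrite bilin_perturb hQ z add0r.
have -> : bilin (- Gm) t t = - G by rewrite /bilin mulmxN mulNmx mxE.
rewrite -/q2 expr2 -mulrA -mulrDr pmulr_rge0 // leNgt => /negP; apply.
have : g * (1 + q2) = G by rewrite /g divfK // gt_eqF.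
by move: g0; lra.
Qed.

Let Y n x k : R := (x 0 k - nu 0 k) / sg n.

(** By [psi_coord] the two sides differ by a power of the mass, which is 1 at [nu], and by the
    corrector inside [zcorr]; each costs a factor [sg n]. *)
Lemma coord_near k : exists2 C, 0 <= C & forall n x i, simp x ->
  `|Y n x k - pairing (V n x i) (coord_col nu k)| <= C * (sg n * (1 + l1 (V n x i) ^+ 2)).
Proof.
have [C1 [C1_0 h1 h2]] := lip_mass r_gt0 (1 - b).
have [C2 [C2_0 hc _]] := corr_bounds nu b r_gt0 lifetime_gt0.
have [D D0 hD] := dist_zcorr b r_gt0 lifetime_gt0 nu_simp.
set t := coord_col nu k; set h := l1 t^T; have h0 : 0 <= h by exact: l1_ge0.
exists (C1 * D * 2 * h + C1 * C2 * h); first by rewrite addr_ge0 // !mulr_ge0.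
move=> n x i sx; set s := sg n; have s0 : 0 < s by exact: sg_gt0.
set v := l1 (V n x i); have v0 : 0 <= v by exact: l1_ge0.
have zV : zcorr (gam n) x i = s *: V n x i by rewrite /scaled scalerA divff ?scale1r // gt_eqF.
have e : Y n x k - pairing (V n x i) t =
  (mass r x `^ (1 - b) - mass r nu `^ (1 - b)) * pairing (V n x i) t
   - s * (mass r x `^ (1 - b) * pairing (corr x i) t).
  rewrite /Y -/s (psi_coord b r_gt0 nu_simp k sx) -/t.
  have -> : psi nu r b x = s *: V n x i - gam n *: corr x i by rewrite -zV /zcorr addrK.
  have -> : gam n = s * s by rewrite sg_sqr.
  by rewrite pairingBl !pairingZl (mass_nu nur) powR1; field; rewrite gt_eqF.
rewrite e [leRHS]mulrDl; apply: le_trans (ler_normB _ _) _; apply: lerD.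
  rewrite normrM.
  have d1 : `|mass r x `^ (1 - b) - mass r nu `^ (1 - b)| <= C1 * (D * (s * (1 + v))).
    apply: le_trans (h2 _ _ sx nu_simp) _; rewrite ler_wpM2l //.
    have [_] := hD (gam n) x i sx (gam_01 n); move/le_trans; apply.
    rewrite ler_wpM2l // zV l1Z gtr0_norm // -/v mulrDr mulr1 addrC lerD2r; exact: gam_le_sg.
  apply: le_trans (ler_pM _ _ d1 (pairing_bound _ _)) _ => //; rewrite -/v -/h.
  have -> : C1 * (D * (s * (1 + v))) * (v * h) = C1 * D * h * s * ((1 + v) * v) by ring.
  have -> : C1 * D * 2 * h * (s * (1 + v ^+ 2)) = C1 * D * h * s * (2 * (1 + v ^+ 2)) by ring.
  rewrite ler_wpM2l ?mulr_ge0 //; first exact: ltW.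
  move: (v) v0 => w w0; have := sqr_ge0 (w - 1); lra.
rewrite normrM (gtr0_norm s0) normrM.
have -> : C1 * C2 * h * (s * (1 + v ^+ 2)) = s * (C1 * (C2 * h * (1 + v ^+ 2))) by ring.
rewrite ler_wpM2l ?(ltW s0) //; apply: ler_pM; rewrite ?normr_ge0 ?h1 //.
apply: le_trans (pairing_bound _ _) _; rewrite -/h.
apply: (@le_trans _ _ (C2 * h)); first by rewrite ler_wpM2r // hc.
by rewrite ler_peMr ?mulr_ge0 // lerDl sqr_ge0.
Qed.

Lemma coord_moment_cvg k p : 1 <= p ->
  exists l : R, 0 < l /\ (fun n => EE n (fun i x => `|Y n x k| `^ p)) @ \oo --> l.
Proof.
move=> p1; have [Q [hQ hcos]] := scaled_cos_cvg.
have q0 := limit_variance_gt0 k hQ hcos; set t := coord_col nu k in q0.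
have [C C_ge0 hC] := coord_near k.
apply: (@L_powR_cvg _ (fun n f => EE n (fun i x => f (Y n x k))) (bilin Q t t)) => //.
- by move=> n f h; rewrite -(chain_expD kern0).
- by move=> n c f; rewrite -(chain_expZ kern0).
- by move=> n f h fh; apply: le_EE => i x _; exact: fh.
- by move=> n c; exact: (chain_exp_cst kern0).
- move=> w; have [B B0 hB] := scaled_moment 1.
  have -> : w ^+ 2 * bilin Q t t = bilin Q (w *: t) (w *: t).
    by rewrite bilinZl bilinZr mulrA expr2.
  apply/cvgrPdist_le => e e0; have e2 : 0 < e / 2 by rewrite divr_gt0.
  have /cvgrPdist_le /(_ _ e2) [N1 _ h1] := hcos (w *: t).
  pose K := `|w| * C * B + 1; have K_gt0 : 0 < K by rewrite ltr_wpDl // !mulr_ge0.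
  have e3 : 0 < e / 2 / K by rewrite divr_gt0.
  have [N2 h2] := gam_cvg0 (exprn_gt0 2 e3).
  exists (maxn N1 N2) => // n /=; rewrite geq_max => /andP[n1 n2].
  have hs : sg n * K <= e / 2.
    rewrite -ler_pdivlMr // -(ler_pXn2r (n := 2)) ?nnegrE ?(ltW e3) ?(ltW (sg_gt0 n)) //.
    by rewrite sqr_sqrtr ?(ltW (gam_gt0 n)) // h2.
  have -> : e = e / 2 + e / 2 by field.
  rewrite -(subrK (EE n (fun i x => cos (pairing (V n x i) (w *: t)))) (expR _)) -addrA.
  apply: le_trans (ler_normD _ _) _; apply: lerD; first exact: (h1 n n1).
  rewrite -(chain_expB kern0) //; apply: le_trans (chain_exp_norm kern0 gam01 p0_ge0 xi_simp _ _) _.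
  apply: le_trans hs; apply: (@le_trans _ _ (EE n (fun i x => (`|w| * C * sg n) * (1 + l1 (V n x i) ^+ 2) ^+ 1))).
    apply: le_EE => i x sx; apply: le_trans (cos_lipschitz _ _) _.
    have -> : pairing (V n x i) (w *: t) = w * pairing (V n x i) t.
      by rewrite /pairing -scalemxAr mxE.
    rewrite -mulrBr normrM -!mulrA ler_wpM2l // expr1 distrC; exact: hC.
  rewrite (chain_expZ kern0) //.
  apply: (@le_trans _ _ (`|w| * C * sg n * B)); first by rewrite ler_wpM2l ?hB // !mulr_ge0 // ltW.
  by rewrite mulrAC mulrC ler_wpM2l ?(ltW (sg_gt0 n)) // /K lerDl.
- move=> a; have [B B0 hB] := scaled_moment (2 * a).
  pose h := l1 t^T; have h0 : 0 <= h by exact: l1_ge0.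
  exists ((h + C) ^+ (2 * a) * B) => n.
  apply: (@le_trans _ _ (EE n (fun i x => (h + C) ^+ (2 * a) * (1 + l1 (V n x i) ^+ 2) ^+ (2 * a)))).
    apply: le_EE => i x sx; rewrite -exprMn.
    have -> : Y n x k ^+ (2 * a) = `|Y n x k| ^+ (2 * a).
      by rewrite !exprM real_normK ?num_real.
    set v := l1 (V n x i); have v0 : 0 <= v by exact: l1_ge0.
    have T0 : 0 <= 1 + v ^+ 2 by rewrite addr_ge0 // sqr_ge0.
    have main : `|Y n x k| <= (h + C) * (1 + v ^+ 2).
      rewrite -(subrK (pairing (V n x i) t) (Y n x k)) addrC [leRHS]mulrDl.
      apply: le_trans (ler_normD _ _) _; apply: lerD.
        apply: le_trans (pairing_bound _ _) _; rewrite -/v -/h mulrC ler_wpM2l //.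
        move: (v) v0 => w w0; have := sqr_ge0 (w - 1); lra.
      apply: le_trans (hC n x i sx) _; rewrite ler_wpM2l // ler_piMl //.
    by apply: lerXn2r => //; rewrite nnegrE // mulr_ge0 // addr_ge0.
  by rewrite (chain_expZ kern0) // ler_wpM2l ?hB // exprn_ge0 // addr_ge0.
Qed.

Lemma chain_norm_cvg p : 1 <= p -> exists l : R, 0 < l /\
  (fun n => gam n `^ (- 2^-1) *
     EE n (fun _ x => \sum_k `|x 0 k - nu 0 k| `^ p) `^ p^-1) @ \oo --> l.
Proof.
move=> p1; have p_gt0 : 0 < p by exact: lt_le_trans p1.
pose l k := sval (cid (coord_moment_cvg k p1)).
have l0 k : 0 < l k by case: (svalP (cid (coord_moment_cvg k p1))).
have hl k : (fun n => EE n (fun i x => `|Y n x k| `^ p)) @ \oo --> l k.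
  by case: (svalP (cid (coord_moment_cvg k p1))).
pose S n := \sum_k EE n (fun i x => `|Y n x k| `^ p).
have sl : 0 < \sum_k l k.
  by rewrite (bigD1 (Ordinal d_gt0)) //= ltr_wpDr // sumr_ge0 // => k _; exact: ltW.
have hS : S @ \oo --> \sum_k l k.
  have main (q : seq 'I_d) : (fun n => \sum_(k <- q) EE n (fun i x => `|Y n x k| `^ p)) @ \oo
     --> \sum_(k <- q) l k.
    elim: q => [|k q IH].
      have -> : (fun n => \sum_(k <- [::]) EE n (fun i x => `|Y n x k| `^ p)) = fun=> 0.
        by apply/funext => n; rewrite big_nil.
      rewrite big_nil; exact: cvg_cst.
    have -> : (fun n => \sum_(k0 <- k :: q) EE n (fun i x => `|Y n x k0| `^ p)) =
      (fun n => EE n (fun i x => `|Y n x k| `^ p) + \sum_(k0 <- q) EE n (fun i x => `|Y n x k0| `^ p)).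
      by apply/funext => n; rewrite big_cons.
    rewrite big_cons; apply: cvgD => //; exact: hl.
  exact: main.
exists ((\sum_k l k) `^ p^-1); split; first exact: powR_gt0.
have -> : (fun n => gam n `^ (- 2^-1) *
     EE n (fun _ x => \sum_k `|x 0 k - nu 0 k| `^ p) `^ p^-1) = (fun n => S n `^ p^-1).
  apply/funext => n.
  have Ssum : EE n (fun _ x => \sum_k `|x 0 k - nu 0 k| `^ p) = sg n `^ p * S n.
    have -> : S n = EE n (fun i x => \sum_k `|Y n x k| `^ p).
      have main (q : seq 'I_d) : \sum_(k <- q) EE n (fun i x => `|Y n x k| `^ p) =
          EE n (fun i x => \sum_(k <- q) `|Y n x k| `^ p).
        elim: q => [|k q IH].
          rewrite big_nil -[LHS](chain_exp_cst kern0 kern1 gam01 p0_ge0 p0_sum xi_simp n).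
          by apply: (chain_exp_eq kern0) => // i x _; rewrite big_nil.
        rewrite big_cons IH -(chain_expD kern0) //.
        by apply: (chain_exp_eq kern0) => // i x _; rewrite big_cons.
      exact: main.
    rewrite -(chain_expZ kern0) //; apply: (chain_exp_eq kern0) => // i x _.
    rewrite mulr_sumr; apply: eq_bigr => k _.
    rewrite -powRM ?(ltW (sg_gt0 n)) // /Y normrM normfV (gtr0_norm (sg_gt0 n)).
    by rewrite mulrC divfK // gt_eqF // sg_gt0.
  have S0 : 0 <= S n.
    apply: sumr_ge0 => k _; rewrite -[leLHS](chain_exp_cst kern0 kern1 gam01 p0_ge0 p0_sum xi_simp n).
    by apply: le_EE => i x _; exact: powR_ge0.
  rewrite Ssum powRM ?powR_ge0 // -powRrM mulfV ?gt_eqF // powRr1 ?(ltW (sg_gt0 n)) // mulrA.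
  rewrite powRN powR12_sqrt ?(ltW (gam_gt0 n)) //.
  by rewrite mulVf ?mul1r // gt_eqF // sg_gt0.
exact: powR_cvg_pos.
Qed.

End ChainLimit.

(** * Spectral conditions *)

(** With [z = x + i y] the claim amounts to [(1 - x) * (lam - x) + y ^+ 2 > 0], which on the closed
    disc fails only at [lam]. Points of modulus [lam] are included, as periodic chains demand. *)
Lemma Re_inv_lt (R : realType) (lam : R) (z : R[i]) : 0 < lam < 1 ->
  `|z| <= real_complex R lam -> z != real_complex R lam ->
  complex.Re (1 - z)^-1 < (1 - lam)^-1.
Proof.
move=> /andP[lam0 lam1]; case: z => x y.
rewrite normc_def lecR => zl zn.
have sq : x ^+ 2 + y ^+ 2 <= lam ^+ 2.
  rewrite -[leLHS]sqr_sqrtr ?addr_ge0 ?sqr_ge0 //.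
  by rewrite ler_pXn2r ?nnegrE ?sqrtr_ge0 // ltW.
have xl : x <= lam.
  apply: le_trans (ler_norm x) _; rewrite -(ler_pXn2r (n := 2)) ?nnegrE ?(ltW lam0) //.
  by rewrite real_normK ?num_real //; apply: le_trans sq; rewrite lerDl sqr_ge0.
have main : 0 < (1 - x) * (lam - x) + y ^+ 2.
  have [xlt|xge] := ltP x lam.
    by rewrite ltr_wpDr ?sqr_ge0 // mulr_gt0 // subr_gt0 // (lt_trans xlt).
  have e : x = lam by apply/eqP; rewrite eq_le xl xge.
  move: zn sq; rewrite e subrr mulr0 add0r => zn.
  rewrite gerDl => y2; rewrite lt_neqAle sqr_ge0 andbT eq_sym sqrf_eq0.
  by apply: contraNneq zn => ->; rewrite eqE /= !eqxx.
have d0 : 0 < (1 - x) ^+ 2 + y ^+ 2.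
  by rewrite ltr_wpDr ?sqr_ge0 // exprn_gt0 // subr_gt0 (le_lt_trans xl).
have l0 : 0 < 1 - lam by rewrite subr_gt0.
have -> : complex.Re (1 - (x +i* y)%C)^-1 = (1 - x) / ((1 - x) ^+ 2 + y ^+ 2).
  by rewrite /= sub0r sqrrN.
rewrite ltr_pdivrMr // mulrC ltr_pdivlMr //; move: main; lra.
Qed.

Lemma eigenvalue_in_list (R : realType) (d : nat) (A : 'M[R]_d) (lam : R) (mu : seq R[i]) (z : R[i]) :
  char_poly (map_mx (real_complex R) A) =
    \prod_(w <- real_complex R lam :: mu) ('X - w%:P) ->
  eigenvalue (map_mx (real_complex R) A) z -> z != real_complex R lam -> z \in mu.
Proof.
move=> hc; rewrite eigenvalue_root_char hc root_prod_XsubC inE.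
by move=> /predU1P[->|//]; rewrite eqxx.
Qed.

Lemma finite_margin (R : realType) (T : eqType) (f : T -> R) (a : R) (s : seq T) :
  (forall z, z \in s -> f z < a) -> exists2 e, 0 < e & forall z, z \in s -> f z < a - e.
Proof.
elim: s => [|z s IH] h; first by exists 1.
have [e e0 he] := IH (fun w ws => h w (mem_behead (s := z :: s) ws)).
have hz := h z (mem_head z s).
exists (Num.min e ((a - f z) / 2)); first by rewrite lt_min e0 divr_gt0 // subr_gt0.
move=> w; rewrite inE => /predU1P[->|ws].
  have h2 : Num.min e ((a - f z) / 2) <= (a - f z) / 2 by rewrite ge_min lexx orbT.
  by move: hz h2; move: (Num.min _ _) => v; lra.
by apply: lt_le_trans (he w ws) _; rewrite lerD2l lerN2 ge_min lexx.
Qed.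

(** The list is finite, so the strict inequality of [Re_inv_lt] leaves a margin. This serves
    condition (i), where any positive [b] will do. *)
Lemma spectral_gap (R : realType) (lam : R) (mu : seq R[i]) : 0 < lam < 1 ->
  sorted (fun z w : R[i] => `|w| <= `|z|) (real_complex R lam :: mu) ->
  exists2 b, 0 < b & forall z, z \in mu -> z != real_complex R lam ->
    complex.Re (1 - z)^-1 < (1 - lam)^-1 - b * (1 - lam)^-1.
Proof.
move=> lam01 srt; have /andP[lam0 lam1] := lam01.
have th0 : 0 < (1 - lam)^-1 by rewrite invr_gt0 subr_gt0.
have [e e0 he] : exists2 e, 0 < e & forall z, z \in [seq z <- mu | z != real_complex R lam] ->
    complex.Re (1 - z)^-1 < (1 - lam)^-1 - e.
  apply: finite_margin => z; rewrite mem_filter => /andP[zn zm]; apply: Re_inv_lt => //.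
  have tr : transitive (fun z w : R[i] => `|w| <= `|z|) by move=> u v w uv vw; exact: le_trans vw uv.
  have /allP /(_ z zm) := order_path_min tr srt.
  by rewrite [`|_%:C%C|]ger0_norm // lecR ltW.
exists (e * (1 - lam)); first by rewrite mulr_gt0 // subr_gt0.
move=> z zm zn; rewrite -mulrA mulfV ?mulr1; last by rewrite gt_eqF // subr_gt0.
by apply: he; rewrite mem_filter zn.
Qed.

Lemma rate_bound (R : realType) (lam b : R) (mu : seq R[i]) (z : R[i]) : lam < 1 ->
  b < rate lam mu -> z \in mu ->
  complex.Re (1 - z)^-1 < (1 - lam)^-1 - b * (1 - lam)^-1.
Proof.
move=> lam1; rewrite /rate; set B := \big[_/_]_(_ <- _) _ => hb zm.
have zB : complex.Re (1 - z)^-1 <= B by rewrite /B; apply: (@le_bigmax_seq _ _ _ mu _ z predT (fun w => complex.Re (1 - w)^-1) zm isT).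
have l0 : 0 < 1 - lam by rewrite subr_gt0.
apply: le_lt_trans zB _; rewrite -[X in X - _]mul1r -mulrBl ltr_pdivlMr //; move: hb; lra.
Qed.

Section QuasiStationaryLimit.
Variables (R : realType) (d : nat) (Ph : 'M[R]_d) (nu : 'rV[R]_d) (lam b : R).
Variables (gam eta : nat -> R) (kap C0 Ct : R).
Variables (p0 : 'I_d -> R) (xi : 'I_d -> 'rV[R]_d).
Hypothesis Ph_ge0 : forall i j, 0 <= Ph i j.
Hypothesis Ph_le1 : forall i, \sum_j Ph i j <= 1.
Hypothesis irr : forall B : pred 'I_d, (exists i, B i) ->
  (forall i j, B i -> 0 < Ph i j -> B j) -> forall j, B j.
Hypothesis nu_simp : simp nu.
Hypothesis lam01 : 0 < lam < 1.
Hypothesis nuPh : nu *m Ph = lam *: nu.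
Hypothesis absorb_gt0 : exists i, 0 < absorb Ph i.
Hypothesis d_gt1 : (1 < d)%N.
Hypothesis spectrum : forall z : R[i], eigenvalue (map_mx (real_complex R) Ph) z ->
  z != real_complex R lam -> complex.Re (1 - z)^-1 < (1 - lam)^-1 - b * (1 - lam)^-1.
Hypothesis gam01 : forall n, 0 < gam n <= 1.
Hypothesis gam_decr : forall n, gam n.+1 <= gam n.
Hypothesis gam_cvg0 : forall e, 0 < e -> exists N, forall n, (N <= n)%N -> gam n <= e.
Hypothesis gam_sum : forall B, exists n0, forall n, (n0 <= n)%N -> B <= \sum_(k < n) gam k.
Hypothesis gam_diff : forall n, gam n - gam n.+1 <= C0 * gam n ^+ 2.
Hypothesis eta_ge : forall n, Num.sqrt (gam n) <= eta n.
Hypothesis eta_le : forall n, eta n <= Ct.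
Hypothesis eta_cvg0 : forall e, 0 < e -> exists N, forall n, (N <= n)%N -> eta n <= e.
Hypothesis eta_ratio : forall n,
  `|Num.sqrt (gam n) / Num.sqrt (gam n.+1) - 1 - kap / 2 * gam n| <= gam n * eta n.
Hypothesis C0_ge0 : 0 <= C0.
Hypothesis kap_ge0 : 0 <= kap.
Hypothesis kap_lt : kap < 2 * b.
Hypothesis p0_ge0 : forall i, 0 <= p0 i.
Hypothesis p0_sum : \sum_i p0 i = 1.
Hypothesis xi_simp : forall i, simp (xi i).

Lemma qsd_norm_cvg p : 1 <= p -> exists l : R, 0 < l /\
  (fun n => gam n `^ (- 2^-1) *
     chain_exp (kern Ph) gam p0 xi n (fun _ x => \sum_k `|x 0 k - nu 0 k| `^ p) `^ p^-1)
    @ \oo --> l.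
Proof.
have [nu_ge0 nu_sum] := nu_simp; have /andP[lam0 lam1] := lam01.
pose th := (1 - lam)^-1; have th_gt0 : 0 < th by rewrite invr_gt0 subr_gt0.
pose M := invmx (1%:M - Ph).
have [r [r_gt0 Phr nur]] := right_eigen Ph_ge0 irr nu_ge0 nu_sum lam01 nuPh.
have U := subPh_unit Ph_ge0 lam01 r_gt0 Phr.
have Mr : M *m r = th *: r := resolvent_right Ph_ge0 lam01 r_gt0 Phr.
have nuM : nu *m M = th *: nu := resolvent_left Ph_ge0 lam01 nuPh r_gt0 Phr.
have PhM : Ph *m M = M - 1%:M.
  have e : (1%:M - Ph) *m M = 1%:M by exact: mulmxV.
  by rewrite -e mulmxBl mul1mx opprB addrC subrK.
have lifetime_gt0 i : 0 < lifetime M i 0.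
  exact: lt_le_trans ltr01 (resolvent_const1_ge1 Ph_ge0 Ph_le1 lam01 r_gt0 Phr i).
(* Any value above [b * th] would bring the deflated Perron eigenvalue [th - K0] below
   [th - b * th]. *)
pose K0 := b * th + 1.
have hK : th - K0 < th - b * th by rewrite /K0; lra.
have [E [[C hC] E_diss']] := lyapunov (deflated_spectrum Ph_ge0 irr lam01 r_gt0 Phr nur hK spectrum).
have [Ce Ce_gt0 E_bound] := l1_eform hC.
have E_diss z : eform E (z *m drift_mx M nu r th b K0) z <= 0.
  have -> : z *m drift_mx M nu r th b K0 = z *m (M - K0 *: (r *m nu)) - (th - b * th) *: z.
    by rewrite /drift_mx addrAC mulmxDr mulmxN mul_mx_scalar.
  by rewrite -(scaleNr _ z) eformDl eformZl mulNr subr_le0.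
have nu_gt0 := qsd_gt0 Ph_ge0 irr nu_ge0 nu_sum lam01 nuPh.
exact: (chain_norm_cvg Ph_ge0 Ph_le1 r_gt0 lifetime_gt0 PhM Mr nuM nur nu_simp nu_gt0 th_gt0
  absorb_gt0 d_gt1 E_bound Ce_gt0 E_diss gam01 gam_decr gam_cvg0 gam_sum gam_diff eta_ge eta_le
  eta_cvg0 eta_ratio C0_ge0 kap_ge0 kap_lt p0_ge0 p0_sum xi_simp).
Qed.

End QuasiStationaryLimit.

(** * Step sizes *)

Lemma expR_taylor1_global (R : realType) (u : R) :
  `|expR u - 1 - u| <= u ^+ 2 * expR `|u|.
Proof.
have h := expR_ge1Dx u; rewrite ger0_norm; last by move: h; lra.
have e : expR u - 1 - u <= u * (expR u - 1).
  have : expR u * (1 + - u) <= expR u * expR (- u) by rewrite ler_wpM2l ?expR_ge0 ?expR_ge1Dx.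
  rewrite -expRD subrr expR0; lra.
apply: le_trans e _; apply: le_trans (ler_norm _) _; rewrite normrM -real_normK ?num_real //.
by rewrite expr2 -mulrA ler_wpM2l // expR_dist1.
Qed.

(** With [q] the sequence tending to [kap], [gam n] equals [gam n.+1 * expR (gam n.+1 * q n.+1)], so
    the bounds on differences and ratios are expansions of the exponential; a square root halves the
    exponent. That [gam] tends to 0 comes from the summable squares. *)
Lemma step_size_facts (R : realType) (gam : R^nat) (kap : R) :
  (forall n, 0 < gam n < 1) -> nonincreasing_seq gam ->
  series gam @ \oo --> +oo -> cvgn (series (fun k => gam k ^+ 2)) ->
  0 <= kap ->
  (fun k => (gam k)^-1 * ln (gam k.-1 / gam k)) @ \oo --> kap ->
  [/\ forall n, 0 < gam n <= 1, forall n, gam n.+1 <= gam n,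
      forall e, 0 < e -> exists N, forall n, (N <= n)%N -> gam n <= e &
      forall B, exists n0, forall n, (n0 <= n)%N -> B <= \sum_(k < n) gam k] /\
  exists eta : nat -> R, exists C0 Ct : R,
  [/\ 0 <= C0, forall n, gam n - gam n.+1 <= C0 * gam n ^+ 2 &
   [/\ forall n, Num.sqrt (gam n) <= eta n, forall n, eta n <= Ct,
      forall e, 0 < e -> exists N, forall n, (N <= n)%N -> eta n <= e &
      forall n, `|Num.sqrt (gam n) / Num.sqrt (gam n.+1) - 1 - kap / 2 * gam n| <= gam n * eta n]].
Proof.
move=> g01 gdec gsum gsq kap0; set q := (fun k => _) => hq.
have g0 n : 0 < gam n by case/andP: (g01 n).
have g1 n : gam n <= 1 by case/andP: (g01 n) => _ /ltW.
have dec n : gam n.+1 <= gam n by apply: gdec.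
have s1 n : gam n <= Num.sqrt (gam n).
  by rewrite -{1}[gam n]sqr_sqrtr ?(ltW (g0 n)) // expr2 ler_piMr ?sqrtr_ge0 // -[leRHS]sqrtr1 ler_sqrt.
have gc e : 0 < e -> exists N, forall n, (N <= n)%N -> gam n <= e.
  move=> e0; have /cvgrPdist_le /(_ _ (exprn_gt0 2 e0)) [N _ hN] := cvg_series_cvg_0 gsq.
  exists N => n /hN /=; rewrite sub0r normrN ger0_norm ?sqr_ge0 //.
  by rewrite ler_pXn2r ?nnegrE // ltW.
have gs B : exists n0, forall n, (n0 <= n)%N -> B <= \sum_(k < n) gam k.
  have /cvgryPge /(_ B) [n0 _ h] := gsum; exists n0 => n /h /=.
  by rewrite /series /= big_mkord.
split; first by split=> // n; rewrite g0 g1.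
have [Cq Cq0 hCq] : exists2 C, 0 <= C & forall n, `|q n| <= C.
  have /cvg_seq_bounded [C [_ hC]] : cvgn q by apply/cvg_ex; exists kap.
  exists `|C + 1|; first exact: normr_ge0.
  move=> n; apply: le_trans (ler_norm (C + 1)); apply: hC => //.
  by rewrite ltrDl.
pose C0 := Cq.
have ratio n : gam n = gam n.+1 * expR (gam n.+1 * q n.+1).
  rewrite /q /= mulrA mulfV ?gt_eqF // mul1r lnK ?posrE ?divr_gt0 //.
  by rewrite mulrC divfK // gt_eqF.
have dq n : gam n - gam n.+1 <= Cq * gam n ^+ 2.
  have e : gam n.+1 = gam n * expR (- (gam n.+1 * q n.+1)).
    by rewrite [X in X * _](ratio n) -mulrA -expRD subrr expR0 mulr1.
  have : gam n * (1 + - (gam n.+1 * q n.+1)) <= gam n.+1.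
    by rewrite [leRHS]e ler_wpM2l ?(ltW (g0 n)) // expR_ge1Dx.
  have : gam n.+1 * q n.+1 <= gam n * Cq.
    apply: le_trans (ler_norm _) _; rewrite normrM (gtr0_norm (g0 _)).
    by apply: ler_pM; rewrite ?(ltW (g0 _)) ?hCq ?dec.
  move=> /(ler_wpM2l (ltW (g0 n))); rewrite expr2; lra.
pose K := Cq ^+ 2 * expR Cq + kap * Cq.
have K0 : 0 <= K by rewrite /K; nonneg.
(* [eta] gathers the three small quantities: the lower bound required of it, the second-order
   errors, and the distance of [q n.+1] from its limit. *)
exists (fun n => Num.sqrt (gam n) + (K * gam n + `|q n.+1 - kap|)), Cq, (1 + (K + (Cq + kap))).
split=> //; split.
- by move=> n; rewrite lerDl addr_ge0 // mulr_ge0 // ltW.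
- move=> n; rewrite lerD //; first by rewrite -[leRHS]sqrtr1 ler_sqrt.
  rewrite lerD //; first by rewrite ler_piMr.
  by apply: le_trans (ler_normB _ _) _; rewrite lerD // ger0_norm.
- move=> e e0; have e3 : 0 < e / 3 by rewrite divr_gt0.
  have [N1 h1] := gc _ (exprn_gt0 2 e3).
  have [N2 h2] := gc _ (divr_gt0 e3 (ltr_wpDl K0 ltr01)).
  have /cvgrPdist_le /(_ _ e3) [N3 _ h3] := hq.
  exists (maxn N1 (maxn N2 N3)) => n; rewrite !geq_max => /andP[n1 /andP[n2 n3]].
  have -> : e = e / 3 + (e / 3 + e / 3) by field.
  apply: lerD; last apply: lerD.
  + rewrite -(ler_pXn2r (n := 2)) ?nnegrE ?sqrtr_ge0 ?(ltW e3) //.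
    by rewrite sqr_sqrtr ?(ltW (g0 n)) // h1.
  + have := h2 n n2; rewrite ler_pdivlMr; last by rewrite ltr_wpDl.
    apply: le_trans.
    by rewrite mulrC ler_wpM2l ?(ltW (g0 n)) // lerDl.
  by rewrite distrC; apply: h3; exact: leqW.
move=> n; set u := gam n.+1 * q n.+1 / 2.
have -> : Num.sqrt (gam n) / Num.sqrt (gam n.+1) = expR u.
  rewrite (ratio n) sqrtrM ?(ltW (g0 _)) // mulrAC divff ?mul1r ?gt_eqF ?sqrtr_gt0 //.
  have -> : gam n.+1 * q n.+1 = u + u by rewrite /u; field.
  by rewrite expRD -expr2 sqrtr_sqr ger0_norm ?expR_ge0.
have bu : `|u| <= gam n * Cq.
  rewrite /u normrM [`|2^-1|]ger0_norm // ler_pdivrMr // normrM (gtr0_norm (g0 _)).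
  apply: (@le_trans _ _ (gam n * Cq)); first by apply: ler_pM; rewrite ?(ltW (g0 _)) ?hCq ?dec.
  by rewrite ler_peMr ?mulr_ge0 ?(ltW (g0 _)) // ler1n.
have -> : expR u - 1 - kap / 2 * gam n = (expR u - 1 - u) +
   (gam n.+1 * (q n.+1 - kap) / 2 - kap * (gam n - gam n.+1) / 2) by rewrite /u; field.
have b1 : `|expR u - 1 - u| <= gam n * (Cq ^+ 2 * expR Cq * gam n).
  apply: le_trans (expR_taylor1_global u) _.
  have -> : gam n * (Cq ^+ 2 * expR Cq * gam n) = (gam n * Cq) ^+ 2 * expR Cq by ring.
  apply: ler_pM; rewrite ?sqr_ge0 ?expR_ge0 //.
    by rewrite -real_normK ?num_real // ler_pXn2r ?nnegrE // mulr_ge0 // ltW.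
  by rewrite ler_expR (le_trans bu) // ler_piMl.
have b2 : `|gam n.+1 * (q n.+1 - kap) / 2| <= gam n * `|q n.+1 - kap|.
  rewrite normrM [`|2^-1|]ger0_norm // ler_pdivrMr // normrM (gtr0_norm (g0 _)).
  apply: (@le_trans _ _ (gam n * `|q n.+1 - kap|)); first by rewrite ler_wpM2r.
  by rewrite ler_peMr ?mulr_ge0 ?(ltW (g0 _)) // ler1n.
have b3 : `|kap * (gam n - gam n.+1) / 2| <= gam n * (kap * Cq * gam n).
  have dn : 0 <= gam n - gam n.+1 by rewrite subr_ge0.
  rewrite ger0_norm; last by rewrite divr_ge0 // mulr_ge0.
  rewrite ler_pdivrMr //; apply: (@le_trans _ _ (gam n * (kap * Cq * gam n))).
    have -> : gam n * (kap * Cq * gam n) = kap * (Cq * gam n ^+ 2) by ring.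
    by rewrite ler_wpM2l.
  by rewrite ler_peMr ?ler1n //; have := ltW (g0 n) => ?; nonneg.
apply: le_trans (ler_normD _ _) _; apply: le_trans (lerD b1 (ler_normB _ _)) _.
apply: le_trans (lerD (lexx _) (lerD b2 b3)) _.
have s0 : 0 <= gam n * Num.sqrt (gam n) by rewrite mulr_ge0 ?sqrtr_ge0 // ltW.
move: s0; rewrite /K; lra.
Qed.

(** [chain_exp] peels off the last step, whereas integration over the process splits events from
    time 0 onwards; the fold exposes the first step. *)
Lemma chain_exp_shift (R : realType) (d : nat) (kern : 'rV[R]_d -> 'I_d -> 'I_d -> R)
    (gam : nat -> R) p0 xi n f :
  chain_exp kern gam p0 xi n f =
  chain_exp kern gam p0 xi 0
    (foldr (fun m => chain_step kern (gam m)) f (iota 0 n)).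
Proof.
elim: n f => [//|n IHn] f; rewrite [LHS]/= IHn.
by rewrite -[in RHS](addn1 n) iotaD foldr_cat add0n.
Qed.

(** * Identification of the process with the chain *)

Section Fibers.
Variables (R : realType) (dis : measure_display) (Omega : measurableType dis).
Variables (Pr : probability Omega R) (I : finType) (Y : Omega -> I).
Hypothesis mY : forall j, measurable (Y @^-1` [set j]).

(** Measurability on [B] is part of the conclusion because it is obtained fibre by fibre, in the
    same induction as the integral. *)
Lemma integral_fibers (B : set Omega) (h : Omega -> \bar R) : measurable B ->
  (forall w, (0 <= h w)%E) ->
  (forall j, measurable_fun (B `&` Y @^-1` [set j]) h) ->
  measurable_fun B h /\
  (\int[Pr]_(w in B) h w = \sum_j \int[Pr]_(w in B `&` Y @^-1` [set j]) h w)%E.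
Proof.
move=> mB h0 mh; pose F j := B `&` Y @^-1` [set j].
have mF j : measurable (F j) by exact: measurableI.
have BE : B = \big[setU/set0]_(j <- enum I) F j.
  rewrite -bigcup_seq; apply/seteqP; split=> [w Bw|w [j _ []] //].
  by exists (Y w); rewrite //= mem_enum.
have mhB : measurable_fun B h.
  rewrite BE; elim: (enum I) => [|j s IHs]; first by rewrite big_nil; exact: measurable_fun_set0.
  have mS : measurable (\big[setU/set0]_(k <- s) F k) by apply: bigsetU_measurable => k _.
  by rewrite big_cons; apply/(measurable_funU _ (mF j) mS); split=> //; exact: mh.
split=> //; rewrite {1}BE ge0_integral_bigsetU ?enum_uniq -?BE //.
- by rewrite big_enum.
- by move=> i j _ _ [w [[_ /= <-] [_ /= <-]]].
Qed.

End Fibers.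

Section PathIdentification.
Variables (R : realType) (dis : measure_display) (Omega : measurableType dis).
Variables (Pr : probability Omega R) (d : nat).
Variables (kern : 'rV[R]_d -> 'I_d -> 'I_d -> R) (gam : nat -> R).
Variables (X : nat -> Omega -> 'I_d) (x : nat -> Omega -> 'rV[R]_d).
Hypothesis mX : forall n j, measurable (X n @^-1` [set j]).
Hypothesis x0X0 : forall w w', X 0%N w = X 0%N w' -> x 0%N w = x 0%N w'.
Hypothesis x_upd : forall n w, x n.+1 w = upd (gam n) (x n w) (X n.+1 w).
Hypothesis X_cond : forall n j B, <<s past X n >> B ->
  (\int[Pr]_(w in B) (kern (x n w) (X n w) j)%:E = Pr (X n.+1 @^-1` [set j] `&` B))%E.

(** On such an event of the past the transition probability is a constant, so the conditional law
    becomes a product formula; splitting by the next state gives atoms again. *)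
Let atom n (B : set Omega) i v := [/\ <<s past X n >> B, measurable B &
  forall w, B w -> X n w = i /\ x n w = v].

Let atom_next n B i v j : atom n B i v ->
  atom n.+1 (B `&` X n.+1 @^-1` [set j]) j (upd (gam n) v j) /\
  Pr (B `&` X n.+1 @^-1` [set j]) = ((kern v i j)%:E * Pr B)%E.
Proof.
move=> [sB mB hB]; split; last first.
  rewrite setIC -X_cond // (@eq_integral _ _ _ _ _ (cst (kern v i j)%:E)).
    by rewrite integral_cst.
  by move=> w; rewrite inE => /hB [-> ->].
split; last 1 first.
- by move=> w [/hB[Xi xv] /= Xj]; rewrite x_upd xv Xj.
- apply: (@measurableI _ (g_sigma_algebraType (past X n.+1))).
    apply: sub_smallest2r sB; first exact: smallest_sigma_algebra.
    by move=> A [k [C [kn ->]]]; exists k, C; split=> //; exact: leqW.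
  by apply: sub_sigma_algebra; exists n.+1, [set j].
- exact: measurableI.
Qed.

Let iter_step f n k := foldr (fun m => chain_step kern (gam m)) f (iota n k).

Let integral_atom f : (forall i v, 0 <= f i v) -> forall k n B i v, atom n B i v ->
  let h := fun w => (f (X (n + k)%N w) (x (n + k)%N w))%:E in
  measurable_fun B h /\
  (\int[Pr]_(w in B) h w = (iter_step f n k i v)%:E * Pr B)%E.
Proof.
move=> f0; elim=> [|k IHk] n B i v aB /=.
  have [sB mB hB] := aB; rewrite addn0.
  have hE w : w \in B -> (f (X n w) (x n w))%:E = cst (f i v)%:E w.
    by rewrite inE => /hB [-> ->].
  split; first by apply: eq_measurable_fun (measurable_cst _) => w wB; rewrite hE.
  by rewrite (eq_integral _ _ hE) integral_cst.
have [_ mB _] := aB; rewrite addnS -addSn.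
set h := fun w => _.
have [mhB ->] := @integral_fibers R _ _ Pr _ (X n.+1) (mX n.+1) B h mB
  (fun w => f0 _ _) (fun j => (IHk n.+1 _ _ _ (atom_next j aB).1).1).
split=> //; have PrB : Pr B = (fine (Pr B))%:E by rewrite fineK // fin_num_measure.
under eq_bigr => j _.
  have [aj Pj] := atom_next j aB.
  rewrite (IHk _ _ _ _ aj).2 Pj PrB -!EFinM mulrA [X in (X * _)%R]mulrC; over.
by rewrite sumEFin -mulr_suml [in RHS]PrB.
Qed.

Let p0 i := fine (Pr (X 0%N @^-1` [set i])).
(** The initial measure depends on the initial state alone, so any outcome of the fibre computes it.
    On an empty fibre the default outcome is harmless, since [p0 i = 0] there. *)
Let xi i := x 0%N (xget point (X 0%N @^-1` [set i])).

Lemma path_init_ge0 i : 0 <= p0 i.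
Proof. by rewrite fine_ge0. Qed.

Lemma path_init_sum : \sum_i p0 i = 1.
Proof.
apply: EFin_inj; rewrite -sumEFin -(@probability_setT _ _ _ Pr).
have m1 j : measurable_fun (setT `&` X 0%N @^-1` [set j]) (cst 1%E : Omega -> \bar R).
  exact: measurable_cst.
have [_] := @integral_fibers R _ _ Pr _ (X 0%N) (mX 0%N) setT (cst 1%E) measurableT (fun _ => lee01) m1.
rewrite integral_cst // mul1e => ->; apply: eq_bigr => i _.
by rewrite setTI integral_cst // mul1e fineK // fin_num_measure.
Qed.

Lemma path_expectation n f : (forall i v, 0 <= f i v) ->
  (\int[Pr]_w (f (X n w) (x n w))%:E = (chain_exp kern gam p0 xi n f)%:E)%E.
Proof.
move=> f0.
have a0 j : atom 0%N (setT `&` X 0%N @^-1` [set j]) j (xi j).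
  rewrite setTI; split=> //.
    by apply: sub_sigma_algebra; exists 0%N, [set j].
  move=> w Xj; split=> //; apply: x0X0; rewrite Xj.
  by have := @xgetPex _ point (X 0%N @^-1` [set j]) (ex_intro _ w Xj) => /= ->.
pose h w := (f (X n w) (x n w))%:E.
have [_ ->] := @integral_fibers R _ _ Pr _ (X 0%N) (mX 0%N) setT h measurableT (fun w => f0 _ _)
  (fun j => (integral_atom f0 n (a0 j)).1).
rewrite chain_exp_shift /= -sumEFin; apply: eq_bigr => j _.
rewrite (integral_atom f0 n (a0 j)).2 setTI EFinM fineK ?fin_num_measure // muleC //.
Qed.

End PathIdentification.

(** * Matrix form of the absorbed chain *)

Lemma sum_star (R : nmodType) (F : finType) (o : F) (g : F -> R) :
  \sum_i g i = g o + \sum_(i : star o) g (val i).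
Proof.
rewrite (bigD1 o) //=; congr (_ + _).
rewrite (reindex_omap (val : star o -> F) insub) => [|i io]; last by rewrite (insubT (fun i => i != o) io).
by apply: eq_bigl => i; rewrite valK eqxx andbT (valP i).
Qed.

Lemma sum_enum_val (R : nmodType) (I : finType) (g : I -> R) :
  \sum_(k < #|I|) g (enum_val k) = \sum_i g i.
Proof. by rewrite [RHS](reindex _ (onW_bij _ (enum_val_bij I))). Qed.

Section AbsorbedChain.
Variables (R : realType) (F : finType) (o : F) (P : F -> F -> R).
Hypothesis hP : absorbed_chain o P.

Local Notation Ph := (mx_of (hat (o := o) P)).

Let P0 i j : 0 <= P i j. Proof. by case: hP => [[]]. Qed.

Lemma hat_mx_ge0 i j : 0 <= Ph i j.
Proof. by rewrite mxE; exact: P0. Qed.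

Lemma absorb_hat i : absorb Ph i = P (val (enum_val i)) o.
Proof.
have [[_ P1] _ _ _] := hP; rewrite /absorb -(P1 (val (enum_val i))) (sum_star o).
have -> : \sum_j Ph i j = \sum_(j : star o) P (val (enum_val i)) (val j).
  by rewrite -[RHS]sum_enum_val; apply: eq_bigr => j _; rewrite mxE.
by rewrite addrK.
Qed.

Lemma hat_mx_le1 i : \sum_j Ph i j <= 1.
Proof. by rewrite -subr_ge0 -/(absorb Ph i) absorb_hat; exact: P0. Qed.

Lemma absorb_hat_gt0 : exists i, 0 < absorb Ph i.
Proof.
have [_ _ [i hi] _] := hP; exists (enum_rank i).
by rewrite absorb_hat enum_rankK.
Qed.

(** A path between states of the class cannot pass through [o], which is absorbing, so it stays in
    the closed set [B]. Were [j] outside, every term of the series from [i] to [j] would vanish. *)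
Lemma hat_mx_irreducible (B : pred 'I_#|star o|) : (exists i, B i) ->
  (forall i j, B i -> 0 < Ph i j -> B j) -> forall j, B j.
Proof.
have [_ Po _ irr] := hP; move=> [i Bi] clB j.
apply: contraT => Bj; have := irr (enum_val i) (enum_val j).
rewrite eseries0 ?ltxx // => k _ _; congr (_%:E).
suff main l (v : star o) : mpow P l (val (enum_val i)) (val v) != 0 -> B (enum_rank v).
  by apply: contraNeq Bj => /main; rewrite enum_valK.
elim: l v => [|l IHl] v.
  rewrite /mpow expr0 mxE (inj_eq enum_rank_inj) (inj_eq val_inj).
  by have [<-|_] := eqVneq (enum_val i) v; rewrite ?enum_valK //= eqxx.
rewrite /mpow exprSr -mulmxE mxE => nz.
have [w nw] : exists w, (mx_of P ^+ l) (enum_rank (val (enum_val i))) w *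
    mx_of P w (enum_rank (val v)) != 0.
  apply/existsP; apply: contraNT nz => /existsPn h; apply/eqP; apply: big1 => w _.
  by apply/eqP; have := h w; rewrite negbK.
move: nw; rewrite mulf_eq0 negb_or mxE enum_rankK => /andP[n1 n2].
have wo : enum_val w != o by apply: contraNneq n2 => ->; rewrite Po.
have := IHl (Sub (enum_val w) wo); rewrite /mpow SubK enum_valK => /(_ n1) Bw.
apply: clB Bw _; rewrite mxE !enum_rankK /hat SubK.
by rewrite lt_neqAle eq_sym n2 P0.
Qed.

End AbsorbedChain.

(** The sets saturated for the fibres of [X 0] form a sigma-algebra containing the generators. *)
Lemma past0_saturated (Omega : pointedType) (I : Type) (X : nat -> Omega -> I) (A : set Omega) w w' :
  <<s past X 0 >> A -> X 0%N w = X 0%N w' -> A w -> A w'.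
Proof.
move=> sA; suff : forall w w', X 0%N w = X 0%N w' -> A w -> A w' by apply.
have : [set A : set Omega | forall w w', X 0%N w = X 0%N w' -> A w -> A w'] A; last by [].
move: sA; apply: smallest_sub; last first.
  by move=> _ [k [C [k0 ->]]] u u' /=; move: k0; rewrite leqn0 => /eqP -> ->.
split=> //.
- by move=> C hC u u' e [_ nC]; split=> // Cu'; apply: nC; exact: hC (esym e) Cu'.
- by move=> C hC u u' e [n _ Cn]; exists n => //; exact: hC e Cn.
Qed.

Theorem corollary1p5 (R : realType)
  (F : finType) (o : F) (P : F -> F -> R)
  (nu : star o -> R) (lambda : R) (mu : seq (complex R)) (gamma : R^nat)
  (d : measure_display) (Omega : measurableType d) (Pr : probability Omega R)
  (X : nat -> Omega -> star o) (x : nat -> Omega -> star o -> R)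
  (hd : (2 <= #|star o|)%N)
  (hP : absorbed_chain o P)
  (hnu : quasi_stationary P nu lambda)
  (hmu : eigenvalue_list (hat (o := o) P) lambda mu)
  (hgamma : step_sequence gamma)
  (hX : reinforced_process P gamma Pr X x)
  (hcond : condition_i gamma \/ condition_ii gamma (rate lambda mu)) :
  forall p : R, 1 <= p ->
    exists C : R, 0 < C /\
      (fun n : nat =>
         gamma n `^ (- 2^-1) *
         fine ('E_Pr [fun w => \sum_i `|x n w i - nu i| `^ p]) `^ p^-1)
        @ \oo --> C.
Proof.
move=> p p1; have [[nu0 nu1] lam01 nuP] := hnu; have [hchar hsort] := hmu.
have [g01 gdec _ _] := hgamma; have /andP[lam0 lam1] := lam01.
(* Under (i) [kap = 0] and [b] comes from [spectral_gap]; under (ii) [b] is the midpoint of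
   [kap / 2] and the rate. *)
have [kap [b [kap0 kapb spectrum [gsum gsq hq]]]] : exists kap b, [/\ 0 <= kap, kap < 2 * b,
    (forall z, z \in mu -> z != real_complex R lambda ->
       complex.Re (1 - z)^-1 < (1 - lambda)^-1 - b * (1 - lambda)^-1) &
    [/\ series gamma @ \oo --> +oo, cvgn (series (fun k => gamma k ^+ 2)) &
      (fun k => (gamma k)^-1 * ln (gamma k.-1 / gamma k)) @ \oo --> kap]].
  case: hcond => [[c1 c2 c3]|[c1 c2 [gs [gs0 gsR c3]]]].
    have [b b0 hb] := spectral_gap lam01 hsort.
    by exists 0, b; split=> //; rewrite mulr_gt0.
  exists gs^-1, ((gs^-1 / 2 + rate lambda mu) / 2); split=> //.
  - by rewrite invr_ge0 ltW.
  - by rewrite mulrC divfK ?pnatr_eq0 //; move: gsR; move: (gs^-1) (rate _ _) => u v; lra.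
  move=> z zm _; apply: (rate_bound lam1 _ zm).
  by move: gsR; move: (gs^-1) (rate _ _) => u v; lra.
have [[gam01 gam_decr gam_cvg0 gam_sum] [eta [C0 [Ct [C0_ge0 gam_diff
  [eta_ge eta_le eta_cvg0 eta_ratio]]]]]] := step_size_facts g01 gdec gsum gsq kap0 hq.
pose Ph := mx_of (hat (o := o) P).
pose nuv : 'rV[R]_#|star o| := \row_k nu (enum_val k).
pose X' n w := enum_rank (X n w).
pose x' n w : 'rV[R]_#|star o| := \row_k x n w (enum_val k).
have nu_simp : simp nuv.
  split=> [k|]; first by rewrite mxE.
  by under eq_bigr do rewrite mxE; rewrite sum_enum_val.
have nuPh : nuv *m Ph = lambda *: nuv.
  apply/rowP => k; rewrite !mxE -nuP -(sum_enum_val (fun i => nu i * hat P i (enum_val k))).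
  by apply: eq_bigr => i _; rewrite !mxE.
have [mX xs x0 Xc xrec] := hX.
have x'_simp n w : simp (x' n w).
  have [x_ge0 x_sum] := xs n w; split=> [k|]; first by rewrite mxE.
  by under eq_bigr do rewrite mxE; rewrite sum_enum_val.
have X'E n j : X' n @^-1` [set j] = X n @^-1` [set enum_val j].
  by apply/seteqP; split=> [w /= <-|w /= Xw]; rewrite /X' ?Xw ?enum_rankK ?enum_valK.
have mX' n j : measurable (X' n @^-1` [set j]) by rewrite X'E; exact: mX.
have x0X0 w w' : X' 0%N w = X' 0%N w' -> x' 0%N w = x' 0%N w'.
  move=> /enum_rank_inj e; apply/rowP => k; rewrite !mxE.
  (* Level sets of the initial measure lie in the sigma-algebra of the initial state, hence are
     saturated: the measure is a function of that state. *)
  have := x0 (enum_val k) measurableT [set x 0%N w (enum_val k)] (measurable_set1 _).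
  by rewrite setTI => /past0_saturated /(_ e) /= ->.
have x_upd n w : x' n.+1 w = upd (gamma n) (x' n w) (X' n.+1 w).
  apply/rowP => k; rewrite !mxE xrec; congr (_ + _ * _%:R).
  by rewrite eqxx -(inj_eq enum_val_inj) enum_rankK eq_sym.
have X_cond n j B : <<s past X' n >> B ->
    (\int[Pr]_(w in B) (kern Ph (x' n w) (X' n w) j)%:E = Pr (X' n.+1 @^-1` [set j] `&` B))%E.
  move=> sB; have [_ hc] := Xc n (enum_val j).
  rewrite X'E -hc; last first.
    apply: sub_smallest2r sB; first exact: smallest_sigma_algebra.
    by move=> _ [k [C [kn ->]]]; exists k, (enum_rank @^-1` C).
  apply: eq_integral => w _; congr (_%:E).
  by rewrite /kern /kernelK (absorb_hat hP) !mxE enum_rankK.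
pose f (_ : 'I_#|star o|) (v : 'rV[R]_#|star o|) := \sum_k `|v 0 k - nuv 0 k| `^ p.
have f0 i v : 0 <= f i v by apply: sumr_ge0 => k _; exact: powR_ge0.
have spec z : eigenvalue (map_mx (real_complex R) Ph) z -> z != real_complex R lambda ->
    complex.Re (1 - z)^-1 < (1 - lambda)^-1 - b * (1 - lambda)^-1.
  by move=> ez zn; apply: spectrum => //; apply: eigenvalue_in_list hchar ez zn.
pose xi i := x' 0%N (xget point (X' 0%N @^-1` [set i])).
have xi_simp i : simp (xi i) by exact: x'_simp.
have [l [l0 hl]] := qsd_norm_cvg (hat_mx_ge0 hP) (hat_mx_le1 hP) (hat_mx_irreducible hP)
  nu_simp lam01 nuPh (absorb_hat_gt0 hP) hd spec gam01 gam_decr gam_cvg0 gam_sum gam_diff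
  eta_ge eta_le eta_cvg0 eta_ratio C0_ge0 kap0 kapb (path_init_ge0 Pr X') (path_init_sum Pr mX')
  xi_simp p1.
exists l; split=> //; congr (_ @ \oo --> l): hl.
apply/funext => n; congr (_ * _ `^ _).
rewrite expectation.unlock; have := path_expectation mX' x0X0 x_upd X_cond n f0.
rewrite -/Ph => /(congr1 fine) /= <-; congr fine; apply: eq_integral => w _; congr (_%:E).
by rewrite /f -[RHS]sum_enum_val; apply: eq_bigr => k _; rewrite !mxE.
Qed.
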